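(* Let $\Omega\subset\mathbb{R}^3$ be an arbitrary nonempty open set. For all $u\in\widehat{H}_0^1(\Omega)$ with $\Delta u\in L^2(\Omega)$, there holds $$\sup_{\Omega}|u|\le \frac{1}{\sqrt{2\pi}}\,\|\nabla u\|^{1/2}\,\|\Delta u\|^{1/2}.$$ Moreover, the constant $1/\sqrt{2\pi}$ is optimal for each $\Omega$: for every nonempty open set $\Omega\subset\mathbb{R}^3$ and every real $C<1/\sqrt{2\pi}$ there exists $u\in\widehat{H}_0^1(\Omega)$ with $\Delta u\in L^2(\Omega)$ such that $\sup_{\Omega}|u|> C\,\|\nabla u\|^{1/2}\|\Delta u\|^{1/2}$.
   Context: Functions are real-valued. $\|\cdot\|$ denotes the $L^2(\Omega)$ norm, so $\|\nabla u\|^2=\int_\Omega|\nabla u|^2\,dx$ and $\|\Delta u\|^2=\int_\Omega|\Delta u|^2\,dx$. The homogeneous Sobolev space $\widehat{H}_0^1(\Omega)$ is the completion of $C_0^\infty(\Omega)$ (smooth functions with compact support in $\Omega$) in the Dirichlet norm $\|\nabla\cdot\|$; by the Sobolev inequality in $\mathbb{R}^3$ its elements are identified with functions in $L^6(\Omega)$ having weak gradient in $L^2(\Omega)$. $\Delta$ is the Laplacian in the sense of distributions on $\Omega$. Since elements of $\widehat{H}_0^1(\Omega)$ are defined up to null sets, $\sup_\Omega|u|$ is understood as the essential supremum (equivalently, the supremum of the continuous representative of $u$). *)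

(* Defs.v *)
From HB Require Import structures.
From mathcomp Require Import all_boot all_order all_algebra.
From mathcomp Require Import all_classical all_reals all_analysis.
Set Implicit Arguments.
Unset Strict Implicit.
Unset Printing Implicit Defensive.
Import Order.TTheory GRing.Theory Num.Theory.
Import numFieldNormedType.Exports.
Local Open Scope classical_set_scope.
Local Open Scope ring_scope.

Notation R3 R := (R * R * R)%type.

(* The product sigma-algebra of the Borel sets of R is the Borel sigma-algebra
   of R^3 for the (product) topology of R * R * R. *)
Definition mu3 (R : realType) :
    {measure set (measurableTypeR R * measurableTypeR R * measurableTypeR R)%type
     -> \bar R} :=
  ((@lebesgue_measure R \x @lebesgue_measure R) \x @lebesgue_measure R)%E.

Definition e3 (R : realType) (i : 'I_3) : R3 R :=
  ((i == 0%N :> nat)%:R, (i == 1%N :> nat)%:R, (i == 2%N :> nat)%:R).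

Definition partial (R : realType) (i : 'I_3) (f : R3 R -> R) : R3 R -> R :=
  'D_(e3 R i) f.

Definition iter_partial (R : realType) (s : seq 'I_3) (f : R3 R -> R) :
    R3 R -> R :=
  foldr (@partial R) f s.

(* 'D_v is a total operator, hence the explicit derivability clause. *)
Definition smooth (R : realType) (f : R3 R -> R) : Prop :=
  forall s : seq 'I_3,
    continuous (iter_partial s f) /\
    forall (i : 'I_3) (x : R3 R), derivable (iter_partial s f) x (e3 R i).

(* Elements of C_0^oo(Omega), extended by 0 to the whole of R^3. *)
Definition test_function (R : realType) (Omega : set (R3 R)) (phi : R3 R -> R) :
    Prop :=
  let supp := closure [set x | phi x != 0] in
  [/\ smooth phi, compact supp & supp `<=` Omega].

(* Functions on Omega are represented by functions on R^3 whose values outside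
   Omega are irrelevant: f \_ Omega is f on Omega and 0 elsewhere, so
   f \_ Omega is measurable iff f is measurable on Omega, and, norms being
   nonnegative, the norms below are those of Omega; for p = +oo this is the
   essential supremum of `|f| on Omega. *)
Definition in_L (R : realType) (Omega : set (R3 R)) (p : \bar R)
    (f : R3 R -> R) : Prop :=
  f \_ Omega \in Lfun (mu3 R) p.

Definition normL (R : realType) (Omega : set (R3 R)) (p : \bar R)
    (f : R3 R -> R) : \bar R :=
  'N[mu3 R]_p [EFin \o (f \_ Omega)]%E.

(* Vector fields F have components F 0, F 1, F 2. *)
Definition euclid (R : realType) (F : 'I_3 -> R3 R -> R) : R3 R -> R :=
  fun x => Num.sqrt (\sum_(i < 3) F i x ^+ 2).

Definition grad (R : realType) (f : R3 R -> R) : 'I_3 -> R3 R -> R :=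
  fun i => partial i f.

Definition laplacian (R : realType) (f : R3 R -> R) : R3 R -> R :=
  fun x => \sum_(i < 3) partial i (partial i f) x.

Definition weak_gradient (R : realType) (Omega : set (R3 R))
    (u : R3 R -> R) (Du : 'I_3 -> R3 R -> R) : Prop :=
  forall (phi : R3 R -> R) (i : 'I_3), test_function Omega phi ->
    \int[mu3 R]_(x in Omega) (u x * partial i phi x) =
    - \int[mu3 R]_(x in Omega) (Du i x * phi x).

Definition distr_laplacian (R : realType) (Omega : set (R3 R))
    (u Lu : R3 R -> R) : Prop :=
  forall phi : R3 R -> R, test_function Omega phi ->
    \int[mu3 R]_(x in Omega) (u x * laplacian phi x) =
    \int[mu3 R]_(x in Omega) (Lu x * phi x).

(* u belongs to the completion of C_0^oo(Omega) in the Dirichlet norm, realized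
   inside L^6(Omega) by the Sobolev inequality, and Du is its weak gradient
   (unique up to null sets): a Dirichlet-Cauchy sequence of test functions
   converges in L^6(Omega), its gradients converge in L^2(Omega), and it is
   identified with its L^6 limit. *)
Definition hatH01 (R : realType) (Omega : set (R3 R))
    (u : R3 R -> R) (Du : 'I_3 -> R3 R -> R) : Prop :=
  [/\ in_L Omega 6%:E u,
      forall i : 'I_3, in_L Omega 2%:E (Du i),
      weak_gradient Omega u Du &
      exists phi : nat -> R3 R -> R,
        [/\ forall n, test_function Omega (phi n),
            normL Omega 6%:E (fun x => phi n x - u x)
              @[n --> \oo] --> 0%E &
            normL Omega 2%:E (euclid (fun i x => grad (phi n) i x - Du i x))
              @[n --> \oo] --> 0%E]].

(* Main.v *)
Require Import Defs.
From HB Require Import structures.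
From mathcomp Require Import all_boot all_order all_algebra.
From mathcomp Require Import all_classical all_reals all_analysis.
From mathcomp Require Import measurable_realfun ess_sup_inf ring lra.
Set Implicit Arguments.
Unset Strict Implicit.
Unset Printing Implicit Defensive.
Import Order.TTheory GRing.Theory Num.Theory.
Import numFieldNormedType.Exports.
Local Open Scope classical_set_scope.
Local Open Scope ring_scope.

(* Put s = |x - a|, q = exp (- mu s) / s and h = 1 / s - q. Off the pole
   - Delta h = mu^2 q, and the integral of mu^-2 |grad h|^2 + q^2 is 4 pi / mu.
   Formally 4 pi u(a) is the integral of grad u . grad h - q Delta u, whence for
   every lam > 0
     |u(a)| <= lam / (2 mu) + (mu^2 |grad u|^2 + |Delta u|^2) / (8 pi lam)
   with L^2 norms on the right, and the best lam and mu give the constant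
   1 / sqrt (2 pi). Neither 1 / s nor q vanishes on the boundary of Omega; this is
   repaired by Kato's inequality, i.e. by arguing with |u| instead of u, so that
   q u / |u| can be used as a test function. The kernels are regularised by
   replacing s with sqrt (s^2 + e^2), and |u| with sqrt (u^2 + k^2) - k.
   Conversely equality holds for h on the whole space. As mu tends to infinity h
   becomes concentrated at a, and a smooth truncation of k h at a fixed positive
   level, which is supported near a, almost attains the constant in Omega. *)

(** * Finite orders of smoothness and their stability *)

Section smooth_functions.
Context {R : realType}.
Implicit Types (f g : R3 R -> R) (i : 'I_3) (x : R3 R).

(** The kernel [h] has a variational origin: maximising u(a) at a given value of mu^2 |grad u|^2 +
    |Delta u|^2 leads to Delta^2 u - mu^2 Delta u = c delta_a, which [h] solves on the whole space.
    Nothing is known about u near the boundary of Omega, so u enters only through test functions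
    phi_n, and this dictates the order of the choices. The regularisations e and k leave errors of
    the form K |grad phi_n - grad u|^2 with K unbounded as e, k tend to 0, so n must come after
    them. Yet the scale e at which local means of |phi_n| recover its values depends on n. Two
    members of the sequence break the circle: phi_N fixes e, then e fixes a later phi_m, and the
    means of |phi_N| and |phi_m| are compared through L^6 convergence. This comparison holds off a
    small set of poles only, hence the conclusion that level sets of |u| are null; no regularity of
    u is used. For optimality the energy mu^2 |grad u|^2 + |Delta u|^2 of the truncated kernel is at
    most about 4 pi k^2 mu^3 while its peak is k mu + O(1), so every energy error only has to be
    O(mu^2). *)

Fixpoint Cn (n : nat) (f : R3 R -> R) : Prop :=
  continuous f /\ if n is m.+1 then
    forall i, (forall x, derivable f x (e3 R i)) /\ Cn m (partial i f)
  else True.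

Lemma Cn_continuous n f : Cn n f -> continuous f.
Proof. by case: n => [|n] []. Qed.

Lemma CnW n f : Cn n.+1 f -> Cn n f.
Proof.
elim: n f => [|n IH] f; first by case.
move=> [cf Hf]; split => // i; split; first by have [] := Hf i.
by apply: IH; have [] := Hf i.
Qed.

Lemma smooth_partial i f : smooth f -> smooth (partial i f).
Proof.
move=> sf s; have := sf (rcons s i); rewrite /iter_partial foldr_rcons.
by [].
Qed.

(** Counting orders with [Cn] lets the Leibniz and chain rules be proved by induction. In
    [iter_partial] the innermost derivative is the last of the sequence, while [Cn] peels off the
    innermost one; hence the induction by [rcons]. *)
Lemma smoothP f : smooth f <-> forall n, Cn n f.
Proof.
split.
  move=> + n; elim: n f => [|n IH] f sf.
    by split => //; have [] := sf [::].
  split; first by have [] := sf [::].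
  move=> i; split; first by move=> x; have [_] := sf [::]; exact.
  by apply: IH; exact: smooth_partial.
move=> H s; elim/last_ind: s f H => [|s i IH] f H.
  by split; [have [] := H 0%N|move=> i x; have [_ /(_ i)[]] := H 1%N].
rewrite /iter_partial foldr_rcons; apply: IH => n.
by have [_ /(_ i)[]] := H n.+1.
Qed.

Lemma partialD i f g : (forall x, derivable f x (e3 R i)) ->
  (forall x, derivable g x (e3 R i)) ->
  partial i (fun x => f x + g x) = (fun x => partial i f x + partial i g x).
Proof. by move=> df dg; apply/funext => x; exact: deriveD. Qed.

Lemma partialM i f g : (forall x, derivable f x (e3 R i)) ->
  (forall x, derivable g x (e3 R i)) ->
  partial i (fun x => f x * g x) =
  (fun x => f x * partial i g x + partial i f x * g x).
Proof.
move=> df dg; apply/funext => x.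
by have := deriveM (df x) (dg x); rewrite /partial /= => ->; congr (_ + _);
  exact: mulrC.
Qed.

Lemma derive_line (V : normedModType R) (f : V -> R) (x v : V) : 'D_1 (fun h : R =>
  f (h *: v + x)) 0 = 'D_v f x.
Proof.
apply: (congr1 (fun F : R -> R => lim (F @ 0^'))).
apply/funext => h /=; rewrite addr0 scale0r add0r.
by rewrite [h *: 1]mulr1.
Qed.

Lemma is_derive_line (V : normedModType R) (f : V ->
  R) (x v : V) df : is_derive x v f df <->
  is_derive (0 : R) 1 (fun h : R => f (h *: v + x)) df.
Proof.
split=> -[H E]; (split; last by rewrite -E ?derive_line//).
- by have /derivable1P := H.
- by apply/derivable1P.
Qed.

(** Restriction to a line turns this into the one-variable chain rule, so derivability of [f] along
    [v] suffices and no total differential of [f] is needed. *)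
Lemma is_derive_comp1 (G : R -> R) (G' : R) f x v df :
  is_derive (f x) 1 G G' -> is_derive x v f df ->
  is_derive x v (G \o f) (G' * df).
Proof.
move=> dG /is_derive_line dfx; apply/is_derive_line.
have dG0 : is_derive ((fun h : R => f (h *: v + x)) 0) 1 G G'.
  by rewrite scale0r add0r.
exact: (is_derive1_comp dG0 dfx).
Qed.

Lemma partial_comp i (G G' : R -> R) f : (forall x, derivable f x (e3 R i)) ->
  (forall x, is_derive (f x) 1 G (G' (f x))) ->
  (forall x, derivable (fun y => G (f y)) x (e3 R i)) /\
  partial i (fun x => G (f x)) = (fun x => G' (f x) * partial i f x).
Proof.
move=> df dG.
have H x : is_derive x (e3 R i) (G \o f) (G' (f x) * partial i f x).
  by apply: is_derive_comp1 => //; exact/derivableP.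
by split => [x|]; [have [] := H x|apply/funext => x; have [] := H x].
Qed.

Lemma Cn_cst n (c : R) : Cn n (fun=> c).
Proof.
elim: n c => [|n IH] c; first by split => // x; exact: cvg_cst.
split; first by move=> x; exact: cvg_cst.
move=> i; split; first by move=> x; exact: derivable_cst.
rewrite (_ : partial i _ = fun=> 0); first exact: IH.
by apply/funext => x; exact: derive_cst.
Qed.

Lemma CnD n f g : Cn n f -> Cn n g -> Cn n (fun x => f x + g x).
Proof.
elim: n f g => [|n IH] f g [cf Hf] [cg Hg];
  (split; first by move=> x; apply: cvgD; [exact: cf|exact: cg]) => //.
move=> i; have [df Hf'] := Hf i; have [dg Hg'] := Hg i; split.
  by move=> x; exact: derivableD.
by rewrite partialD//; exact: IH.
Qed.

Lemma CnM n f g : Cn n f -> Cn n g -> Cn n (fun x => f x * g x).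
Proof.
elim: n f g => [|n IH] f g; move=> Kf Kg; have [cf Hf] := Kf; have [cg Hg] := Kg;
  (split; first by move=> x; apply: cvgM; [exact: cf|exact: cg]) => //.
move=> i; have [df Hf'] := Hf i; have [dg Hg'] := Hg i; split.
  by move=> x; exact: derivableM.
by rewrite partialM//; apply: CnD; apply: IH => //; exact: CnW.
Qed.

(** The derivative of the composite contains [G'] composed with [f], so the induction has to run
    over a whole class [C] of functions closed under derivation. *)
Lemma Cn_comp (C : (R -> R) -> Prop) (CP : forall G, C G -> exists2 G', C G' &
    forall t : R, is_derive t 1 G (G' t)) n (G : R -> R) f :
  C G -> Cn n f -> Cn n (fun x => G (f x)).
Proof.
elim: n G f => [|n IH] G f CG Kf; have [cf Hf] := Kf;
  have [G' CG' dG] := CP _ CG.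
  split => // x; apply: (@continuous_comp _ _ _ f G); first exact: cf.
  apply: differentiable_continuous; apply/derivable1_diffP.
  by have [] := dG (f x).
split.
  move=> x; apply: (@continuous_comp _ _ _ f G); first exact: cf.
  apply: differentiable_continuous; apply/derivable1_diffP.
  by have [] := dG (f x).
move=> i; have [df Hf'] := Hf i.
have [H1 H2] := @partial_comp i G G' f df (fun x => dG (f x)).
by split => //; rewrite H2; apply: CnM => //; apply: IH => //; exact: CnW.
Qed.

Lemma is_derive_inv (y : R) : y != 0 -> is_derive y 1 GRing.inv (- (y^-1 * y^-1)).
Proof.
move=> y0.
have -> : - (y^-1 * y^-1) = - y ^- 2 *: 1 by rewrite scaleNr scaler1 -invfM.
by apply: is_deriveV.
Qed.

Lemma CnV n f : (forall x, f x != 0) -> Cn n f -> Cn n (fun x => (f x)^-1).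
Proof.
move=> f0; elim: n => [|n IH] Kf; have [cf Hf] := Kf;
  (split; first by move=> x; apply: cvgV; [exact: f0|exact: cf]) => //.
move=> i; have [df Hf'] := Hf i.
have [|H1 H2] := @partial_comp i GRing.inv (fun y => - (y^-1 * y^-1)) f df.
  by move=> x; exact: is_derive_inv.
split => //; rewrite H2; apply: CnM => //.
rewrite (_ : (fun x => _) = fun x => -1 * ((f x)^-1 * (f x)^-1)).
  by apply: CnM; [exact: Cn_cst|apply: CnM; apply: IH; exact: CnW].
by apply/funext => x; rewrite mulN1r.
Qed.

Lemma is_derive_sqrt (y : R) : 0 < y ->
  is_derive y 1 Num.sqrt (2^-1 * (Num.sqrt y)^-1).
Proof. by move=> y0; rewrite -invfM; exact: is_derive1_sqrt. Qed.

Lemma Cn_sqrt n f : (forall x, 0 < f x) -> Cn n f -> Cn n (fun x => Num.sqrt (f x)).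
Proof.
move=> f0; elim: n => [|n IH] Kf; have [cf Hf] := Kf;
  (split; first by move=> x; apply: (@continuous_comp _ _ _ f Num.sqrt);
    [exact: cf|exact: sqrt_continuous]) => //.
move=> i; have [df Hf'] := Hf i.
have [|H1 H2] := @partial_comp i Num.sqrt (fun y => 2^-1 * (Num.sqrt y)^-1) f df.
  by move=> x; exact: is_derive_sqrt.
split => //; rewrite H2; apply: CnM => //; apply: CnM; first exact: Cn_cst.
apply: CnV; last by apply: IH; exact: CnW.
by move=> x; rewrite gt_eqF// sqrtr_gt0.
Qed.

Lemma Cn_expR n f : Cn n f -> Cn n (fun x => expR (f x)).
Proof.
apply: (Cn_comp (C := fun G => G = expR)) => // G ->.
by exists expR => // x; exact: is_derive_expR.
Qed.

Definition coord3 i x : R :=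
  if i == 0%N :> nat then x.1.1 else if i == 1%N :> nat then x.1.2 else x.2.

Lemma coord3_continuous i : continuous (coord3 i).
Proof.
move=> x; rewrite /coord3; case: (i == 0%N :> nat).
  by apply: (@continuous_comp _ _ _ fst fst); exact: cvg_fst.
case: (i == 1%N :> nat); last exact: cvg_snd.
by apply: (@continuous_comp _ _ _ fst snd); [exact: cvg_fst|exact: cvg_snd].
Qed.

Lemma coord3_line i (v : R3 R) x (h : R) :
  coord3 i (h *: v + x) = h * coord3 i v + coord3 i x.
Proof. by rewrite /coord3; case: ifP => _; [|case: ifP]. Qed.

Lemma coord3_e3 i j : coord3 i (e3 R j) = (i == j)%:R.
Proof.
rewrite /coord3 /e3 /=.
by case: i => [[|[|[|//]]] ?]; case: j => [[|[|[|//]]] ?].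
Qed.

Lemma is_derive_coord3 i x v : is_derive x v (coord3 i) (coord3 i v).
Proof.
apply/is_derive_line.
rewrite (_ : (fun h : R => _) = (fun h => h * coord3 i v + coord3 i x)); last first.
  by apply/funext => h; rewrite coord3_line.
by apply: is_derive_eq; rewrite scaler0 addr0 add0r scaler1.
Qed.

Lemma Cn_coord3 i n : Cn n (coord3 i).
Proof.
case: n => [|n]; first by split => //; exact: coord3_continuous.
split; first exact: coord3_continuous.
move=> j; split; first by move=> x; have [] := is_derive_coord3 i x (e3 R j).
rewrite (_ : partial j _ = fun=> coord3 i (e3 R j)); first exact: Cn_cst.
by apply/funext => x; have [] := is_derive_coord3 i x (e3 R j).
Qed.

End smooth_functions.

(** * Borel measurability on the threefold product *)

Section measurability.
Context {R : realType}.
Local Notation M3 :=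
  (measurableTypeR R * measurableTypeR R * measurableTypeR R)%type.

(** An open set is a countable union of boxes with rational centres and radii [n.+1%:R^-1], and
    boxes lie in the product sigma-algebra. *)
Lemma open_measurable3 (A : set (R3 R)) : open A -> measurable (A : set M3).
Proof.
move=> oA.
pose box (i : rat * rat * rat * nat) : set (R3 R) :=
  ball (ratr i.1.1.1 : R) i.2.+1%:R^-1 `*` ball (ratr i.1.1.2 : R) i.2.+1%:R^-1
  `*` ball (ratr i.1.2 : R) i.2.+1%:R^-1.
pose F (i : rat * rat * rat * nat) : set (R3 R) :=
  if `[< box i `<=` A >] then box i else set0.
have -> : A = \bigcup_i F i.
  apply/seteqP; split => [x Ax|x [i _]]; last first.
    by rewrite /F; case: asboolP => // /[apply].
  have [e /= e0 xe] : nbhs_ball x A by apply/nbhs_ballP; exact: open_nbhs_nbhs.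
  have [n ne] : exists n, n.+1%:R^-1 < e / 2.
    have := near_infty_natSinv_lt (PosNum (divr_gt0 e0 (ltr0Sn R 1))).
    by case=> n _ /(_ n (leqnn n)); exists n.
  have Q (t : R) : exists q : rat, ball t n.+1%:R^-1 (ratr q : R).
    have tt : t - n.+1%:R^-1 < t + n.+1%:R^-1 by rewrite ltrD2l gtrN.
    have [q] := rat_in_itvoo tt; rewrite in_itv/= => /andP[q1 q2].
    by exists q; rewrite /ball/= ltr_distlC q1.
  have [[a Ha] [[b Hb] [c Hc]]] := (Q x.1.1, (Q x.1.2, Q x.2)).
  exists (a, b, c, n) => //; rewrite /F; case: asboolP => [_|].
    by split => /=; [split => /=|]; exact: ball_sym.
  case=> y [/= [/= H1 H2] H3]; apply: xe.
  have K (s t : R) (q : rat) : ball (ratr q : R) n.+1%:R^-1 t ->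
    ball s n.+1%:R^-1 (ratr q : R) -> ball s e t.
    move=> qt sq; apply: (@le_ball _ _ s (n.+1%:R^-1 + n.+1%:R^-1)).
      by rewrite (splitr e) ltW// ltrD.
    exact: ball_triangle qt.
  by split; [split|]; apply: K; eauto.
apply: countable_bigcupT_measurable; first exact: countableP.
move=> i; rewrite /F; case: asboolP => // _.
by apply: measurableX; [apply: measurableX|]; apply: open_measurable; exact: ball_open.
Qed.

Lemma continuous_measurable3 (f : R3 R -> R) : continuous f ->
  measurable_fun (setT : set M3) f.
Proof.
move=> cf; apply: (measurability (@RGenOpens.G R)).
  exact: RGenOpens.measurableE.
move=> _ [_ [a [b ->] <-]]; rewrite setTI.
by apply: open_measurable3; apply: open_comp; [move=> x _;
  exact: cf|exact: interval_open].
Qed.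

End measurability.

(** * Affine changes of variable on the line *)

Section lebesgue_affine.
Context {R : realType}.
Local Notation la := (@lebesgue_measure R).
Local Open Scope ereal_scope.

(** Lebesgue measure is [c] times its image under the affine map: both measures agree on half-open
    intervals, and uniqueness of the extension does the rest. *)
Lemma ge0_integral_affine (c a : R) (F : R -> \bar R) : (0 < c)%R ->
  measurable_fun setT F -> (forall x, 0 <= F x) ->
  \int[la]_x F (c * x + a)%R = (c^-1)%:E * \int[la]_x F x.
Proof.
move=> c0 mF F0.
pose k : {nonneg R} := NngNum (ltW c0).
have mphi : measurable_fun setT ((fun x : R => c * x + a)%R : measurableTypeR R ->
  measurableTypeR R).
  by apply: continuous_measurable_fun => x; apply: cvgD; [apply: cvgMr;
    exact: cvg_id|exact: cvg_cst].
have E A : measurable A -> la A = mscale k (pushforward la ((fun x : R =>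
  c * x + a)%R : measurableTypeR R -> measurableTypeR R)) A.
  move=> mA; apply: lebesgue_measure_unique => //= _ [[u v]] _ <-.
  rewrite /mscale/= /pushforward.
  have -> : (fun x : R => c * x + a)%R @^-1` `]u, v]%classic = [set` `](u - a) / c,
    (v - a) / c]%R].
    apply/seteqP; split => x /=; rewrite !in_itv/= ltr_pdivrMr// ler_pdivlMr//
      lerBrDr ltrBlDr mulrC//.
  rewrite !lebesgue_measure_itv/= !lte_fin ltr_pM2r ?invr_gt0// ltrD2r.
  case: ifPn => uv; last by rewrite mule0.
  by rewrite -!EFinD -EFinM; congr EFin; field; rewrite gt_eqF.
rewrite [in RHS](eq_measure_integral (mscale k (pushforward la ((fun x : R =>
  c * x + a)%R : measurableTypeR R -> measurableTypeR R)))); last first.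
  by move=> A mA _; exact: E.
rewrite ge0_integral_mscale// ge0_integral_pushforward//= muleA -EFinM mulVf
  ?gt_eqF// mul1e.
by apply: eq_integral.
Qed.

Lemma ge0_integral_scale (c : R) (F : R -> \bar R) : c != 0%R ->
  measurable_fun setT F -> (forall x, 0 <= F x) ->
  `|c|%:E * \int[la]_x F (c * x)%R = \int[la]_x F x.
Proof.
wlog c0 : c F / (0 < c)%R => [H|] cn0 mF F0.
  have [c0|c0] := ltP 0%R c; first exact: H.
  have {}c0 : (0 < - c)%R by rewrite oppr_gt0 lt_neqAle cn0.
  pose G x := F (- x)%R.
  have mG : measurable_fun setT G by apply: measurableT_comp.
  have := H (- c)%R G c0 (lt0r_neq0 c0) mG (fun x => F0 _).
  rewrite normrN; under eq_integral do rewrite /G mulNr opprK.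
  move=> ->; rewrite /G.
  rewrite [RHS](eq_measure_integral (pushforward la (-%R : measurableTypeR R ->
    measurableTypeR R))); last first.
    by move=> A mA _; apply/esym; exact: lebesgue_measureN.
  by rewrite ge0_integral_pushforward.
have := ge0_integral_affine 0%R c0 mF F0.
under eq_integral do rewrite addr0.
by move=> ->; rewrite gtr0_norm// muleA -EFinM divff// mul1e.
Qed.

End lebesgue_affine.

(** * Iterated integrals and translation invariance in dimension three *)

Section tonelli3.
Context {R : realType}.
Local Notation la := (@lebesgue_measure R).
Local Notation M3 :=
  (measurableTypeR R * measurableTypeR R * measurableTypeR R)%type.
Local Open Scope ereal_scope.
Lemma sigma_finite_product d1 d2 (T1 : measurableType d1) (T2 : measurableType d2)
  (m1 : {sigma_finite_measure set T1 -> \bar R})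
  (m2 : {sigma_finite_measure set T2 -> \bar R}) : sigma_finite setT (m1 \x m2).
Proof.
have /sigma_finiteP[F [TF ndF Foo]] := sigma_finiteT m1.
have /sigma_finiteP[G [TG ndG Goo]] := sigma_finiteT m2.
exists (fun n => F n `*` G n).
  rewrite -setXTT TF TG predeqE => -[x y]; split.
    move=> [/= [n _ Fnx] [k _ Gky]]; exists (maxn n k) => //; split.
    - by move: x Fnx; exact/subsetPset/ndF/leq_maxl.
    - by move: y Gky; exact/subsetPset/ndG/leq_maxr.
  by move=> [n _ []/= ? ?]; split; exists n.
move=> k; have [? ?] := Foo k; have [? ?] := Goo k.
split; first exact: measurableX.
by rewrite product_measure1E// lte_mul_pinfty// ge0_fin_numE.
Qed.

(* The library's canonical sigma-finite structure on products only covers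
   subprobabilities. *)
Definition la2 : {sigma_finite_measure set (measurableTypeR R * measurableTypeR
  R)%type -> \bar R} :=
  HB.pack_for {sigma_finite_measure set (measurableTypeR R * measurableTypeR
    R)%type -> \bar R}
    (la \x la) (Measure_isSigmaFinite.Build _ _ _ (la \x la) (sigma_finite_product
      la la)).

Definition la3 : {sigma_finite_measure set M3 -> \bar R} :=
  HB.pack_for {sigma_finite_measure set M3 -> \bar R}
    (la2 \x la) (Measure_isSigmaFinite.Build _ _ _ (la2 \x la)
      (sigma_finite_product la2 la)).

Lemma la3E (D : set M3) (F : M3 -> \bar R) : \int[mu3 R]_(x in D) F x =
  \int[la3]_(x in D) F x.
Proof. by []. Qed.

Lemma ge0_integral3 (F : M3 -> \bar R) : measurable_fun setT F ->
  (forall x, 0 <= F x) ->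
  \int[mu3 R]_x F x = \int[la]_x \int[la]_y \int[la]_z F (x, y, z).
Proof.
move=> mF F0; rewrite la3E.
have F1 x : 0 <= fubini_F la F x by apply: integral_ge0.
have E1 := @fubini_tonelli1 _ _ _ _ R la2 la F mF F0.
have E2 := @fubini_tonelli1 _ _ _ _ R la la (fubini_F la F)
   (@measurable_fun_fubini_tonelli_F _ _ _ _ R la F mF F0) F1.
exact: (etrans E1 E2).
Qed.

Lemma measurable_integral_z (F : M3 -> \bar R) : measurable_fun setT F ->
  (forall x, 0 <= F x) ->
  measurable_fun setT (fun xy : measurableTypeR R * measurableTypeR R =>
    \int[la]_z F (xy, z)).
Proof. by move=> mF F0; exact: (@measurable_fun_fubini_tonelli_F _ _ _ _ R la F mF
  F0). Qed.

Lemma measurable_integral_yz (F : M3 -> \bar R) : measurable_fun setT F ->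
  (forall x, 0 <= F x) ->
  measurable_fun setT (fun x : measurableTypeR R => \int[la]_y \int[la]_z F (x, y, z)).
Proof.
move=> mF F0; exact: (@measurable_fun_fubini_tonelli_F _ _ _ _ R la _
  (measurable_integral_z mF F0) (fun x => integral_ge0 _ (fun y _ => F0 _))).
Qed.

Lemma ge0_integral3_translation (a : R3 R) (F : M3 -> \bar R) :
  measurable_fun setT F -> (forall x, 0 <= F x) ->
  \int[mu3 R]_x F (x + a)%R = \int[mu3 R]_x F x.
Proof.
move=> mF F0.
have tr (b : R) (G : R -> \bar R) : measurable_fun setT G -> (forall x, 0 <= G x) ->
    \int[la]_x G (x + b)%R = \int[la]_x G x.
  move=> mG G0; have := ge0_integral_affine b ltr01 mG G0.
  by under eq_integral do rewrite mul1r; rewrite invr1 mul1e.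
have mFa : measurable_fun setT (fun x : M3 => F (x + a)%R).
  apply: measurableT_comp => //; apply: measurable_fun_pair => /=.
    apply: measurable_fun_pair => /=.
      apply: measurable_funD => //; exact: (measurableT_comp measurable_fst
        measurable_fst).
    apply: measurable_funD => //; exact: (measurableT_comp measurable_snd
      measurable_fst).
  apply: measurable_funD => //; exact: measurable_snd.
rewrite (ge0_integral3 mFa (fun x => F0 _)) (ge0_integral3 mF F0).
transitivity (\int[la]_x \int[la]_y \int[la]_z F (x + a.1.1, y + a.1.2, z)%R).
  apply: eq_integral => x _; apply: eq_integral => y _.
  apply: (tr a.2 (fun z => F (x + a.1.1, y + a.1.2, z)%R)) => //.
  by apply: measurableT_comp => //; apply: measurable_fun_pair.
transitivity (\int[la]_x \int[la]_y \int[la]_z F (x + a.1.1, y, z)%R).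
  apply: eq_integral => x _.
  apply: (tr a.1.2 (fun y => \int[la]_z F (x + a.1.1, y, z)%R)) => //.
    apply: (measurableT_comp (measurable_integral_z mF F0)).
    exact: measurable_fun_pair.
  by move=> y; apply: integral_ge0.
apply: (tr a.1.1 (fun x => \int[la]_y \int[la]_z F (x, y, z)%R)) => //.
    exact: (measurable_integral_yz mF F0).
by move=> x; apply: integral_ge0 => y _; apply: integral_ge0.
Qed.

End tonelli3.

(** * Integration of radial functions *)

Section radial_integrals.
Context {R : realType}.
Local Notation la := (@lebesgue_measure R).
Local Notation M3 :=
  (measurableTypeR R * measurableTypeR R * measurableTypeR R)%type.
Implicit Types (e t : R).

Definition hyp e t : R := Num.sqrt (t ^+ 2 + e ^+ 2).

Lemma hyp_gt0 e t : 0 < e -> 0 < hyp e t.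
Proof. by move=> e0; rewrite sqrtr_gt0 ltr_wpDl ?sqr_ge0// exprn_gt0. Qed.

Lemma hyp_sqr e t : hyp e t ^+ 2 = t ^+ 2 + e ^+ 2.
Proof. by rewrite sqr_sqrtr// addr_ge0 ?sqr_ge0. Qed.

Lemma ler_hyp e t : t <= hyp e t.
Proof.
rewrite (le_trans (ler_norm _))// -sqrtr_sqr ler_sqrt ?lerDl ?sqr_ge0//.
by rewrite addr_ge0 ?sqr_ge0.
Qed.

Lemma hyp_ler e t : 0 <= e -> 0 <= t -> hyp e t <= t + e.
Proof.
move=> e0 t0; rewrite -(ger0_norm (addr_ge0 t0 e0)) -sqrtr_sqr ler_sqrt ?sqr_ge0//.
by rewrite sqrrD lerD2r lerDl mulrn_wge0// mulr_ge0.
Qed.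

Lemma is_derive_hyp e t : 0 < e -> is_derive t 1 (hyp e) (t / hyp e t).
Proof.
move=> e0; have h0 := hyp_gt0 t e0.
have d : is_derive t 1 (fun t => t ^+ 2 + e ^+ 2) (2 * t).
  by apply: is_derive_eq; rewrite /GRing.scale/=; ring.
have p0 : 0 < t ^+ 2 + e ^+ 2 by rewrite -hyp_sqr exprn_gt0.
have ds : is_derive (t ^+ 2 + e ^+ 2) 1 Num.sqrt (2^-1 * (hyp e t)^-1).
  exact: is_derive_sqrt.
have D : is_derive t 1 (hyp e) _ :=
  @is_derive1_comp _ Num.sqrt (fun t => t ^+ 2 + e ^+ 2) t _ _ ds d.
by apply: (is_derive_eq D); field; rewrite gt_eqF.
Qed.

Lemma continuous_hyp e : continuous (hyp e).
Proof.
move=> t; apply: (@continuous_comp _ _ _ (fun t => t ^+ 2 + e ^+ 2) Num.sqrt).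
  by apply: cvgD; [exact: exprn_continuous|exact: cvg_cst].
exact: sqrt_continuous.
Qed.

Lemma is_derive_div_hyp e t : 0 < e ->
  is_derive t 1 (fun t => t / hyp e t) (e ^+ 2 / hyp e t ^+ 3).
Proof.
move=> e0; have h0 := hyp_gt0 t e0; have h1 : hyp e t != 0 by rewrite gt_eqF.
have d := is_derive_hyp t e0.
have dv := is_derive_inv h1.
have d2 := @is_derive1_comp _ GRing.inv (hyp e) t _ _ dv d.
have D : is_derive t 1 (fun t => t / hyp e t) _ := is_deriveM (is_derive_id t 1) d2.
apply: (is_derive_eq D); rewrite /GRing.scale/=.
have -> : e ^+ 2 = hyp e t ^+ 2 - t ^+ 2 by rewrite hyp_sqr addrAC subrr add0r.
by field.
Qed.

Lemma cvg_div_hyp e : 0 < e -> t / hyp e t @[t --> +oo] --> (1 : R).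
Proof.
move=> e0; apply/cvgrPdist_le => /= eps eps0; near=> t.
have t0 : 0 < t by near: t; exact: nbhs_pinfty_gt.
have h0 := hyp_gt0 t e0.
have th := ler_hyp e t; have ht := hyp_ler (ltW e0) (ltW t0).
have et : e / eps <= t by near: t; apply: nbhs_pinfty_ge; exact: num_real.
rewrite ger0_norm ?subr_ge0 ?ler_pdivrMr ?mul1r//.
rewrite lerBlDr -lerBlDl ler_pdivlMr// mulrBl mul1r lerBlDr.
rewrite (le_trans ht)// lerD2l -ler_pdivrMl// mulrC (le_trans et)//.
Unshelve. all: by end_near. Qed.

Lemma integralT_even (f F : R -> R) (l : R) : (forall t, 0 <= f t) ->
  continuous f -> (forall t, f (- t) = f t) -> F 0 = 0 ->
  (forall t, derivable F t 1 /\ 'D_1 F t = f t) -> F t @[t --> +oo] --> l ->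
  (\int[la]_t (f t)%:E = (2 * l)%:E)%E.
Proof.
move=> f0 cf fN F0 dF Fl; rewrite ge0_symfun_integralT//; last first.
  by move=> t; rewrite /= fN.
rewrite -set_itvcy (@ge0_continuous_FTC2y _ f F 0 l) //.
- by rewrite F0 sube0 -EFinM.
- exact: continuous_subspaceT.
- by move=> t _; have [] := dF t.
- apply: cvg_at_right_filter; apply: differentiable_continuous.
  by apply/derivable1_diffP; have [] := dF 0.
- by move=> t _; rewrite derive1E; have [] := dF t.
Qed.

Lemma integralT_hyp3 : (\int[la]_t ((hyp 1 t ^+ 3)^-1)%:E = 2%:E)%E.
Proof.
rewrite (@integralT_even (fun t => (hyp 1 t ^+ 3)^-1) (fun t =>
  t / hyp 1 t) 1) ?mulr1//.
- by move=> t; rewrite invr_ge0 exprn_ge0// sqrtr_ge0.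
- move=> t; apply: cvgV; first by rewrite gt_eqF// exprn_gt0// hyp_gt0.
  by apply: (cvg_comp _ (fun x : R => x ^+ 3) (@continuous_hyp 1 t));
    exact: exprn_continuous.
- by move=> t; rewrite /hyp sqrrN.
- by rewrite mul0r.
- move=> t; have [? ->] := is_derive_div_hyp t (@ltr01 R).
  by rewrite expr1n mul1r.
- exact: cvg_div_hyp.
Qed.

(** The integrand is t^2 times the radial profile of the mollifier [rho]. Its primitive
    [(t / hyp e t) ^+ 3] tends to 1 whatever [e] is, so the total mass does not depend on [e]. *)
Lemma integralT_hyp5 e : 0 < e ->
  (\int[la]_t (3 * e ^+ 2 * t ^+ 2 / hyp e t ^+ 5)%:E = 2%:E)%E.
Proof.
move=> e0.
rewrite (@integralT_even (fun t => 3 * e ^+ 2 * t ^+ 2 / hyp e t ^+ 5)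
  (fun t => (t / hyp e t) ^+ 3) 1) ?mulr1//.
- move=> t; rewrite divr_ge0 ?exprn_ge0 ?sqrtr_ge0// mulr_ge0 ?sqr_ge0//.
  by rewrite mulr_ge0// sqr_ge0.
- move=> t; apply: cvgM; first by apply: cvgMr; exact: exprn_continuous.
  apply: cvgV; first by rewrite gt_eqF// exprn_gt0// hyp_gt0.
  by apply: (cvg_comp _ (fun x : R => x ^+ 5) (@continuous_hyp e t));
    exact: exprn_continuous.
- by move=> t; rewrite /hyp !sqrrN.
- by rewrite mul0r expr0n.
- move=> t; have h1 : hyp e t != 0 by rewrite gt_eqF// hyp_gt0.
  have D : is_derive t 1 (fun t => (t / hyp e t) ^+ 3) _ :=
    is_deriveX 3 (is_derive_div_hyp t e0).
  by case: D => ? ->; split => //; rewrite /GRing.scale/=; field.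
- rewrite -[X in _ --> X](expr1n _ 3).
  by apply: (cvg_comp _ (fun x : R => x ^+ 3) (cvg_div_hyp e0));
    exact: exprn_continuous.
Qed.

Local Open Scope ereal_scope.

Definition sqnorm3 (x : R3 R) : R := (x.1.1 ^+ 2 + x.1.2 ^+ 2 + x.2 ^+ 2)%R.

(** The integral on the right runs over the whole line and counts each radius twice, hence [2 * pi]
    in place of 4 pi. *)
Lemma ge0_integral_radial (f : R -> R) : measurable_fun setT f ->
  (forall t, 0 <= f t)%R ->
  \int[mu3 R]_x (f (sqnorm3 x))%:E = (2 * pi)%:E * \int[la]_t (t ^+ 2 * f (t ^+ 2))%:E.
Proof.
move=> mf f0.
have m1 : measurable_fun setT (fst \o fst : M3 -> measurableTypeR R).
  exact: (measurableT_comp measurable_fst measurable_fst).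
have m2 : measurable_fun setT (snd \o fst : M3 -> measurableTypeR R).
  exact: (measurableT_comp measurable_snd measurable_fst).
have m3 : measurable_fun setT (snd : M3 -> measurableTypeR R).
  exact: measurable_snd.
have mF : measurable_fun setT (fun x : M3 => (f (sqnorm3 x))%:E).
  apply/measurable_EFinP; apply: (measurableT_comp mf).
  by apply: measurable_funD; [apply: measurable_funD|]; exact: measurable_funX.
(* The coordinates (x, x v, x w) replace the spherical ones. *)
pose c (v w : R) : R := (1 + v ^+ 2 + w ^+ 2)%R.
pose g (x : M3) : \bar R := (x.1.1 ^+ 2 * f (x.1.1 ^+ 2 * c x.1.2 x.2))%:E.
have mg : measurable_fun setT g.
  apply/measurable_EFinP; apply: measurable_funM; first exact: measurable_funX.
  apply: (measurableT_comp mf); apply: measurable_funM; first exact: measurable_funX.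
  apply: measurable_funD; [apply: measurable_funD|] => //; exact: measurable_funX.
have g0 x : 0 <= g x by rewrite lee_fin mulr_ge0// sqr_ge0.
pose I := \int[la]_t (t ^+ 2 * f (t ^+ 2))%:E.
have I0 : 0 <= I by apply: integral_ge0 => t _; rewrite lee_fin mulr_ge0// sqr_ge0.
have F0 x : 0 <= (f (sqnorm3 x))%:E by rewrite lee_fin.
have sc (a : R) : a != 0%R -> forall G : R -> \bar R, measurable_fun setT G ->
    (forall x, 0 <= G x) -> \int[la]_x G x = `|a|%:E * \int[la]_x G (a * x)%R.
  by move=> a0 G mG G0; rewrite (ge0_integral_scale a0 mG G0).
have E1 : \int[mu3 R]_x (f (sqnorm3 x))%:E = \int[mu3 R]_x g x.
  rewrite (ge0_integral3 mF F0) (ge0_integral3 mg g0).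
  have mm1 := measurable_integral_yz mF F0.
  have mm2 := measurable_integral_yz mg g0.
  (* The substitution multiplies by [x] and breaks down at [x = 0], a null set that is removed from
     both sides. *)
  rewrite -(@integral_setD1 _ _ 0%R setT); last 2 first.
  - by apply: measurableD.
  - exact: measurable_funTS mm1.
  rewrite -[RHS](@integral_setD1 _ _ 0%R setT); last 2 first.
  - by apply: measurableD.
  - exact: measurable_funTS mm2.
  apply: eq_integral => x; rewrite inE /= => -[_ /eqP x0].
  have mz := measurable_integral_z mF F0.
  rewrite (sc x x0 (fun y => \int[la]_z (f (sqnorm3 (x, y, z)))%:E)); last 2 first.
  - exact: (measurableT_comp mz (pair1_measurable x)).
  - by move=> y; apply: integral_ge0 => z _; exact: F0.
  rewrite -ge0_integralZl; last 4 first.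
  - by [].
  - apply: (measurableT_comp mz); apply: measurable_fun_pair => //.
  - by move=> y _; apply: integral_ge0 => z _; exact: F0.
  - by rewrite lee_fin.
  apply: eq_integral => v _.
  rewrite (sc x x0 (fun z => (f (sqnorm3 (x, x * v, z)%R))%:E)); last 2 first.
  - exact: (measurableT_comp mF (pair1_measurable _)).
  - by move=> z; exact: F0.
  rewrite muleA -EFinM -normrM ger0_norm ?sqr_ge0//.
  rewrite -ge0_integralZl; last 4 first.
  - by [].
  - apply: (measurableT_comp mF); apply: measurable_fun_pair => //.
  - by move=> z _; exact: F0.
  - by rewrite lee_fin sqr_ge0.
  apply: eq_integral => w _; rewrite /g /= -EFinM; congr (_ * f _)%:E.
  by rewrite /c /sqnorm3 /=; ring.
have mxvw : measurable_fun setT (fun x : M3 => g (x.2, x.1.1, x.1.2)).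
  by apply: (measurableT_comp mg); apply: measurable_fun_pair => //;
    apply: measurable_fun_pair.
have E2 : \int[mu3 R]_x g x = \int[la]_v \int[la]_w \int[la]_x g (x, v, w).
  rewrite (ge0_integral3 mg g0).
  apply: (etrans (@fubini_tonelli _ _ _ _ R la la (fun xv => \int[la]_w g (xv, w))
    (measurable_integral_z mg g0) (fun x => integral_ge0 _ (fun w _ => g0 _)))).
  apply: eq_integral => v _.
  apply: (@fubini_tonelli _ _ _ _ R la la (fun xw => g (xw.1, v, xw.2))).
    by apply: (measurableT_comp mg); apply: measurable_fun_pair => //;
      apply: measurable_fun_pair.
  by move=> x; exact: g0.
have c0 v w : (0 < c v w)%R by rewrite ltr_wpDr ?sqr_ge0// ltr_wpDr// sqr_ge0.
have mI : measurable_fun setT (fun t : R => (t ^+ 2 * f (t ^+ 2))%:E).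
  apply/measurable_EFinP; apply: measurable_funM; first exact: measurable_funX.
  by apply: (measurableT_comp mf); exact: measurable_funX.
(* Scaling [x] by sqrt(c) yields two factors from [x ^+ 2] and one from dx, hence the cube. *)
have E3 v w : \int[la]_x g (x, v, w) = ((Num.sqrt (c v w) ^+ 3)^-1)%:E * I.
  have s0 : (0 < Num.sqrt (c v w))%R by rewrite sqrtr_gt0.
  have cs : (c v w = Num.sqrt (c v w) ^+ 2)%R by rewrite sqr_sqrtr// ltW.
  rewrite /g/=; move: (Num.sqrt (c v w)) s0 cs => s s0 ->.
  rewrite /I (sc s (lt0r_neq0 s0) _ mI); last first.
    by move=> t; rewrite lee_fin mulr_ge0// sqr_ge0.
  rewrite muleA -EFinM gtr0_norm// -ge0_integralZl; last 4 first.
  - by [].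
  - apply: (measurableT_comp mI) => //.
  - by move=> t _; rewrite lee_fin mulr_ge0// sqr_ge0.
  - by rewrite lee_fin mulr_ge0 ?invr_ge0 ?exprn_ge0// ltW.
  apply: eq_integral => x _; rewrite -EFinM /=; congr EFin.
  by rewrite exprMn [(s ^+ 2 * _)%R]mulrC; field; rewrite gt_eqF.
rewrite E1 E2 -/I.
have mc : measurable_fun setT (fun t : R => (hyp 1 t ^- 3)%:E).
  apply/measurable_EFinP; apply: continuous_measurable_fun => t.
  apply: cvgV; first by rewrite gt_eqF// exprn_gt0// hyp_gt0.
  by apply: (cvg_comp _ (fun x : R => x ^+ 3)%R (@continuous_hyp 1 t));
    exact: exprn_continuous.
(* With [1 + v ^+ 2 = k ^+ 2], scaling [w] by [k] factors [k] out of the square root and leaves the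
   integral of [hyp 1 w ^- 3], which is 2. The remaining integral over [v] is that of twice the
   derivative of [atan]. *)
have E4 v : \int[la]_w \int[la]_x g (x, v, w) = (2 / (1 + v ^+ 2))%:E * I.
  under eq_integral do rewrite E3.
  have k0 : (0 < 1 + v ^+ 2)%R by rewrite ltr_wpDr ?sqr_ge0.
  have [k [kk k1]] : exists k : R, (0 < k)%R /\ (1 + v ^+ 2 = k ^+ 2)%R.
    by exists (Num.sqrt (1 + v ^+ 2)); rewrite sqrtr_gt0 sqr_sqrtr// ltW.
  have cE w : Num.sqrt (c v w) = (k * hyp 1 (k^-1 * w))%R.
    transitivity (Num.sqrt (k ^+ 2) * hyp 1 (k^-1 * w))%R; last first.
      by rewrite sqrtr_sqr gtr0_norm.
    rewrite -sqrtrM ?sqr_ge0// /c k1; congr Num.sqrt.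
    by rewrite expr1n; field; rewrite gt_eqF.
  have mk : measurable_fun setT (fun w => ((Num.sqrt (c v w) ^+ 3)^-1)%:E).
    rewrite (_ : (fun w => _) = fun w => (k ^- 3)%:E * (hyp 1 (k^-1 * w)%R ^- 3)%:E).
      apply: measurable_funeM; apply: (measurableT_comp mc).
      by apply: continuous_measurable_fun => w; apply: cvgMr; exact: cvg_id.
    by apply/funext => w; rewrite cE -EFinM exprMn invfM.
  rewrite ge0_integralZr//.
  congr (_ * _); rewrite (sc k (lt0r_neq0 kk) _ mk); last first.
    by move=> w; rewrite lee_fin invr_ge0 exprn_ge0// sqrtr_ge0.
  rewrite (_ : \int[la]_w _ = \int[la]_w ((k ^- 3)%:E * (hyp 1 w ^- 3)%:E)); last first.
    apply: eq_integral => w _; rewrite cE mulKf ?gt_eqF// -EFinM.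
    by rewrite exprMn invfM.
  rewrite ge0_integralZl//; last 2 first.
  - by move=> w _; rewrite lee_fin invr_ge0 exprn_ge0// sqrtr_ge0.
  - by rewrite lee_fin invr_ge0 exprn_ge0// ltW.
  rewrite integralT_hyp3 k1 gtr0_norm// -!EFinM; congr EFin.
  by field; rewrite gt_eqF.
have ca : continuous (fun v : R => 2 / (1 + v ^+ 2))%R.
  move=> v; apply: cvgMr => //; apply: cvgV; first by rewrite gt_eqF//
    ltr_wpDr ?sqr_ge0.
  by apply: cvgD; [exact: cvg_cst|exact: exprn_continuous].
have p0 (v : R) : (0 <= 2 / (1 + v ^+ 2))%R by rewrite divr_ge0// addr_ge0// sqr_ge0.
under eq_integral do rewrite E4.
rewrite ge0_integralZr; [| exact: measurableT | |by move=> v _;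
  rewrite lee_fin|exact: I0]; last first.
  by apply/measurable_EFinP; exact: continuous_measurable_fun.
congr (_ * _).
rewrite (@integralT_even (fun v => 2 / (1 + v ^+ 2))%R (fun v =>
  2 * atan v)%R (2 * (pi / 2))%R)//.
- by congr EFin; field.
- by move=> v; rewrite sqrrN.
- by rewrite atan0 mulr0.
- move=> v; have D : is_derive v (1 : R)%R (fun v => 2 * atan v)%R (2 / (1 + v ^+ 2))%R.
    exact: (@is_deriveZ _ _ _ (@atan R) 2%R v 1%R _ (is_derive1_atan v)).
  by case: D => ? ->.
- by apply: cvgMr; exact: cvgy_atan.
Qed.

End radial_integrals.

(** * Compactly supported functions and the vanishing of integrals of derivatives *)

Section compact_support.
Context {R : realType}.
Local Notation M3 :=
  (measurableTypeR R * measurableTypeR R * measurableTypeR R)%type.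
Implicit Types (f g phi : R3 R -> R) (i : 'I_3) (x : R3 R).

Definition supp f : set (R3 R) := closure [set x | f x != 0].

Lemma supp_sub f x : f x != 0 -> supp f x.
Proof. by move=> fx; exact: subset_closure. Qed.

Lemma supp_le f g : (forall x, f x = 0 -> g x = 0) -> supp g `<=` supp f.
Proof.
by move=> H; apply: closure_subset => x /=; apply: contra_neq; exact: H.
Qed.

Lemma compact_supp_le f g : (forall x, f x = 0 -> g x = 0) ->
  compact (supp f) -> compact (supp g).
Proof.
move=> H kf; apply: (subclosed_compact _ kf (supp_le H)).
exact: closed_closure.
Qed.

Lemma supp_partial i f : supp (partial i f) `<=` supp f.
Proof.
have -> : supp f = closure (supp f) by apply/closure_id; exact: closed_closure.
apply: closure_subset => x /=; apply: contra_neqP => nfx.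
rewrite /partial -(derive_cst (0 : R) x (e3 R i)); apply: near_eq_derive.
have : open_nbhs x (~` supp f) by split => //; apply: closed_openC;
  exact: closed_closure.
move=> /open_nbhs_nbhs; apply: filterS => y /= nfy.
by apply/eqP; apply: contra_notT nfy; exact: supp_sub.
Qed.

Lemma compact_supp_partial i f : compact (supp f) -> compact (supp (partial i f)).
Proof.
move=> kf; apply: (subclosed_compact _ kf (@supp_partial i f)).
exact: closed_closure.
Qed.

Lemma compact_supp_norm f : compact (supp f) ->
  exists2 M, 0 < M & forall x, f x != 0 -> `|x| <= M.
Proof.
move=> /compact_bounded [M [_ HM]]; exists (Num.max M 0 + 1).
  by rewrite ltr_wpDl// le_max lexx orbT.
move=> x /supp_sub fx; apply: (HM (Num.max M 0 + 1)) => //.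
by rewrite (@le_lt_trans _ _ (Num.max M 0)) ?ltrDl// le_max lexx.
Qed.

Lemma compact_supp_bounded f : continuous f -> compact (supp f) ->
  exists2 C, 0 < C & forall x, `|f x| <= C.
Proof.
move=> cf kf; have [[x0 fx0]|nf] := pselect (exists x, supp f x); last first.
  exists 1 => // x; have [->|/supp_sub fx] := eqVneq (f x) 0; first by rewrite normr0.
  by exfalso; apply: nf; exists x.
have cn : {within supp f, continuous (fun x => `|f x|)}.
  apply: continuous_subspaceT => x; apply: continuous_comp; first exact: cf.
  exact: norm_continuous.
have [c _ Hc] := compact_EVT_max (ex_intro _ x0 fx0) kf cn.
exists (`|f c| + 1); first by rewrite ltr_wpDl.
move=> x; have [->|/supp_sub fx] := eqVneq (f x) 0.
  by rewrite normr0 addr_ge0.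
by rewrite (le_trans (Hc x _)) ?inE// lerDl.
Qed.

Definition cube (M : R) : set (R3 R) :=
  (`[- M, M] `*` `[- M, M] `*` `[- M, M])%classic.

Lemma cubeP M x : cube M x <-> `|x| <= M.
Proof.
rewrite /cube !prod_normE !ge_max -!andbA /= !in_itv/= !ler_norml.
by split => [[[-> ->] ->]|/and3P[]].
Qed.

Lemma measurable_cube M : measurable (cube M : set M3).
Proof. by apply: measurableX; [apply: measurableX|]. Qed.

Lemma mu3_cube_lty M : (mu3 R (cube M) < +oo)%E.
Proof.
rewrite /cube.
set I : set (measurableTypeR R) := `[- M, M]%classic.
have mi : measurable I by rewrite /I.
have L : (@lebesgue_measure R I < +oo)%E.
  by rewrite lebesgue_measure_itv/=; case: ifP => _; rewrite ?ltry.
have E2 := @product_measure1E _ _ _ _ R (@lebesgue_measure R) (@lebesgue_measure R)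
  I I mi mi.
have L2 : ((@lebesgue_measure R \x @lebesgue_measure R) (I `*` I) < +oo)%E.
  by rewrite E2 lte_mul_pinfty// ge0_fin_numE.
have E1 := @product_measure1E _ _ _ _ R (@la2 R) (@lebesgue_measure R)
  (I `*` I) I (measurableX mi mi) mi.
have -> : mu3 R (I `*` I `*` I) = _ := E1.
by rewrite lte_mul_pinfty// ge0_fin_numE//; exact: L2.
Qed.

Lemma integrable_bounded (D : set M3) f (C M : R) : measurable D ->
  measurable_fun (setT : set M3) f ->
  (forall x, `|f x| <= C) -> (forall x, f x != 0 -> `|x| <= M) ->
  (mu3 R).-integrable D (EFin \o f).
Proof.
move=> mD mf fC fM.
have I : (mu3 R).-integrable setT (fun x : M3 => (C * \1_(cube M) x)%:E).
  apply: (@integrableZl _ _ _ _ _ measurableT C (fun x : M3 => (\1_(cube M) x)%:E)).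
  apply/integrableP; split.
    by apply/measurable_EFinP; apply: measurable_indic; exact: measurable_cube.
  under eq_integral do rewrite gee0_abs ?lee_fin//.
  rewrite integral_indic//; last exact: measurable_cube.
  by rewrite setIT; exact: mu3_cube_lty.
apply: (@integrableS _ _ _ _ setT) => //.
apply: (le_integrable measurableT _ _ I).
  by apply/measurable_EFinP.
move=> x _ /=; rewrite lee_fin.
have C0 : 0 <= C by rewrite (le_trans _ (fC 0)).
rewrite indicE; case: (boolP (x \in cube M)) => xM.
  by rewrite mulr1 (ger0_norm C0).
have [->|/fM/cubeP] := eqVneq (f x) 0; first by rewrite normr0.
by move/mem_set; rewrite (negbTE xM).
Qed.

Lemma continuous_integrable (D : set M3) f : measurable D -> continuous f ->
  compact (supp f) -> (mu3 R).-integrable D (EFin \o f).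
Proof.
move=> mD cf kf; have [C _ HC] := compact_supp_bounded cf kf.
have [M _ HM] := compact_supp_norm kf.
by apply: (integrable_bounded mD _ HC HM); exact: continuous_measurable3.
Qed.

Lemma integral3_translation (a : R3 R) (f : R3 R -> R) :
  measurable_fun (setT : set M3) f ->
  (\int[mu3 R]_x (f (x + a))%:E = \int[mu3 R]_x (f x)%:E)%E.
Proof.
move=> mf; have mF : measurable_fun (setT : set M3) (EFin \o f)
  by apply/measurable_EFinP.
have E : (fun x : M3 => (f (x + a))%:E) = (EFin \o f) \o (fun x => x + a) by [].
rewrite integralE [RHS]integralE E funepos_comp funeneg_comp; congr (_ - _)%E.
  exact: (@ge0_integral3_translation _ a ((EFin \o f)^\+)%E (measurable_funepos mF)
    (funepos_ge0 _)).
exact: (@ge0_integral3_translation _ a ((EFin \o f)^\-)%E (measurable_funeneg mF)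
  (funeneg_ge0 _)).
Qed.

Lemma is_derive_line_at f (v : R3 R) x (h : R) : derivable f (h *: v + x) v ->
  is_derive h 1 (fun h => f (h *: v + x)) ('D_v f (h *: v + x)).
Proof.
move=> /derivableP /is_derive_line D; apply/is_derive_line.
rewrite (_ : (fun k : R => _) = fun k : R => f (k *: v + (h *: v + x)))//.
by apply/funext => k; rewrite [k *: 1]mulr1 scalerDl addrA.
Qed.

Lemma mvt_line f (v : R3 R) x (t : R) : 0 < t -> (forall x, derivable f x v) ->
  exists2 s, 0 < s < t & f (t *: v + x) - f x = 'D_v f (s *: v + x) * t.
Proof.
move=> t0 df.
have D (h : R) := is_derive_line_at (df (h *: v + x)).
have [|s] := @MVT R (fun h => f (h *: v + x)) (fun h => 'D_v f (h *: v + x)) 0 t t0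
  (fun h _ => D h).
  apply: continuous_subspaceT => h; apply: differentiable_continuous.
  by apply/derivable1_diffP; have [] := D h.
by rewrite in_itv/= scale0r add0r subr0 => s0t E; exists s.
Qed.

(** Every difference quotient has integral zero by translation invariance. The mean value theorem
    bounds the quotients by a constant on a fixed cube, and dominated convergence passes to the
    derivative. *)
Lemma integral_partial0 i f : Cn 1 f -> compact (supp f) ->
  (\int[mu3 R]_x (partial i f x)%:E = 0)%E.
Proof.
move=> [cf /(_ i)[df [cpf _]]] kf.
have kpf := @compact_supp_partial i _ kf.
have [C C0 HC] := compact_supp_bounded cpf kpf.
have [M M0 HM] := compact_supp_norm kf.
pose t n : R := n.+1%:R^-1.
have t0 n : 0 < t n by rewrite invr_gt0.
have t1 n : t n <= 1 by rewrite invf_le1// ler1n.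
pose g n x : R := (t n)^-1 * (f (x + t n *: e3 R i) - f x).
have mf : measurable_fun (setT : set M3) f by exact: continuous_measurable3.
have mft n : measurable_fun (setT : set M3) (fun x => f (x + t n *: e3 R i)).
  apply: continuous_measurable3 => x; apply: continuous_comp; last exact: cf.
  by apply: cvgD; [exact: cvg_id|exact: cvg_cst].
have mg n : measurable_fun (setT : set M3) (g n).
  by apply: measurable_funM => //; apply: measurable_funB.
have ei1 : `|e3 R i| <= 1.
  by rewrite !prod_normE !ge_max; case: i {df cpf kpf HC g mft mg} =>
    [[|[|[|//]]] ?] /=;
    rewrite ?normr1 ?normr0 ?lexx ?ler01.
(* The shifts have norm at most 1, so all the quotients vanish outside the cube of half-side
   [M + 1]. *)
have gC n x : `|g n x| <= C * \1_(cube (M + 1)) x.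
  have [xM|xM] := boolP (x \in cube (M + 1));
    rewrite indicE ?(negbTE xM) ?xM /= ?mulr1 ?mulr0.
    have [s _ E] := @mvt_line f (e3 R i) x (t n) (t0 n) df.
    by rewrite /g [x + _]addrC E mulrC mulfK ?gt_eqF ?HC.
  have xM1 : M + 1 < `|x|.
    rewrite ltNge; apply: contra xM => /cubeP; exact: mem_set.
  rewrite /g; have [->|/HM] := eqVneq (f x) 0; last first.
    by move=> xM2; have := lt_le_trans xM1 xM2; rewrite gtrDl ltr10.
  have [->|/HM] := eqVneq (f (x + t n *: e3 R i)) 0;
    first by rewrite subr0 mulr0 normr0.
  move=> H; have : `|x| <= M + 1.
    rewrite -(addrK (t n *: e3 R i) x) (le_trans (ler_normB _ _))// lerD//.
    by rewrite normrZ (gtr0_norm (t0 n)) mulr_ile1// ltW.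
  by rewrite leNgt xM1.
have Ig : (mu3 R).-integrable setT (fun x : M3 => (C * \1_(cube (M + 1)) x)%:E).
  apply: (@integrable_bounded setT (fun x => C * \1_(cube (M + 1)) x) C (M + 1)) => //.
  - by apply: measurable_funM => //; apply: measurable_indic; exact: measurable_cube.
  - move=> x; rewrite indicE; case: (_ \in _);
    rewrite ?mulr1 ?mulr0 ?normr0 ?(ltW C0)//.
    by rewrite gtr0_norm.
  - move=> x; rewrite indicE; case: (boolP (x \in _)); last by rewrite mulr0 eqxx.
    by rewrite inE => /cubeP.
have [C' _ HC'] := compact_supp_bounded cf kf.
have If : (mu3 R).-integrable setT (fun x => (f x)%:E).
  exact: (integrable_bounded measurableT mf HC' HM).
have Ift n : (mu3 R).-integrable setT (fun x => (f (x + t n *: e3 R i))%:E).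
  apply: (@integrable_bounded setT (fun x => f (x + t n *: e3 R i)) C' (M + 1)) =>
    // x /HM H.
  rewrite -(addrK (t n *: e3 R i) x) (le_trans (ler_normB _ _))// lerD//.
  by rewrite normrZ (gtr0_norm (t0 n)) mulr_ile1// ltW.
have H1 : {ae mu3 R, forall x, setT x -> (g n x)%:E @[n --> \oo] -->
  (partial i f x)%:E}.
  apply: aeW => x _.
  have D0 : h^-1 * (f (h *: e3 R i + x) - f x) @[h --> 0^'] --> partial i f x.
    exact: df.
  have T0 : (forall n, t n != 0) /\ t n @[n --> \oo] --> 0.
    by split; [move=> n; rewrite gt_eqF|exact: cvg_harmonic].
  have D1 := (cvgr_dnbhsP _ _ _).1 D0 t T0.
  apply: cvg_EFin; first exact: nearW.
  rewrite (_ : _ \o _ = fun n => (t n)^-1 * (f (t n *: e3 R i + x) - f x))//.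
  by apply/funext => n; rewrite /= /g [x + _]addrC.
have H2 : {ae mu3 R, forall x, forall n, setT x ->
  (`|(g n x)%:E| <= (C * \1_(cube (M + 1)) x)%:E)%E}.
  by apply: aeW => x n _; rewrite /= lee_fin gC.
have [_ _ H3] := @dominated_convergence _ _ R (mu3 R) setT measurableT
  (fun n x => (g n x)%:E) (fun x => (partial i f x)%:E) _
  (fun n => (measurable_EFinP _ _).2 (mg n))
  ((measurable_EFinP _ _).2 (continuous_measurable3 cpf)) H1 Ig H2.
apply/esym; move: H3; rewrite (_ : (fun n => _) = fun=> 0%E); last first.
  apply/funext => n /=.
  under eq_integral do rewrite EFinM EFinB.
  rewrite integralZl//; last exact: integrableB.
  rewrite integralB//.
  by rewrite integral3_translation// subee ?mule0//; exact: integrable_fin_num.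
by move=> /cvg_lim <- //; rewrite lim_cst.
Qed.

End compact_support.

(** * The energy integral of the regularised kernel *)

Section radial_bound.
Context {R : realType}.
Local Notation la := (@lebesgue_measure R).
Implicit Types (e t mu : R).

Definition norm3 (x : R3 R) : R := Num.sqrt (sqnorm3 x).

Lemma sqnorm3_ge0 (x : R3 R) : 0 <= sqnorm3 x.
Proof. by rewrite /sqnorm3 !addr_ge0// sqr_ge0. Qed.

Lemma sqr_norm3 (x : R3 R) : norm3 x ^+ 2 = sqnorm3 x.
Proof. by rewrite sqr_sqrtr// sqnorm3_ge0. Qed.

Lemma hyp_norm e t : hyp e `|t| = hyp e t.
Proof. by rewrite /hyp real_normK// num_real. Qed.

Lemma ge0_integral_radial_norm (g : R -> R) : continuous g -> (forall t, 0 <= g t) ->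
  (\int[mu3 R]_x (g (norm3 x))%:E =
   (2 * pi)%:E * \int[la]_t (t ^+ 2 * g `|t|)%:E)%E.
Proof.
move=> cg g0; rewrite (@ge0_integral_radial _ (fun t => g (Num.sqrt t)))//.
  by congr (_ * _)%E; apply: eq_integral => t _; rewrite sqrtr_sqr.
apply: continuous_measurable_fun => t.
by apply: (@continuous_comp _ _ _ Num.sqrt g); [exact: sqrt_continuous|exact: cg].
Qed.

(** [dG] only has to dominate the radial integrand on the half line, so no exact primitive of a
    regularised integrand is needed. *)
Lemma ge0_integral_radial_le (g G dG : R -> R) l : continuous g ->
  (forall t, 0 <= g t) -> continuous dG ->
  (forall t, 0 <= t -> t ^+ 2 * g t <= dG t) ->
  (forall t, is_derive t 1 G (dG t)) -> G t @[t --> +oo] --> l ->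
  (\int[mu3 R]_x (g (norm3 x))%:E <= (4 * pi * (l - G 0))%:E)%E.
Proof.
move=> cg g0 cdG H D Gl; rewrite ge0_integral_radial_norm//.
have cg' : continuous (fun t => t ^+ 2 * g `|t|).
  move=> t; apply: cvgM; first exact: exprn_continuous.
  by apply: (@continuous_comp _ _ _ (fun t => `|t|) g);
    [exact: norm_continuous|exact: cg].
rewrite ge0_symfun_integralT//; last 2 first.
- by move=> t; rewrite mulr_ge0 ?sqr_ge0.
- by move=> t /=; rewrite sqrrN normrN.
have -> : (4 * pi * (l - G 0))%:E = ((2 * pi)%:E * (2 * (l%:E - (G 0)%:E)))%E.
  by rewrite -EFinB -!EFinM; congr EFin; ring.
apply: lee_wpmul2l; first by rewrite lee_fin mulr_ge0// pi_ge0.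
apply: lee_wpmul2l => //.
rewrite -set_itvcy.
have E : (\int[la]_(t in `[0%R, +oo[) (dG t)%:E = l%:E - (G 0)%:E)%E.
  apply: ge0_continuous_FTC2y => //.
  - by move=> t t0; rewrite (le_trans _ (H t t0))// mulr_ge0// sqr_ge0.
  - exact: continuous_subspaceT.
  - apply: cvg_at_right_filter; apply: differentiable_continuous.
    by apply/derivable1_diffP; have [] := D 0.
  - by move=> t _; rewrite derive1E; have [] := D t.
rewrite -E; apply: ge0_le_integral => //.
- by move=> t _; rewrite lee_fin mulr_ge0// sqr_ge0.
- apply/measurable_EFinP; apply: measurable_funTS; exact: continuous_measurable_fun.
- apply/measurable_EFinP; apply: measurable_funTS; exact: continuous_measurable_fun.
- move=> t; rewrite /= in_itv/= andbT => t0; rewrite lee_fin.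
  by rewrite (ger0_norm t0) H.
Qed.

Definition ek mu e t := expR (- (mu * hyp e t)).

Lemma is_derive_ek mu e t : 0 < e ->
  is_derive t 1 (ek mu e) (- mu * (t / hyp e t) * ek mu e t).
Proof.
move=> e0; have d := is_derive_hyp t e0.
have d1 : is_derive t 1 (fun t => - mu * hyp e t) (- mu * (t / hyp e t)).
  exact: (@is_deriveZ _ _ _ (hyp e) (- mu) t 1 _ d).
have d2 := @is_derive1_comp _ expR (fun t => - mu * hyp e t) t _ _ (is_derive_expR
  _) d1.
have -> : ek mu e = expR \o (fun t => - mu * hyp e t).
  by apply/funext => u; rewrite /ek /= mulNr.
by apply: (is_derive_eq d2); rewrite mulrC /=.
Qed.

Lemma continuous_ek mu e : continuous (ek mu e).
Proof.
move=> t; apply: (@continuous_comp _ _ _ (fun t => - (mu * hyp e t)) expR).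
  by apply: cvgN; apply: cvgMr => //; exact: continuous_hyp.
exact: continuous_expR.
Qed.

(* The value of [mu^-2 |grad (newton - yukawa)|^2 + yukawa^2] at distance [t]
   from the pole. *)
Definition radial_energy mu e t :=
  t ^+ 2 / hyp e t ^+ 6 * (((mu * hyp e t + 1) * ek mu e t - 1) / mu) ^+ 2
  + (ek mu e t / hyp e t) ^+ 2.

Lemma continuous_radial_energy mu e : 0 < e -> continuous (radial_energy mu e).
Proof.
move=> e0 t.
have ch := @continuous_hyp R e t; have ce := @continuous_ek mu e t.
have cX n : hyp e u ^+ n @[u --> t] --> hyp e t ^+ n.
  by apply: (cvg_comp _ (fun x : R => x ^+ n) ch); exact: exprn_continuous.
have c2 (f : R -> R) : f u @[u --> t] --> f t -> f u ^+ 2 @[u --> t] --> f t ^+ 2.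
  by move=> cf; apply: (cvg_comp _ (fun x : R => x ^+ 2) cf); exact: exprn_continuous.
apply: cvgD.
  apply: cvgM; first apply: cvgM.
  - exact: exprn_continuous.
  - by apply: cvgV => //; rewrite gt_eqF// exprn_gt0// hyp_gt0.
  - apply: (c2 (fun t => ((mu * hyp e t + 1) * ek mu e t - 1) / mu)).
    apply: cvgMl => //; apply: cvgB; last exact: cvg_cst.
    apply: cvgM => //; apply: cvgD; last exact: cvg_cst.
    exact: cvgMr.
apply: (c2 (fun t => ek mu e t / hyp e t)); apply: cvgM => //.
by apply: cvgV => //; rewrite gt_eqF// hyp_gt0.
Qed.

Lemma integral_radial_energy mu e : 0 < mu -> 0 < e ->
  (\int[mu3 R]_x (radial_energy mu e (norm3 x))%:E <= (4 * pi / mu)%:E)%E.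
Proof.
move=> mu0 e0.
(* At [e = 0], [G] is a primitive of [t^2 * radial_energy]. *)
pose G t := - ((ek mu e t) ^+ 2 / mu + (1 - ek mu e t) ^+ 2 / (mu ^+ 2 * hyp e t)).
pose dG t := (t / hyp e t) * ((((mu * hyp e t +
  1) * ek mu e t - 1) / (mu * hyp e t)) ^+ 2
  + ek mu e t ^+ 2).
have D t : is_derive t 1 G (dG t).
  have h0 : hyp e t != 0 by rewrite gt_eqF// hyp_gt0.
  have dk := is_derive_ek mu t e0.
  have dh := is_derive_hyp t e0.
  have d1 : is_derive t 1 (fun t => (ek mu e t) ^+ 2) _ := is_deriveX 2 dk.
  have d2 : is_derive t 1 (fun t => (ek mu e t) ^+ 2 / mu) _ :=
    is_deriveM d1 (is_derive_cst mu^-1 t 1).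
  have d3 : is_derive t 1 (fun t => 1 - ek mu e t) _ :=
    is_deriveB (is_derive_cst (1 : R) t 1) dk.
  have d4 : is_derive t 1 (fun t => (1 - ek mu e t) ^+ 2) _ := is_deriveX 2 d3.
  have d5 : is_derive t 1 (fun t => mu ^+ 2 * hyp e t) _ :=
    @is_deriveZ _ _ _ (hyp e) (mu ^+ 2) t 1 _ dh.
  have m0 : mu ^+ 2 * hyp e t != 0 by rewrite mulf_neq0// expf_neq0// gt_eqF.
  have d6 : is_derive t 1 (fun t => (mu ^+ 2 * hyp e t)^-1) _ :=
    @is_derive1_comp _ GRing.inv (fun t => mu ^+ 2 * hyp e t) t _ _ (is_derive_inv
      m0) d5.
  have d7 : is_derive t 1 (fun t => (1 - ek mu e t) ^+ 2 / (mu ^+ 2 * hyp e t)) _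
    := is_deriveM d4 d6.
  have d8 : is_derive t 1 G _ := is_deriveN (is_deriveD d2 d7).
  apply: (is_derive_eq d8).
  rewrite /dG /GRing.scale /cst /=; field.
  by rewrite h0 gt_eqF.
have cdG : continuous dG.
  move=> t; have ch := @continuous_hyp R e t; have ce := @continuous_ek mu e t.
  have c2 (f : R -> R) : f u @[u --> t] --> f t -> f u ^+ 2 @[u --> t] --> f t ^+ 2.
    by move=> cf; apply: (cvg_comp _ (fun x : R => x ^+ 2) cf); exact: exprn_continuous.
  apply: cvgM.
    by apply: cvgM; [exact: cvg_id|apply: cvgV => //; rewrite gt_eqF// hyp_gt0].
  apply: cvgD; last exact: (c2 (ek mu e)).
  apply: (c2 (fun t => ((mu * hyp e t + 1) * ek mu e t - 1) / (mu * hyp e t))).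
  apply: cvgM.
    apply: cvgB; last exact: cvg_cst.
    by apply: cvgM => //; apply: cvgD; [exact: cvgMr|exact: cvg_cst].
  by apply: cvgV; [rewrite mulf_neq0// gt_eqF// hyp_gt0|exact: cvgMr].
(* The regularised integrand differs from [dG] only by powers of [t / hyp e t], which are at most
   1. *)
have H t : 0 <= t -> t ^+ 2 * radial_energy mu e t <= dG t.
  move=> t0; have h0 := hyp_gt0 t e0; have th := ler_hyp e t.
  have th1 : 0 <= t / hyp e t <= 1 by rewrite divr_ge0 ?(ltW h0)//= ler_pdivrMr// mul1r.
  have -> : t ^+ 2 * radial_energy mu e t = (t / hyp e t) *
     ((t / hyp e t) ^+ 3 * (((mu * hyp e t + 1) * ek mu e t - 1) / (mu * hyp e t))
       ^+ 2 + (t / hyp e t) * ek mu e t ^+ 2).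
    rewrite /radial_energy; field.
    by rewrite !gt_eqF.
  move: th1 => /andP[u0 u1]; rewrite /dG ler_wpM2l//.
  by rewrite lerD// ler_piMl ?sqr_ge0// exprn_ile1.
have ek_le1 t : 0 <= ek mu e t <= 1.
  by rewrite expR_ge0 expR_le1 oppr_le0 mulr_ge0 ?(ltW mu0)// sqrtr_ge0.
have Gl : G t @[t --> +oo] --> (0 : R).
  apply/cvgrPdist_le => /= eps eps0; near=> t.
  have t0 : 0 < t by near: t; exact: nbhs_pinfty_gt.
  have tb : 2 / (mu ^+ 2 * eps) <= t by near: t; apply: nbhs_pinfty_ge; exact: num_real.
  have h0 := hyp_gt0 t e0; have th := ler_hyp e t.
  have /andP[k0 k1] := ek_le1 t.
  rewrite sub0r /G opprK ger0_norm; last first.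
    by rewrite addr_ge0// divr_ge0 ?sqr_ge0 ?(ltW mu0)// mulr_ge0 ?sqr_ge0// ltW.
  have kle : ek mu e t <= (mu * t)^-1.
    rewrite /ek expRN lef_pV2 ?posrE ?expR_gt0 ?mulr_gt0//.
    by rewrite (le_trans _ (expR_ge1Dx _))// (le_trans (ler_wpM2l (ltW mu0) th))//
      lerDr.
  have A1 : (ek mu e t) ^+ 2 / mu <= (mu ^+ 2 * t)^-1.
    rewrite ler_pdivrMr// (_ : _ * mu = (mu * t)^-1); last by field; rewrite !gt_eqF.
    by rewrite (le_trans _ kle)// expr2 ler_piMl.
  have A2 : (1 - ek mu e t) ^+ 2 / (mu ^+ 2 * hyp e t) <= (mu ^+ 2 * t)^-1.
    rewrite -[leRHS]mul1r ler_pM ?sqr_ge0//.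
    - by rewrite invr_ge0 mulr_ge0 ?sqr_ge0// ltW.
    - by rewrite exprn_ile1// ?subr_ge0// lerBlDr lerDl.
    - by rewrite lef_pV2 ?posrE ?mulr_gt0 ?exprn_gt0// ler_wpM2l ?sqr_ge0.
  apply: (le_trans (lerD A1 A2)).
  rewrite -mulr2n -[leLHS]mulr_natl ler_pdivrMr ?mulr_gt0 ?exprn_gt0//.
  move: tb; rewrite ler_pdivrMr ?mulr_gt0 ?exprn_gt0// => /le_trans; apply.
  by rewrite le_eqVlt; apply/orP; left; apply/eqP; ring.
have rp t : 0 <= radial_energy mu e t.
  by rewrite /radial_energy addr_ge0// ?sqr_ge0// mulr_ge0 ?sqr_ge0//
    divr_ge0 ?sqr_ge0// exprn_ge0// sqrtr_ge0.
apply: (le_trans (ge0_integral_radial_le (continuous_radial_energy e0) rp cdG H D Gl)).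
rewrite lee_fin sub0r ler_wpM2l//; first by rewrite mulr_ge0// pi_ge0.
have h0 : hyp e 0 = e by rewrite /hyp expr0n/= add0r sqrtr_sqr gtr0_norm.
rewrite /G opprK h0; have /andP[k0 k1] := ek_le1 0.
have y0 : 0 < mu * e by rewrite mulr_gt0.
have ky : 1 - ek mu e 0 <= mu * e.
  rewrite lerBlDl -lerBlDr; apply: le_trans (expR_ge1Dx _); by rewrite h0.
(* With y = mu e and E = exp(-y), the bound on [- G 0] reduces to E^2 + (1 - E)^2 / y <= 1, a
   consequence of 0 <= 1 - E <= y. *)
have -> : ek mu e 0 ^+ 2 / mu + (1 - ek mu e 0) ^+ 2 / (mu ^+ 2 * e) =
  (ek mu e 0 ^+ 2 + (1 - ek mu e 0) ^+ 2 / (mu * e)) / mu.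
  by field; rewrite !gt_eqF.
rewrite -[leRHS]mul1r ler_wpM2r ?invr_ge0 ?(ltW mu0)//.
rewrite -lerBrDl ler_pdivrMr//; move: k0 k1 y0 ky.
move: (ek mu e 0) (mu * e) => E y k0 k1 y0 ky.
have H1 : 0 <= (1 - E) * (y - (1 - E)) by rewrite mulr_ge0 ?subr_ge0.
have H2 : 0 <= (1 - E) * (E * y) by rewrite mulr_ge0 ?subr_ge0// mulr_ge0// ltW.
rewrite -subr_ge0 (_ : _ - _ = (1 - E) * (y - (1 - E)) + (1 - E) * (E * y));
  last by ring.
by rewrite addr_ge0.
Unshelve. all: by end_near. Qed.

End radial_bound.

(** * Regularised Newton and Yukawa kernels and their derivatives *)

Section kernels.
Context {R : realType}.
Implicit Types (e mu : R) (a x : R3 R) (i : 'I_3).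

Lemma sum3E (F : 'I_3 -> R) :
  \sum_(i < 3) F i = F ord0 + F (lift ord0 ord0) + F (lift ord0 (lift ord0 ord0)).
Proof. by rewrite !big_ord_recl big_ord0 addr0 addrA. Qed.

Lemma sqnorm3E x : sqnorm3 x = \sum_(i < 3) coord3 i x ^+ 2.
Proof. by rewrite sum3E. Qed.

Lemma coord3B i x a : coord3 i (x - a) = coord3 i x - coord3 i a.
Proof. by rewrite /coord3; case: ifP => _; [|case: ifP]. Qed.

Definition kdist e a x := hyp e (norm3 (x - a)).

Lemma kdistE e a x : kdist e a x = Num.sqrt (sqnorm3 (x - a) + e ^+ 2).
Proof. by rewrite /kdist /hyp sqr_norm3. Qed.

Lemma kdist_gt0 e a x : 0 < e -> 0 < kdist e a x.
Proof. exact: hyp_gt0. Qed.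

Lemma kdist_sqr e a x : kdist e a x ^+ 2 = sqnorm3 (x - a) + e ^+ 2.
Proof. by rewrite /kdist hyp_sqr sqr_norm3. Qed.

Lemma kdist_ge e a x : 0 < e -> e <= kdist e a x.
Proof.
move=> e0; rewrite kdistE -[leLHS](gtr0_norm e0) -sqrtr_sqr ler_sqrt.
  by rewrite lerDr sqnorm3_ge0.
by rewrite addr_ge0 ?sqnorm3_ge0 ?sqr_ge0.
Qed.

Lemma coord3_sqr_le e a x i : 0 < e -> `|coord3 i (x - a)| <= kdist e a x.
Proof.
move=> e0; rewrite kdistE -sqrtr_sqr ler_sqrt ?addr_ge0 ?sqnorm3_ge0 ?sqr_ge0//.
rewrite sqnorm3E (bigD1 i)//= -addrA lerDl addr_ge0 ?sqr_ge0//.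
by apply: sumr_ge0 => j _; exact: sqr_ge0.
Qed.

Lemma Cn_sqnorm3 n a : Cn n (fun x => sqnorm3 (x - a)).
Proof.
rewrite (_ : (fun x => _) = fun x =>
    (coord3 ord0 x + - coord3 ord0 a) * (coord3 ord0 x + - coord3 ord0 a)
  + (coord3 (lift ord0 ord0) x + - coord3 (lift ord0 ord0) a) * (coord3 (lift ord0
    ord0) x + - coord3 (lift ord0 ord0) a)
  + (coord3 (lift ord0 (lift ord0 ord0)) x + - coord3 (lift ord0 (lift ord0 ord0))
    a) * (coord3 (lift ord0 (lift ord0 ord0)) x +
      - coord3 (lift ord0 (lift ord0 ord0)) a)).
  by apply: CnD; [apply: CnD|]; apply: CnM; apply: CnD;
     solve [exact: Cn_coord3|exact: Cn_cst].
by apply/funext => x; rewrite sqnorm3E sum3E !coord3B !expr2.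
Qed.

Lemma Cn_kdist n e a : 0 < e -> Cn n (kdist e a).
Proof.
move=> e0; rewrite (_ : kdist e a = fun x => Num.sqrt (sqnorm3 (x - a) + e ^+ 2)).
  apply: Cn_sqrt; first by move=> x; rewrite ltr_wpDl ?sqnorm3_ge0// exprn_gt0.
  by apply: CnD; [exact: Cn_sqnorm3|exact: Cn_cst].
by apply/funext => x; rewrite kdistE.
Qed.

Lemma is_derive_coord3B i j a x :
  is_derive x (e3 R i) (fun x => coord3 j (x - a)) (i == j)%:R.
Proof.
rewrite (_ : (fun x => _) = fun x => coord3 j x - coord3 j a).
  apply: (is_derive_eq (is_deriveB (is_derive_coord3 j x (e3 R i)) (is_derive_cst
    (coord3 j a) x (e3 R i)))).
  by rewrite subr0 coord3_e3 eq_sym.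
by apply/funext => y; rewrite coord3B.
Qed.

Lemma is_derive_sqnorm3 i a x :
  is_derive x (e3 R i) (fun x => sqnorm3 (x - a)) (2 * coord3 i (x - a)).
Proof.
rewrite (_ : (fun x => _) = fun x => \sum_(j < 3) (coord3 j (x - a)) ^+ 2).
  have D := @is_derive_sum R _ _ 3 (fun j x => (coord3 j (x - a)) ^+ 2) x (e3 R i) _
    (fun j => is_deriveX 2 (is_derive_coord3B i j a x)).
  rewrite (_ : (fun x => _) = \sum_(j < 3) (fun x => (coord3 j (x - a)) ^+ 2)).
    apply: (is_derive_eq D); rewrite (bigD1 i)//= big1 ?addr0.
      by rewrite eqxx /GRing.scale/= mulr1 expr1.
    by move=> j ji; rewrite eq_sym (negbTE ji) scaler0.
  by apply/funext => y; rewrite fct_sumE.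
by apply/funext => y; rewrite sqnorm3E.
Qed.

Lemma is_derive_kdist i e a x : 0 < e ->
  is_derive x (e3 R i) (kdist e a) (coord3 i (x - a) / kdist e a x).
Proof.
move=> e0; have k0 := kdist_gt0 a x e0.
have p0 : 0 < sqnorm3 (x - a) + e ^+ 2 by rewrite -kdist_sqr exprn_gt0.
have D1 : is_derive x (e3 R i) (fun x => sqnorm3 (x - a) + e ^+ 2) _ :=
  is_deriveD (is_derive_sqnorm3 i a x) (is_derive_cst (e ^+ 2) x (e3 R i)).
have D2 := is_derive_comp1 (is_derive_sqrt p0) D1.
rewrite (_ : kdist e a = Num.sqrt \o (fun x => sqnorm3 (x - a) + e ^+ 2)).
  apply: (is_derive_eq D2); rewrite /= -kdistE; field; by rewrite gt_eqF.
by apply/funext => y; rewrite kdistE.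
Qed.

Definition newton e a x := (kdist e a x)^-1.
Definition yukawa mu e a x := ek mu e (norm3 (x - a)) / kdist e a x.

Lemma yukawaE mu e a x : yukawa mu e a x = expR (- (mu * kdist e a x)) / kdist e a x.
Proof. by []. Qed.

Lemma Cn_newton n e a : 0 < e -> Cn n (newton e a).
Proof.
move=> e0; apply: CnV; last exact: Cn_kdist.
by move=> x; rewrite gt_eqF// kdist_gt0.
Qed.

Lemma Cn_yukawa n mu e a : 0 < e -> Cn n (yukawa mu e a).
Proof.
move=> e0; apply: CnM; last exact: Cn_newton.
rewrite (_ : (fun x => _) = fun x => expR (- mu * kdist e a x)).
  by apply: Cn_expR; apply: CnM; [exact: Cn_cst|exact: Cn_kdist].
by apply/funext => x; rewrite mulNr.
Qed.

Lemma is_derive_newton i e a x : 0 < e -> is_derive x (e3 R i) (newton e a)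
  (- coord3 i (x - a) / kdist e a x ^+ 3).
Proof.
move=> e0; have k0 : kdist e a x != 0 by rewrite gt_eqF// kdist_gt0.
apply: (is_derive_eq (is_derive_comp1 (is_derive_inv k0) (is_derive_kdist i a x e0))).
by field.
Qed.

Lemma is_derive_ekdist i mu e a x : 0 < e ->
  is_derive x (e3 R i) (fun x => ek mu e (norm3 (x - a)))
  (- mu * ek mu e (norm3 (x - a)) * coord3 i (x - a) / kdist e a x).
Proof.
move=> e0.
have D1 : is_derive x (e3 R i) (fun x => - mu * kdist e a x) _ :=
  @is_deriveZ _ _ _ (kdist e a) (- mu) x (e3 R i) _ (is_derive_kdist i a x e0).
have D2 := is_derive_comp1 (is_derive_expR _) D1.
rewrite (_ : (fun x => _) = expR \o (fun x => - mu * kdist e a x)).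
  by apply: (is_derive_eq D2); rewrite /= /ek -/(kdist e a x) -mulNr
    /GRing.scale/=; ring.
by apply/funext => y; rewrite /= mulNr.
Qed.

Lemma is_derive_yukawa i mu e a x : 0 < e -> is_derive x (e3 R i) (yukawa mu e a)
  (- ((mu * kdist e a x + 1) * ek mu e (norm3 (x - a))) * coord3 i (x - a) / kdist
    e a x ^+ 3).
Proof.
move=> e0; have k0 : kdist e a x != 0 by rewrite gt_eqF// kdist_gt0.
have D : is_derive x (e3 R i) (yukawa mu e a) _ :=
  is_deriveM (is_derive_ekdist i mu a x e0) (is_derive_newton i a x e0).
apply: (is_derive_eq D); rewrite /newton /GRing.scale /=; by field.
Qed.

Lemma partial_newton i e a : 0 < e ->
  partial i (newton e a) = fun x => - coord3 i (x - a) / kdist e a x ^+ 3.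
Proof. by move=> e0; apply/funext => x; have [] := is_derive_newton i a x e0. Qed.

Lemma partial_yukawa i mu e a : 0 < e -> partial i (yukawa mu e a) =
  fun x => - ((mu * kdist e a x + 1) * ek mu e (norm3 (x - a))) * coord3 i (x - a)
    / kdist e a x ^+ 3.
Proof. by move=> e0; apply/funext => x; have [] := is_derive_yukawa i mu a x e0. Qed.

Lemma is_derive_kdist3V i e a x : 0 < e ->
  is_derive x (e3 R i) (fun x => (kdist e a x ^+ 3)^-1) (- 3 * coord3 i (x - a) /
    kdist e a x ^+ 5).
Proof.
move=> e0; have k0 : kdist e a x != 0 by rewrite gt_eqF// kdist_gt0.
have k3 : kdist e a x ^+ 3 != 0 by rewrite expf_neq0.
have D1 : is_derive x (e3 R i) (fun x => kdist e a x ^+ 3) _ :=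
  is_deriveX 3 (is_derive_kdist i a x e0).
apply: (is_derive_eq (is_derive_comp1 (is_derive_inv k3) D1)).
by rewrite /GRing.scale/=; field.
Qed.

Lemma partial2_newton i e a x : 0 < e -> partial i (partial i (newton e a)) x =
  - (kdist e a x ^+ 3)^-1 + 3 * coord3 i (x - a) ^+ 2 / kdist e a x ^+ 5.
Proof.
move=> e0; rewrite partial_newton//.
have k0 : kdist e a x != 0 by rewrite gt_eqF// kdist_gt0.
have D0 : is_derive x (e3 R i) (fun x => - coord3 i (x - a)) _ :=
  is_deriveN (is_derive_coord3B i i a x).
have D : is_derive x (e3 R i) (fun x => - coord3 i (x - a) / kdist e a x ^+ 3) _ :=
  is_deriveM D0 (is_derive_kdist3V i a x e0).
rewrite /partial; have [_ ->] := D; rewrite eqxx /GRing.scale/=; by field.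
Qed.

Lemma laplacian_newton e a x : 0 < e ->
  laplacian (newton e a) x = - (3 * e ^+ 2 / kdist e a x ^+ 5).
Proof.
move=> e0; have k0 : kdist e a x != 0 by rewrite gt_eqF// kdist_gt0.
rewrite /laplacian; under eq_bigr do rewrite partial2_newton//.
rewrite big_split/= sumr_const card_ord -mulr_suml -mulr_sumr -sqnorm3E.
have -> : sqnorm3 (x - a) = kdist e a x ^+ 2 - e ^+ 2 by rewrite kdist_sqr addrK.
by rewrite -mulr_natl; field.
Qed.

Lemma partial2_yukawa i mu e a x : 0 < e -> partial i (partial i (yukawa mu e a)) x =
  let k := kdist e a x in let E := ek mu e (norm3 (x - a)) in
  - (mu * k + 1) * E / k ^+ 3
  + (mu ^+ 2 * E / k ^+ 3 + 3 * (mu * k + 1) * E / k ^+ 5) * coord3 i (x - a) ^+ 2.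
Proof.
move=> e0 /=; rewrite partial_yukawa//.
have k0 : kdist e a x != 0 by rewrite gt_eqF// kdist_gt0.
have D1 : is_derive x (e3 R i) (fun x => mu * kdist e a x + 1) _ :=
  is_deriveD (@is_deriveZ _ _ _ (kdist e a) mu x (e3 R i) _ (is_derive_kdist i a x
    e0)) (is_derive_cst (1 : R) x (e3 R i)).
have D2 : is_derive x (e3 R i) (fun x => (mu * kdist e a x +
  1) * ek mu e (norm3 (x - a))) _ :=
  is_deriveM D1 (is_derive_ekdist i mu a x e0).
have D3 : is_derive x (e3 R i) (fun x => - ((mu * kdist e a x +
  1) * ek mu e (norm3 (x - a)))) _ :=
  is_deriveN D2.
have D4 : is_derive x (e3 R i) (fun x => - ((mu * kdist e a x +
  1) * ek mu e (norm3 (x - a))) * coord3 i (x - a)) _ :=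
  is_deriveM D3 (is_derive_coord3B i i a x).
have D5 : is_derive x (e3 R i) (fun x => - ((mu * kdist e a x +
  1) * ek mu e (norm3 (x - a))) * coord3 i (x - a) / kdist e a x ^+ 3) _ :=
  is_deriveM D4 (is_derive_kdist3V i a x e0).
rewrite /partial; have [_ ->] := D5; rewrite eqxx /GRing.scale/=; by field.
Qed.

Lemma laplacian_yukawa mu e a x : 0 < e -> laplacian (yukawa mu e a) x =
  let k := kdist e a x in let E := ek mu e (norm3 (x - a)) in
  mu ^+ 2 * E / k - e ^+ 2 * E * (mu ^+ 2 * k ^+ 2 + 3 * (mu * k + 1)) / k ^+ 5.
Proof.
move=> e0 /=; have k0 : kdist e a x != 0 by rewrite gt_eqF// kdist_gt0.
rewrite /laplacian; under eq_bigr do rewrite partial2_yukawa//.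
rewrite big_split/= sumr_const card_ord -mulr_sumr -sqnorm3E.
have -> : sqnorm3 (x - a) = kdist e a x ^+ 2 - e ^+ 2 by rewrite kdist_sqr addrK.
by rewrite -mulr_natl; field.
Qed.

(** The singularities of the two terms compensate: this difference stays below [mu] for every [e],
    although each term reaches 1 / e in size as [e] tends to 0. *)
Definition regular mu e a x := newton e a x - yukawa mu e a x.

End kernels.

(** * Calculus of real-valued integrals over the whole space *)

Section integrable3.
Context {R : realType}.
Local Notation M3 :=
  (measurableTypeR R * measurableTypeR R * measurableTypeR R)%type.
Implicit Types (f g : R3 R -> R) (i : 'I_3).

Definition itg f : Prop := (mu3 R).-integrable (setT : set M3) (EFin \o f).
Definition mfun3 f : Prop := measurable_fun (setT : set M3) f.

Lemma continuous_mfun3 f : continuous f -> mfun3 f.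
Proof. exact: continuous_measurable3. Qed.

Lemma itg_mfun f : itg f -> mfun3 f.
Proof. by move=> /integrableP[/measurable_EFinP]. Qed.

Lemma itgD f g : itg f -> itg g -> itg (fun x => f x + g x).
Proof. by move=> If Ig; have := integrableD measurableT If Ig. Qed.

Lemma itgB f g : itg f -> itg g -> itg (fun x => f x - g x).
Proof. by move=> If Ig; have := integrableB measurableT If Ig. Qed.

Lemma itgZ c f : itg f -> itg (fun x => c * f x).
Proof. by move=> If; have := integrableZl measurableT c If. Qed.

Lemma itg_sum (F : 'I_3 -> R3 R -> R) : (forall i, itg (F i)) ->
  itg (fun x => \sum_(i < 3) F i x).
Proof.
move=> IF; under eq_fun do rewrite sum3E.
by apply: itgD => //; apply: itgD.
Qed.

Lemma itg_le f g : mfun3 f -> (forall x, `|f x| <= g x) -> itg g -> itg f.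
Proof.
move=> mf fg; apply: le_integrable => //; first exact/measurable_EFinP.
by move=> x _ /=; rewrite lee_fin (le_trans (fg x))// ler_norm.
Qed.

Lemma itg_ge0 f (c : R) : mfun3 f -> (forall x, 0 <= f x) ->
  (\int[mu3 R]_x (f x)%:E <= c%:E)%E -> itg f.
Proof.
move=> mf f0 fc; apply/integrableP; split; first exact/measurable_EFinP.
under eq_integral do rewrite /= ger0_norm//.
exact: le_lt_trans (ltry c).
Qed.

Lemma continuous_itg f : continuous f -> compact (supp f) -> itg f.
Proof. exact: continuous_integrable. Qed.

Lemma mfun3D f g : mfun3 f -> mfun3 g -> mfun3 (fun x => f x + g x).
Proof. exact: measurable_funD. Qed.

Lemma mfun3M f g : mfun3 f -> mfun3 g -> mfun3 (fun x => f x * g x).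
Proof. exact: measurable_funM. Qed.

Lemma mfun3N f : mfun3 f -> mfun3 (fun x => - f x).
Proof.
move=> mf; under [X in mfun3 X]eq_fun do rewrite -mulN1r.
by apply: mfun3M => //; exact: measurable_cst.
Qed.

Lemma mfun3X f n : mfun3 f -> mfun3 (fun x => f x ^+ n).
Proof. exact: measurable_funX. Qed.

Lemma itgM2 f g : mfun3 f -> mfun3 g -> itg (fun x => f x ^+ 2) ->
  itg (fun x => g x ^+ 2) -> itg (fun x => f x * g x).
Proof.
move=> mf mg If Ig; apply: (@itg_le _ (fun x => f x ^+ 2 + g x ^+ 2)).
- exact: mfun3M.
- move=> x; rewrite -[f x ^+ 2]real_normK ?num_real// -[g x ^+ 2]real_normK ?num_real//.
  rewrite normrM; have := sqr_ge0 (`|f x| - `|g x|).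
  have := mulr_ge0 (normr_ge0 (f x)) (normr_ge0 (g x)).
  rewrite sqrrB; lra.
- exact: itgD.
Qed.

Lemma itg_sqrD f g : mfun3 f -> mfun3 g -> itg (fun x => f x ^+ 2) ->
  itg (fun x => g x ^+ 2) -> itg (fun x => (f x + g x) ^+ 2).
Proof.
move=> mf mg If Ig.
rewrite (_ : (fun x => _) = fun x => f x ^+ 2 + 2 * (f x * g x) + g x ^+ 2).
  by apply: itgD => //; apply: itgD => //; apply: itgZ; exact: itgM2.
by apply/funext => x; rewrite sqrrD mulr_natl.
Qed.

Lemma int_ge0 f : (forall x, 0 <= f x) -> 0 <= \int[mu3 R]_x f x.
Proof. by move=> f0; apply: Rintegral_ge0 => x _; exact: f0. Qed.

Lemma int_le f g : itg f -> itg g -> (forall x, f x <= g x) ->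
  \int[mu3 R]_x f x <= \int[mu3 R]_x g x.
Proof. by move=> If Ig fg; apply: le_Rintegral => // x _; exact: fg. Qed.

Lemma intD f g : itg f -> itg g ->
  \int[mu3 R]_x (f x + g x) = \int[mu3 R]_x f x + \int[mu3 R]_x g x.
Proof. by move=> If Ig; exact: RintegralD. Qed.

Lemma intB f g : itg f -> itg g ->
  \int[mu3 R]_x (f x - g x) = \int[mu3 R]_x f x - \int[mu3 R]_x g x.
Proof. by move=> If Ig; exact: RintegralB. Qed.

Lemma intZ c f : itg f -> \int[mu3 R]_x (c * f x) = c * \int[mu3 R]_x f x.
Proof. by move=> If; exact: RintegralZl. Qed.

Lemma int_sum (F : 'I_3 -> R3 R -> R) : (forall i, itg (F i)) ->
  \int[mu3 R]_x (\sum_(i < 3) F i x) = \sum_(i < 3) \int[mu3 R]_x F i x.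
Proof.
move=> IF; rewrite sum3E -!intD//; last exact: itgD.
by apply: eq_Rintegral => x _; rewrite sum3E.
Qed.

Lemma int_EFin f : itg f -> (\int[mu3 R]_x (f x)%:E = (\int[mu3 R]_x f x)%:E)%E.
Proof. by move=> If; rewrite fineK//; exact: integrable_fin_num. Qed.

Lemma int_leP f (c : R) : mfun3 f -> (forall x, 0 <= f x) ->
  (\int[mu3 R]_x (f x)%:E <= c%:E)%E -> \int[mu3 R]_x f x <= c.
Proof. by move=> mf f0 fc; rewrite -lee_fin -int_EFin//; exact: itg_ge0 fc. Qed.

Lemma int_partial i f : Cn 1 f -> compact (supp f) ->
  itg (partial i f) /\ \int[mu3 R]_x partial i f x = 0.
Proof.
move=> Cf kf; split; last by rewrite /Rintegral integral_partial0.
apply: continuous_itg; last exact: compact_supp_partial.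
by have [_ /(_ i)[_ []]] := Cf.
Qed.

End integrable3.

(** * Integrals of the kernels with an arbitrary pole *)

Section kernel_integrals.
Context {R : realType}.
Implicit Types (e mu : R) (a x : R3 R) (i : 'I_3).

Lemma continuous_norm3B a : continuous (fun x : R3 R => norm3 (x - a)).
Proof.
move=> x; apply: (@continuous_comp _ _ _ (fun x => sqnorm3 (x - a)) Num.sqrt).
  exact: (Cn_continuous (Cn_sqnorm3 0 a)).
exact: sqrt_continuous.
Qed.

Lemma mfun3_radial (g : R -> R) a : continuous g -> mfun3 (fun x : R3 R =>
  g (norm3 (x - a))).
Proof.
move=> cg; apply: continuous_measurable3 => x.
by apply: (@continuous_comp _ _ _ (fun x => norm3 (x - a)) g);
  [exact: continuous_norm3B|exact: cg].
Qed.

Lemma integral_radialB (g : R -> R) a : continuous g -> (forall t, 0 <= g t) ->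
  (\int[mu3 R]_x (g (norm3 (x - a)))%:E = \int[mu3 R]_x (g (norm3 x))%:E)%E.
Proof.
move=> cg g0.
rewrite -(@ge0_integral3_translation _ (- a) (fun x => (g (norm3 x))%:E))//; last first.
  by move=> x; rewrite lee_fin.
apply/measurable_EFinP; have := mfun3_radial 0 cg.
by under eq_fun do rewrite subr0.
Qed.

Lemma radial_energy_ge0 mu e t : 0 <= radial_energy mu e t.
Proof.
by rewrite /radial_energy addr_ge0// ?sqr_ge0// mulr_ge0 ?sqr_ge0// divr_ge0 ?sqr_ge0//
  exprn_ge0// sqrtr_ge0.
Qed.

Lemma itg_radial_energy mu e a : 0 < mu -> 0 < e ->
  itg (fun x => radial_energy mu e (norm3 (x - a))) /\
  \int[mu3 R]_x radial_energy mu e (norm3 (x - a)) <= 4 * pi / mu.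
Proof.
move=> mu0 e0.
have m : mfun3 (fun x => radial_energy mu e (norm3 (x - a))).
  by apply: mfun3_radial; exact: continuous_radial_energy.
have p x : 0 <= radial_energy mu e (norm3 (x - a)) by exact: radial_energy_ge0.
have L : (\int[mu3 R]_x (radial_energy mu e (norm3 (x - a)))%:E <= (4 * pi / mu)%:E)%E.
  rewrite (@integral_radialB (radial_energy mu e)) ?integral_radial_energy//.
    exact: continuous_radial_energy.
  by move=> t; exact: radial_energy_ge0.
by split; [exact: (itg_ge0 m p L)|exact: (int_leP m p L)].
Qed.

(* [- laplacian (newton e a)], of total mass [4 pi]. *)
Definition rho e a x : R := 3 * e ^+ 2 / kdist e a x ^+ 5.

Lemma rho_ge0 e a x : 0 <= rho e a x.
Proof.
by rewrite /rho divr_ge0 ?exprn_ge0 ?sqrtr_ge0// mulr_ge0// sqr_ge0.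
Qed.

Lemma continuous_rho e a : 0 < e -> continuous (rho e a).
Proof.
move=> e0 x; apply: cvgMr => //; apply: cvgV;
  first by rewrite expf_neq0// gt_eqF// kdist_gt0.
apply: (@continuous_comp _ _ _ (kdist e a) (fun t => t ^+ 5)).
  exact: (Cn_continuous (Cn_kdist 0 a e0)).
exact: exprn_continuous.
Qed.

Lemma int_rho e a : 0 < e -> itg (rho e a) /\ \int[mu3 R]_x rho e a x = 4 * pi.
Proof.
move=> e0.
have cg : continuous (fun t => 3 * e ^+ 2 / hyp e t ^+ 5).
  move=> t; apply: cvgMr => //; apply: cvgV; first by rewrite expf_neq0// gt_eqF//
    hyp_gt0.
  apply: (@continuous_comp _ _ _ (hyp e) (fun t => t ^+ 5));
    first exact: continuous_hyp.
  exact: exprn_continuous.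
have g0 t : 0 <= 3 * e ^+ 2 / hyp e t ^+ 5.
  by rewrite divr_ge0 ?exprn_ge0 ?sqrtr_ge0// mulr_ge0// sqr_ge0.
have E : (\int[mu3 R]_x (rho e a x)%:E = (4 * pi)%:E)%E.
  rewrite (@integral_radialB (fun t => 3 * e ^+ 2 / hyp e t ^+ 5))//.
  rewrite (@ge0_integral_radial_norm _ (fun t => 3 * e ^+ 2 / hyp e t ^+ 5))//.
  rewrite (_ : (\int[_]_t _)%E = 2%:E); first by rewrite -EFinM; congr EFin; ring.
  rewrite -(integralT_hyp5 e0); apply: eq_integral => t _.
  by rewrite hyp_norm; congr EFin; ring.
have I : itg (rho e a).
  apply: (@itg_ge0 _ _ (4 * pi)); last by rewrite E.
    by apply: continuous_mfun3; exact: continuous_rho.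
  exact: rho_ge0.
by split => //; apply: EFin_inj; rewrite -int_EFin.
Qed.

Lemma rho_sym e a x : rho e a x = rho e x a.
Proof.
have E : sqnorm3 (x - a) = sqnorm3 (a - x) by rewrite /sqnorm3 /=; ring.
by rewrite /rho /kdist /norm3 E.
Qed.

End kernel_integrals.

(** * Test functions and the smoothed absolute value *)

Section test_functions.
Context {R : realType}.
Implicit Types (f g phi : R3 R -> R) (i : 'I_3).

Lemma Cn_derivable n f i x : Cn n.+1 f -> derivable f x (e3 R i).
Proof. by move=> [_ /(_ i)[]]. Qed.

Lemma Cn_partial n f i : Cn n.+1 f -> Cn n (partial i f).
Proof. by move=> [_ /(_ i)[]]. Qed.

Lemma C1_partial_continuous i f : Cn 1 f -> continuous (partial i f).
Proof. by move=> /(@Cn_partial 0 f i) /Cn_continuous. Qed.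

Lemma test_functionP Omega phi : test_function Omega phi ->
  [/\ forall n, Cn n phi, compact (supp phi) & supp phi `<=` Omega].
Proof. by move=> [/smoothP]. Qed.

Lemma test_function_le Omega phi f : (forall n, Cn n f) -> test_function Omega phi ->
  (forall x, phi x = 0 -> f x = 0) -> test_function Omega f.
Proof.
move=> Cf /test_functionP[_ kphi sphi] H; split; first exact/smoothP.
  exact: compact_supp_le H kphi.
exact: subset_trans (supp_le H) sphi.
Qed.

Lemma Cn_hyp n (k : R) f : 0 < k -> Cn n f -> Cn n (fun x => hyp k (f x)).
Proof.
move=> k0 Cf; apply: Cn_sqrt; first by move=> x; rewrite ltr_wpDl ?sqr_ge0// exprn_gt0.
apply: CnD; last exact: Cn_cst.
under [X in Cn _ X]eq_fun do rewrite expr2; exact: CnM.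
Qed.

Lemma partial_hyp i (k : R) f : 0 < k -> (forall x, derivable f x (e3 R i)) ->
  partial i (fun x => hyp k (f x)) = fun x => f x / hyp k (f x) * partial i f x.
Proof.
move=> k0 df.
by have [_ ->] := @partial_comp R i (hyp k) (fun t => t / hyp k t) f df
  (fun x => is_derive_hyp (f x) k0).
Qed.

Lemma partial_div_hyp i (k : R) f : 0 < k -> (forall x, derivable f x (e3 R i)) ->
  partial i (fun x => f x / hyp k (f x)) = fun x =>
    k ^+ 2 / hyp k (f x) ^+ 3 * partial i f x.
Proof.
move=> k0 df.
by have [_ ->] := @partial_comp R i (fun t => t / hyp k t) (fun t =>
  k ^+ 2 / hyp k t ^+ 3) f df
  (fun x => is_derive_div_hyp (f x) k0).
Qed.

End test_functions.

(** * Kato's inequality with explicit error terms *)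

Section kato.
Context {R : realType}.

Lemma am_gm (c x y b : R) : 0 < c -> `|b| <= 1 ->
  b * x * y <= (c * x ^+ 2 + y ^+ 2 / c) / 2.
Proof.
move=> c0 b1; have H : b * x * y <= `|x| * `|y|.
  rewrite (le_trans (ler_norm _))// !normrM -mulrA ler_piMl// mulr_ge0//.
apply: (le_trans H).
have E : (c * x ^+ 2 + y ^+ 2 / c) / 2 - `|x| * `|y| = c * (`|x| - `|y| / c) ^+ 2 / 2.
  rewrite -[x ^+ 2]real_normK ?num_real// -[y ^+ 2]real_normK ?num_real//.
  by field; rewrite gt_eqF.
by rewrite -subr_ge0 E divr_ge0// mulr_ge0 ?sqr_ge0// ltW.
Qed.

(** One coordinate of the main estimate. [H] and [q] stand for the derivatives of the regular and
    the Yukawa kernel, [psi] for the Yukawa kernel itself, [p] for the derivative of the test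
    function and [v] for that of its limit; [b] is the smoothed sign and [b'] its slope. The last
    product is the integrand removed by the weak equation. *)
Lemma kato_pointwise (lam mu th tau H q v d p b b' psi : R) :
  0 < lam -> 0 < mu -> 0 < th -> 0 < tau -> `|b| <= 1 -> 0 <= b' -> 0 <= psi ->
  p = v + d ->
  (H + q) * (b * p) <= lam / 2 * (H / mu) ^+ 2 + tau / 2 * q ^+ 2
    + mu ^+ 2 * (1 + th) / (2 * lam) * v ^+ 2
    + (mu ^+ 2 * (1 + th^-1) / (2 * lam) + (2 * tau)^-1 + psi * b' / 4) * d ^+ 2
    + v * (q * b + psi * b' * p).
Proof.
move=> l0 m0 t0 u0 b1 b0 p0 pE.
have A1 : b * (H / mu) * (mu * p) <= _ := am_gm (H / mu) (mu * p) l0 b1.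
have A2 : b * q * d <= _ := am_gm q d u0 b1.
have n1 : `|1 : R| <= 1 by rewrite normr1.
have A3 : 1 * v * d <= _ := am_gm v d t0 n1.
have A4 : p ^+ 2 <= (1 + th) * v ^+ 2 + (1 + th^-1) * d ^+ 2.
  rewrite pE sqrrD -subr_ge0; move: A3; rewrite mul1r => A3.
  by rewrite (_ : _ - _ = 2 * ((th * v ^+ 2 + d ^+ 2 / th) / 2 - v * d));
    [rewrite mulr_ge0// subr_ge0|rewrite -mulr_natl; field; rewrite gt_eqF].
have A5 : mu ^+ 2 / (2 * lam) * p ^+ 2 <=
    mu ^+ 2 / (2 * lam) * ((1 + th) * v ^+ 2 + (1 + th^-1) * d ^+ 2).
  by rewrite ler_wpM2l// divr_ge0 ?sqr_ge0// mulr_ge0// ltW.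
(* This is the positivity behind Kato's inequality: p v = (p - d/2)^2 - d^2/4 is nonnegative up to
   the error [d]. *)
have A6 : psi * b' * (- (p * v)) <= psi * b' * (d ^+ 2 / 4).
  rewrite ler_wpM2l ?mulr_ge0//; rewrite -subr_ge0.
  rewrite (_ : _ - _ = (p - d / 2) ^+ 2); first exact: sqr_ge0.
  by rewrite pE; field.
have {}A1 : b * H * p <= lam / 2 * (H / mu) ^+ 2 + mu ^+ 2 / (2 * lam) * p ^+ 2.
  have -> : b * H * p = b * (H / mu) * (mu * p) by field; rewrite gt_eqF.
  apply: (le_trans A1); rewrite le_eqVlt; apply/orP; left; apply/eqP.
  by field; rewrite !gt_eqF.
rewrite -subr_ge0 in A1; rewrite -subr_ge0 in A2.
rewrite -subr_ge0 in A5; rewrite -subr_ge0 in A6.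
rewrite -subr_ge0; have := addr_ge0 (addr_ge0 A6 A5) (addr_ge0 A2 A1).
congr (0 <= _); rewrite pE; field; by rewrite !gt_eqF.
Qed.

Lemma yukawa_ge0 mu e (a x : R3 R) : 0 <= yukawa mu e a x.
Proof. by rewrite /yukawa divr_ge0 ?expR_ge0// sqrtr_ge0. Qed.

Lemma yukawa_le mu e (a x : R3 R) : 0 < mu -> 0 < e -> yukawa mu e a x <= e^-1.
Proof.
move=> m0 e0; rewrite /yukawa -[leRHS]mul1r ler_pM ?expR_ge0 ?invr_ge0 ?sqrtr_ge0//.
  by rewrite /ek expR_le1 oppr_le0 mulr_ge0 ?(ltW m0)// sqrtr_ge0.
by rewrite lef_pV2 ?posrE ?hyp_gt0//; exact: kdist_ge.
Qed.

Lemma radial_energyE mu e (a x : R3 R) : 0 < mu -> 0 < e ->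
  radial_energy mu e (norm3 (x - a)) =
  \sum_(i < 3) ((partial i (newton e a) x - partial i (yukawa mu e a) x) / mu) ^+ 2
  + yukawa mu e a x ^+ 2.
Proof.
move=> m0 e0; rewrite /radial_energy sqr_norm3 sqnorm3E; congr (_ + _).
rewrite !mulr_suml; apply: eq_bigr => i _.
rewrite partial_newton// partial_yukawa// -/(kdist e a x).
by field; rewrite !gt_eqF// kdist_gt0.
Qed.

(** It controls the product of the Yukawa gradient with the error in the gradient of the test
    function. The factor 1 / e is harmless since the weight [tau] of this term is chosen after
    [e]. *)
Lemma partial_yukawa_le mu e (a x : R3 R) : 0 < mu -> 0 < e ->
  \sum_(i < 3) partial i (yukawa mu e a) x ^+ 2 <= (mu +
    e^-1) ^+ 2 * yukawa mu e a x ^+ 2.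
Proof.
move=> m0 e0; have k0 := kdist_gt0 a x e0.
set E := ek mu e (norm3 (x - a)).
have -> : \sum_(i < 3) partial i (yukawa mu e a) x ^+ 2 =
    (sqnorm3 (x - a) / kdist e a x ^+ 2) * ((mu +
      (kdist e a x)^-1) ^+ 2 * yukawa mu e a x ^+ 2).
  rewrite sqnorm3E !mulr_suml; apply: eq_bigr => i _.
  rewrite partial_yukawa// /yukawa -/(kdist e a x) -/E; field; by rewrite gt_eqF.
rewrite -[leRHS]mul1r ler_pM//.
- by rewrite divr_ge0 ?sqr_ge0// sqnorm3_ge0.
- by rewrite mulr_ge0 ?sqr_ge0.
- by rewrite ler_pdivrMr ?exprn_gt0// mul1r kdist_sqr lerDl sqr_ge0.
rewrite ler_wpM2r ?sqr_ge0// lerXn2r ?nnegrE ?addr_ge0 ?invr_ge0 ?(ltW m0) ?(ltW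
  e0) ?(ltW k0)//.
by rewrite lerD2l lef_pV2 ?posrE// kdist_ge.
Qed.

Variables (Omega : set (R3 R)) (V : 'I_3 -> R3 R -> R) (L phi : R3 R -> R).
Hypothesis mV : forall i, mfun3 (V i).
Hypothesis IV : forall i, itg (fun x => V i x ^+ 2).
Hypothesis mL : mfun3 L.
Hypothesis IL : itg (fun x => L x ^+ 2).
Hypothesis W : forall eta, test_function Omega eta ->
  \int[mu3 R]_x (\sum_(i < 3) V i x * partial i eta x + L x * eta x) = 0.
Hypothesis tphi : test_function Omega phi.

(* Kato's inequality for [phi]: the equation is tested against
   [yukawa * phi / hyp k phi], and [hyp k phi - k] stands for [`|phi|]. The last
   line vanishes when [phi] tends to the function whose gradient is [V]. *)
Lemma core_inequality (lam mu th tau k e : R) (a : R3 R) : 0 < lam -> 0 < mu ->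
  0 < th -> 0 < tau -> 0 < k -> 0 < e ->
  \int[mu3 R]_x (rho e a x * (hyp k (phi x) - k)) <=
  (lam + tau * (mu + e^-1) ^+ 2) / 2 * (4 * pi / mu)
  + mu ^+ 2 * (1 + th) / (2 * lam) * \int[mu3 R]_x (\sum_(i < 3) V i x ^+ 2)
  + (2 * lam)^-1 * \int[mu3 R]_x (L x ^+ 2)
  + (mu ^+ 2 * (1 + th^-1) / (2 * lam) + (2 * tau)^-1 + e^-1 * k^-1 / 4) *
    \int[mu3 R]_x (\sum_(i < 3) (partial i phi x - V i x) ^+ 2).
Proof.
move=> l0 m0 th0 ta0 k0 e0.
have [Cphi kphi _] := test_functionP tphi.
have dphi i x : derivable phi x (e3 R i) := Cn_derivable (Cphi 1%N).
pose B x := hyp k (phi x) - k.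
pose b x := phi x / hyp k (phi x).
pose b' x := k ^+ 2 / hyp k (phi x) ^+ 3.
pose q := yukawa mu e a.
pose eta x := q x * b x.
have hk x : 0 < hyp k (phi x) := hyp_gt0 (phi x) k0.
have Cb n : Cn n b.
  apply: CnM => //; apply: CnV; last exact: Cn_hyp.
  by move=> x; rewrite gt_eqF.
have CB n : Cn n B by apply: CnD; [exact: Cn_hyp|exact: Cn_cst].
have Cq n : Cn n q by exact: Cn_yukawa.
have Ceta n : Cn n eta by exact: CnM.
have CN n : Cn n (newton e a) by exact: Cn_newton.
have B0 x : phi x = 0 -> B x = 0.
  by rewrite /B => ->; rewrite /hyp expr0n/= add0r sqrtr_sqr gtr0_norm// subrr.
have teta : test_function Omega eta.
  by apply: (test_function_le Ceta tphi) => x; rewrite /eta /b => ->;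
    rewrite mul0r mulr0.
have keta : compact (supp eta).
  by have [] := test_functionP teta.
have kB : compact (supp B) := compact_supp_le B0 kphi.
have pB i x : partial i B x = b x * partial i phi x.
  rewrite /B partialD; [|by move=> y; exact: (Cn_derivable (Cn_hyp k0 (Cphi
    1%N)))|by move=> y; exact: derivable_cst].
  by rewrite partial_hyp// /partial derive_cst addr0.
have peta i x : partial i eta x = partial i q x * b x + q x * b' x * partial i phi x.
  rewrite /eta partialM; [|by move=> y; exact: (Cn_derivable (Cq 1%N))|by move=> y;
    exact: (Cn_derivable (Cb 1%N))].
  have -> : partial i b x = b' x * partial i phi x by rewrite /b partial_div_hyp.
  by rewrite addrC mulrA.
(* The divergence of the Newton gradient times [B] integrates to zero; this moves one derivative
   from the Laplacian of the kernel to [B]. *)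
pose F i x := partial i (newton e a) x * B x.
have CF i n : Cn n (F i) by apply: CnM; [exact: Cn_partial|].
have kF i : compact (supp (F i)).
  by apply: compact_supp_le kB => x; rewrite /F => ->; rewrite mulr0.
have [IF JF] : itg (fun x => \sum_(i < 3) partial i (F i) x) /\ \int[mu3 R]_x
  (\sum_(i < 3) partial i (F i) x) = 0.
  have I i := (int_partial i (CF i 1%N) (kF i)).1.
  split; first exact: itg_sum.
  by rewrite int_sum// big1// => i _; exact: (int_partial i (CF i 1%N) (kF i)).2.
have divE x : \sum_(i < 3) partial i (F i) x =
    - rho e a x * B x + \sum_(i < 3) partial i (newton e a) x * (b x * partial i phi x).
  rewrite /rho -laplacian_newton// /laplacian mulr_suml -big_split/=.
  apply: eq_bigr => i _; rewrite /F partialM.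
  - by rewrite pB addrC.
  - by move=> y; apply: (@Cn_derivable _ 0); exact: (@Cn_partial _ 1 _ i (CN 2%N)).
  - by move=> y; exact: (Cn_derivable (CB 1%N)).
pose T x := \sum_(i < 3) V i x * partial i eta x + L x * eta x.
have JT : \int[mu3 R]_x T x = 0 by exact: W.
have sq_itg (f : R3 R -> R) : continuous f -> compact (supp f) -> itg (fun x =>
  f x ^+ 2).
  move=> cf kf; apply: continuous_itg.
    by move=> x; apply: (cvg_comp _ (fun t : R => t ^+ 2) (cf x));
      exact: exprn_continuous.
  by apply: compact_supp_le kf => x ->; rewrite expr0n.
have IT : itg T.
  apply: itgD.
    apply: itg_sum => i; apply: itgM2 => //.
      by apply: continuous_mfun3; exact: C1_partial_continuous.
    apply: sq_itg; first exact: C1_partial_continuous.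
    exact: compact_supp_partial.
  apply: itgM2 => //; first by apply: continuous_mfun3;
    exact: (Cn_continuous (Ceta 0%N)).
  by apply: sq_itg => //; exact: (Cn_continuous (Ceta 0%N)).
have IrB : itg (fun x => rho e a x * B x).
  apply: continuous_itg.
    move=> x; apply: cvgM; first exact: continuous_rho.
    exact: (Cn_continuous (CB 0%N)).
  by apply: compact_supp_le kB => x ->; rewrite mulr0.
have Iphi i : itg (fun x => (partial i phi x - V i x) ^+ 2).
  apply: itg_sqrD.
  - by apply: continuous_mfun3; exact: C1_partial_continuous.
  - exact: mfun3N.
  - apply: sq_itg; first exact: C1_partial_continuous.
    exact: compact_supp_partial.
  - by under eq_fun do rewrite sqrrN; exact: IV.
have ID := itg_sum Iphi.
have IG := itg_sum IV.
have [IE JE] := itg_radial_energy a m0 e0.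
pose c1 := (lam + tau * (mu + e^-1) ^+ 2) / 2.
pose c2 := mu ^+ 2 * (1 + th) / (2 * lam).
pose c4 := mu ^+ 2 * (1 + th^-1) / (2 * lam) + (2 * tau)^-1 + e^-1 * k^-1 / 4.
(* Both [T] and the divergence of [F] have integral zero. Adding them makes the bound hold
   pointwise: [T] absorbs the last product of [kato_pointwise] at the price of the term in [L]. *)
have key x : rho e a x * B x + \sum_(i < 3) partial i (F i) x - T x <=
   c1 * radial_energy mu e (norm3 (x - a)) + c2 * (\sum_(i < 3) V i x ^+ 2)
   + (2 * lam)^-1 * L x ^+ 2 + c4 * (\sum_(i < 3) (partial i phi x - V i x) ^+ 2).
  rewrite divE (_ : _ - T x = \sum_(i < 3) partial i (newton e a) x * (b x *
    partial i phi x)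
    - \sum_(i < 3) V i x * (partial i q x * b x +
      q x * b' x * partial i phi x) - L x * (q x * b x)); last first.
    rewrite (_ : T x = \sum_(i < 3) V i x * (partial i q x * b x +
      q x * b' x * partial i phi x) + L x * (q x * b x)).
      by ring.
    by rewrite /T; congr (_ + _); apply: eq_bigr => i _; rewrite peta.
  have b1 : `|b x| <= 1.
    rewrite /b normrM normfV (gtr0_norm (hk x)) ler_pdivrMr// mul1r.
    by rewrite -(hyp_norm k (phi x)) ler_hyp.
  have b'0 : 0 <= b' x by rewrite divr_ge0 ?sqr_ge0// exprn_ge0// ltW.
  (* The slope of the smoothed sign is largest where [phi] vanishes; with [yukawa <= e^-1] this
     produces the coefficient [e^-1 * k^-1 / 4]. *)
  have b'k : b' x <= k^-1.
    rewrite /b' ler_pdivrMr ?exprn_gt0// ler_pdivlMl//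
      -exprS lerXn2r ?nnegrE ?(ltW k0) ?(ltW (hk x))//.
    rewrite /hyp -[leLHS](gtr0_norm k0) -sqrtr_sqr ler_sqrt ?lerDr ?sqr_ge0//.
    by rewrite addr_ge0 ?sqr_ge0.
  have q0 : 0 <= q x by exact: yukawa_ge0.
  have qe : q x <= e^-1 by exact: yukawa_le.
  have K : \sum_(i < 3) partial i (newton e a) x * (b x * partial i phi x) <=
    \sum_(i < 3) (lam / 2 * ((partial i (newton e a) x - partial i q x) / mu) ^+ 2
      + tau / 2 * partial i q x ^+ 2 + c2 * V i x ^+ 2
      + (mu ^+ 2 * (1 + th^-1) / (2 * lam) + (2 * tau)^-1 +
        q x * b' x / 4) * (partial i phi x - V i x) ^+ 2
      + V i x * (partial i q x * b x + q x * b' x * partial i phi x)).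
    apply: ler_sum => i _.
    rewrite -[X in X * (b x * _)](subrK (partial i q x)).
    by apply: kato_pointwise => //; rewrite addrC subrK.
  rewrite !big_split/= -!mulr_sumr in K.
  have A := @am_gm lam (q x) (L x) (- b x) l0 _.
  have {}A := A (eq_ind_r (fun t => t <= 1) b1 (normrN _)).
  have RE := radial_energyE a x m0 e0; rewrite -/q in RE.
  have PY := partial_yukawa_le a x m0 e0; rewrite -/q in PY.
  have D0 : 0 <= \sum_(i < 3) (partial i phi x - V i x) ^+ 2.
    by apply: sumr_ge0 => i _; exact: sqr_ge0.
  have qb : q x * b' x / 4 <= e^-1 * k^-1 / 4.
    by rewrite ler_wpM2r ?invr_ge0// ler_pM.
  have H4 := ler_wpM2r D0 qb.
  have HS : 0 <= \sum_(i < 3) ((partial i (newton e a) x - partial i q x) / mu) ^+ 2.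
    by apply: sumr_ge0 => i _; exact: sqr_ge0.
  have H5 : tau / 2 * (\sum_(i < 3) partial i q x ^+ 2) <=
      tau / 2 * ((mu + e^-1) ^+ 2 * radial_energy mu e (norm3 (x - a))).
    rewrite ler_wpM2l ?divr_ge0 ?(ltW ta0)// (le_trans PY)// ler_wpM2l ?sqr_ge0//.
    by rewrite RE lerDr.
  move: K A H4 H5; rewrite /c1 /c4.
  rewrite RE.
  move: (\sum_(i < 3) ((partial i (newton e a) x - partial i q x) / mu) ^+ 2) => S1.
  move: (\sum_(i < 3) partial i (newton e a) x * _) => S2.
  move: (\sum_(i < 3) partial i q x ^+ 2) => S3.
  move: (\sum_(i < 3) V i x ^+ 2) => S4.
  move: (\sum_(i < 3) (partial i phi x - V i x) ^+ 2) => S5.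
  move: (\sum_(i < 3) V i x * _) => S6.
  have -> : (2 * lam)^-1 * L x ^+ 2 = L x ^+ 2 / lam / 2 by field; rewrite gt_eqF.
  move: (e^-1) (k^-1) (L x ^+ 2 / lam) (mu ^+ 2 * (1 +
    th^-1) / (2 * lam)) (2 * tau)^-1 => *; nra.
have : \int[mu3 R]_x (rho e a x * B x + \sum_(i < 3) partial i (F i) x - T x) <=
   \int[mu3 R]_x (c1 * radial_energy mu e (norm3 (x - a)) +
     c2 * (\sum_(i < 3) V i x ^+ 2)
   + (2 * lam)^-1 * L x ^+ 2 + c4 * (\sum_(i < 3) (partial i phi x - V i x) ^+ 2)).
  apply: int_le => //.
    by apply: itgB => //; exact: itgD.
  apply: itgD; last exact: itgZ.
  by apply: itgD; [apply: itgD|]; apply: itgZ.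
rewrite intB//; last exact: itgD.
rewrite intD// JF JT addr0 subr0 => /le_trans; apply.
rewrite intD; [|by apply: itgD; [apply: itgD|]; apply: itgZ|exact: itgZ].
rewrite intD; [|by apply: itgD; apply: itgZ|exact: itgZ].
rewrite intD; [|exact: itgZ|exact: itgZ].
rewrite !intZ// !lerD// ler_wpM2l// /c1 divr_ge0// addr_ge0 ?(ltW l0)//.
by rewrite mulr_ge0 ?(ltW ta0)// sqr_ge0.
Qed.

End kato.

(** * The mollifier [rho] as an approximate identity *)

Section approximate_identity.
Context {R : realType}.
Local Notation M3 :=
  (measurableTypeR R * measurableTypeR R * measurableTypeR R)%type.
Implicit Types (x a : R3 R) (phi : R3 R -> R).

Lemma lipschitz_line phi (v : R3 R) (C : R) : (forall x, derivable phi x v) ->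
  (forall x, `|'D_v phi x| <= C) ->
  forall x t, `|phi (t *: v + x) - phi x| <= C * `|t|.
Proof.
move=> df HC x t.
have pos y s : 0 < s -> `|phi (s *: v + y) - phi y| <= C * s.
  move=> s0; have [c _ ->] := mvt_line y s0 df.
  by rewrite normrM (gtr0_norm s0) ler_wpM2r// ltW.
have [t0|t0|->] := ltgtP t 0.
- rewrite distrC [`|t|]ltr0_norm//.
  have := pos (t *: v + x) (- t); rewrite oppr_gt0 => /(_ t0).
  by rewrite addrA scaleNr addNr add0r.
- by rewrite [`|t|]gtr0_norm// pos.
- by rewrite scale0r add0r subrr !normr0 mulr0.
Qed.

Lemma coord3_norm3 i x : `|coord3 i x| <= norm3 x.
Proof.
rewrite /norm3 -sqrtr_sqr ler_sqrt ?sqnorm3_ge0// sqnorm3E (bigD1 i)//= lerDl.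
by apply: sumr_ge0 => j _; exact: sqr_ge0.
Qed.

Lemma coord3_inj x y : (forall i, coord3 i x = coord3 i y) -> x = y.
Proof.
case: x y => [[x1 x2] x3] [[y1 y2] y3] H.
have := H ord0; have := H (lift ord0 ord0); have := H (lift ord0 (lift ord0 ord0)).
by rewrite /coord3/= => -> -> ->.
Qed.

(** The segment from [a] to [x] is replaced by a path along the three axes, on which only partial
    derivatives occur. *)
Lemma lipschitz3 phi : Cn 1 phi -> compact (supp phi) ->
  exists2 C, 0 < C & forall x a, `|phi x - phi a| <= C * norm3 (x - a).
Proof.
move=> Cphi kphi.
have b i : exists2 C, 0 < C & forall x, `|partial i phi x| <= C.
  apply: compact_supp_bounded; first exact: C1_partial_continuous.
  exact: compact_supp_partial.
have [C0 p0 H0] := b ord0; have [C1 p1 H1] := b (lift ord0 ord0).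
have [C2 p2 H2] := b (lift ord0 (lift ord0 ord0)).
exists (C0 + C1 + C2); first by rewrite !addr_gt0.
move=> x a.
pose d i := coord3 i (x - a).
pose y := d ord0 *: e3 R ord0 + a.
pose z := d (lift ord0 ord0) *: e3 R (lift ord0 ord0) + y.
have xE : x = d (lift ord0 (lift ord0 ord0)) *: e3 R (lift ord0 (lift ord0 ord0)) + z.
  apply: coord3_inj => i; rewrite /z /y !coord3_line !coord3_e3 /d !coord3B.
  by case: i => [[|[|[|//]]] ?]; rewrite /coord3/=; ring.
have df i t := Cn_derivable (i := i) (x := t) Cphi.
have L0 := lipschitz_line (df ord0) H0 a (d ord0).
have L1 := lipschitz_line (df (lift ord0 ord0)) H1 y (d (lift ord0 ord0)).
have L2 := lipschitz_line (df (lift ord0 (lift ord0 ord0))) H2 z (d (lift ord0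
  (lift ord0 ord0))).
rewrite -/y in L0; rewrite -/z in L1; rewrite -xE in L2.
rewrite !mulrDl.
have -> : phi x - phi a = (phi y - phi a) + (phi z - phi y) + (phi x - phi z) by ring.
rewrite (le_trans (ler_normD _ _))// lerD//; last first.
  by rewrite (le_trans L2)// ler_wpM2l ?coord3_norm3// ltW.
rewrite (le_trans (ler_normD _ _))// lerD//.
  by rewrite (le_trans L0)// ler_wpM2l ?coord3_norm3// ltW.
by rewrite (le_trans L1)// ler_wpM2l ?coord3_norm3// ltW.
Qed.

(** Comparison with [rho 1], whose mass is known, replaces the computation of a tail integral, and
    the factor [e ^+ 2] makes the tail small uniformly in the pole. *)
Lemma rho_tail (e d : R) a x : 0 < e -> 0 < d -> d <= norm3 (x - a) ->
  rho e a x <= e ^+ 2 * (1 + d ^- 2) ^+ 5 * rho 1 a x.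
Proof.
move=> e0 d0 dx.
have k0 := kdist_gt0 a x e0; have k1 := kdist_gt0 a x (@ltr01 R).
have r0 : 0 < norm3 (x - a) := lt_le_trans d0 dx.
have H : kdist 1 a x <= (1 + d ^- 2) * kdist e a x.
  rewrite -(@ler_pXn2r R 2) ?nnegrE ?mulr_ge0 ?addr_ge0 ?invr_ge0 ?sqr_ge0 ?(ltW
    k0) ?(ltW k1)//.
  rewrite exprMn !kdist_sqr expr1n.
  have H1 : 1 <= sqnorm3 (x - a) * d ^- 2.
    rewrite ler_pdivlMr ?exprn_gt0// mul1r -sqr_norm3.
    by rewrite lerXn2r ?nnegrE ?(ltW d0) ?(ltW r0).
  have D0 : 0 <= d ^- 2 by rewrite invr_ge0 sqr_ge0.
  have S0 := sqnorm3_ge0 (x - a).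
  rewrite (le_trans (lerD (lexx _) H1))// -[X in X + _]mulr1 -mulrDr.
  apply: (@le_trans _ _ ((1 + d ^- 2) ^+ 2 * sqnorm3 (x - a))).
    rewrite mulrC ler_wpM2r// expr2 ler_peMr ?addr_ge0// lerDl//.
  by rewrite ler_wpM2l ?sqr_ge0// lerDl sqr_ge0.
rewrite /rho expr1n mulr1 ler_pdivrMr ?exprn_gt0//.
have H5 : kdist 1 a x ^+ 5 <= (1 + d ^- 2) ^+ 5 * kdist e a x ^+ 5.
  by rewrite -exprMn lerXn2r ?nnegrE ?mulr_ge0 ?addr_ge0 ?invr_ge0 ?sqr_ge0 ?(ltW
    k0) ?(ltW k1).
rewrite (_ : e ^+ 2 * (1 + d ^- 2) ^+ 5 * (3 / kdist 1 a x ^+ 5) * kdist e a x ^+ 5 =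
  3 * e ^+ 2 * ((1 + d ^- 2) ^+ 5 * kdist e a x ^+ 5 / kdist 1 a x ^+ 5)).
  have H6 : 1 <= (1 + d ^- 2) ^+ 5 * kdist e a x ^+ 5 / kdist 1 a x ^+ 5.
    by rewrite ler_pdivlMr ?exprn_gt0// mul1r.
  by rewrite -[leLHS]mulr1; apply: ler_wpM2l => //; rewrite mulr_ge0// sqr_ge0.
by field; rewrite !gt_eqF.
Qed.

Lemma itg_rhoM (e : R) a phi : 0 < e -> continuous phi -> compact (supp phi) ->
  itg (fun x => rho e a x * phi x).
Proof.
move=> e0 cphi kphi; apply: continuous_itg.
  by move=> x; apply: cvgM; [exact: continuous_rho|exact: cphi].
by apply: compact_supp_le kphi => x ->; rewrite mulr0.
Qed.

Lemma compact_supp_normr phi : compact (supp phi) -> compact (supp (fun x => `|phi x|)).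
Proof. by apply: compact_supp_le => x ->; rewrite normr0. Qed.

Lemma continuous_normr phi : continuous phi -> continuous (fun x => `|phi x|).
Proof.
move=> cphi x; apply: continuous_comp; first exact: cphi.
exact: norm_continuous.
Qed.

Lemma rho_approx phi (eta : R) : Cn 1 phi -> compact (supp phi) -> 0 < eta ->
  exists2 e, 0 < e & forall a,
    4 * pi * `|phi a| <= \int[mu3 R]_x (rho e a x * `|phi x|) + 4 * pi * eta.
Proof.
move=> Cphi kphi eta0.
have cphi := Cn_continuous Cphi.
have [C C0 HC] := lipschitz3 Cphi kphi.
have [S S0 HS] := compact_supp_bounded cphi kphi.
(* Within distance [d] of the pole [phi] varies by at most [eta / 2]; beyond it, [e] is chosen so
   that the tail also contributes [eta / 2]. *)
pose d := eta / 2 / C.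
have d0 : 0 < d by rewrite !divr_gt0.
pose c := (1 + d ^- 2) ^+ 5.
have c0 : 0 < c by rewrite exprn_gt0// ltr_pwDl ?invr_ge0 ?sqr_ge0.
pose e := Num.sqrt (eta / 2 / (2 * S * c)).
have E0 : 0 < eta / 2 / (2 * S * c).
  apply: divr_gt0; [exact: divr_gt0|].
  by apply: mulr_gt0; last exact: c0; apply: mulr_gt0; [exact: ltr0Sn|exact: S0].
have e0 : 0 < e by rewrite sqrtr_gt0.
have e2 : 2 * S * (e ^+ 2 * c) = eta / 2.
  rewrite sqr_sqrtr; last exact: ltW.
  by field; rewrite !gt_eqF.
exists e => // a.
have [Ir Jr] := int_rho a e0; have [Ir1 Jr1] := int_rho a (@ltr01 R).
have Irp := itg_rhoM a e0 (continuous_normr cphi) (compact_supp_normr kphi).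
have key x : `|phi a| * rho e a x <=
    rho e a x * `|phi x| + eta / 2 * rho e a x + eta / 2 * rho 1 a x.
  have T : `|phi a| <= `|phi x| + `|phi x - phi a|.
    by have := ler_normB (phi x) (phi x - phi a); rewrite subKr.
  have r0 := rho_ge0 e a x; have r1 := rho_ge0 1 a x.
  have [dx|dx] := leP d (norm3 (x - a)).
    have B : `|phi x - phi a| <= 2 * S.
      by rewrite (le_trans (ler_normB _ _))// mulr_natl mulr2n lerD.
    have tl := rho_tail e0 d0 dx; rewrite -/c in tl.
    have H1 : `|phi a| * rho e a x <= (`|phi x| + 2 * S) * rho e a x.
      by rewrite ler_wpM2r// (le_trans T)// lerD2l.
    have H2 : 2 * S * rho e a x <= 2 * S * (e ^+ 2 * c * rho 1 a x).
      by rewrite ler_wpM2l// mulr_ge0// ltW.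
    rewrite [leRHS]mulrA e2 in H2.
    rewrite (le_trans H1)// mulrDl [X in X + _ <= _]mulrC -addrA lerD2l.
    by rewrite (le_trans H2)// lerDr mulr_ge0// divr_ge0// ltW.
  have B : `|phi x - phi a| <= eta / 2.
    by rewrite (le_trans (HC _ _))// mulrC -ler_pdivlMr// ltW.
  have H1 : `|phi a| * rho e a x <= (`|phi x| + eta / 2) * rho e a x.
    by rewrite ler_wpM2r// (le_trans T)// lerD2l.
  rewrite (le_trans H1)// mulrDl [X in X + _ <= _]mulrC lerDl.
  by rewrite mulr_ge0// divr_ge0// ltW.
have : \int[mu3 R]_x (`|phi a| * rho e a x) <=
   \int[mu3 R]_x (rho e a x * `|phi x| + eta / 2 * rho e a x + eta / 2 * rho 1 a x).
  by apply: int_le => //; [exact: itgZ|apply: itgD; [apply: itgD => //|]; exact: itgZ].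
rewrite intD; [|by apply: itgD => //; exact: itgZ|exact: itgZ].
rewrite intD; [|by []|exact: itgZ].
rewrite (intZ `|phi a| Ir) (intZ (eta / 2) Ir) (intZ (eta / 2) Ir1) Jr Jr1 => H;
  rewrite mulrC (le_trans H)// -addrA lerD2l.
by rewrite le_eqVlt; apply/orP; left; apply/eqP; field.
Qed.

(** [rho] is symmetric in its two points, so integrating over the pole first gives the mass 4 pi.
    Hence a function with small integral has small local means at most poles. *)
Lemma tonelli_rho (e : R) (h : R3 R -> R) : 0 < e -> mfun3 h -> (forall x, 0 <= h x) ->
  measurable_fun (setT : set M3) (fun a => \int[mu3 R]_x (rho e a x * h x)%:E)%E /\
  (\int[mu3 R]_a \int[mu3 R]_x (rho e a x * h x)%:E =
    (4 * pi)%:E * \int[mu3 R]_x (h x)%:E)%E.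
Proof.
move=> e0 mh h0.
pose F (ax : M3 * M3) : \bar R := (rho e ax.1 ax.2 * h ax.2)%:E.
have mF : measurable_fun setT F.
  apply/measurable_EFinP; apply: measurable_funM; last first.
    exact: (measurableT_comp mh measurable_snd).
  rewrite (_ : (fun ax => _) = (fun x : M3 => rho e 0 x) \o (fun ax : M3 * M3 =>
    ax.2 - ax.1 : M3)).
    apply: measurableT_comp; first by apply: continuous_mfun3; exact: continuous_rho.
    have m1 : measurable_fun setT (fun ax : M3 * M3 => ax.1) by exact: measurable_fst.
    have m2 : measurable_fun setT (fun ax : M3 * M3 => ax.2) by exact: measurable_snd.
    have c1 : measurable_fun setT (fst \o fst : M3 -> measurableTypeR R).
      exact: (measurableT_comp measurable_fst measurable_fst).
    have c2 : measurable_fun setT (snd \o fst : M3 -> measurableTypeR R).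
      exact: (measurableT_comp measurable_snd measurable_fst).
    have c3 : measurable_fun setT (snd : M3 ->
      measurableTypeR R) by exact: measurable_snd.
    apply: (@measurable_fun_pair _ _ _ _ (measurableTypeR R * measurableTypeR
      R)%type (measurableTypeR R)
       (fun ax : M3 * M3 => (ax.2.1.1 - ax.1.1.1, ax.2.1.2 - ax.1.1.2)) (fun ax =>
         ax.2.2 - ax.1.2)).
      apply: (@measurable_fun_pair _ _ _ _ (measurableTypeR R) (measurableTypeR R)
       (fun ax : M3 * M3 => ax.2.1.1 - ax.1.1.1) (fun ax => ax.2.1.2 - ax.1.1.2)).
        by apply: measurable_funB; [exact: (measurableT_comp c1 m2)|exact:
          (measurableT_comp c1 m1)].
      by apply: measurable_funB; [exact: (measurableT_comp c2 m2)|exact: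
        (measurableT_comp c2 m1)].
    by apply: measurable_funB; [exact: (measurableT_comp c3 m2)|exact:
      (measurableT_comp c3 m1)].
  by apply/funext => ax; rewrite /= /rho /kdist subr0.
have F0 ax : (0 <= F ax)%E by rewrite lee_fin mulr_ge0// rho_ge0.
split; first exact: (@measurable_fun_fubini_tonelli_F _ _ _ _ R (@la3 R) F mF F0).
have E := @fubini_tonelli _ _ _ _ R (@la3 R) (@la3 R) F mF F0.
rewrite (E : (\int[mu3 R]_a \int[mu3 R]_x (rho e a x * h x)%:E)%E = _).
transitivity (\int[mu3 R]_x ((4 * pi)%:E * (h x)%:E))%E.
  apply: eq_integral => x _; rewrite /F /=.
  have [Ir Jr] := int_rho x e0.
  transitivity (\int[mu3 R]_a ((h x)%:E * (rho e x a)%:E))%E.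
    by apply: eq_integral => a _; rewrite -EFinM mulrC rho_sym.
  rewrite ge0_integralZl; last 4 first.
  - exact: measurableT.
  - by apply/measurable_EFinP; exact: itg_mfun.
  - by move=> a _; rewrite lee_fin rho_ge0.
  - by rewrite lee_fin.
  by rewrite int_EFin// Jr muleC.
apply: ge0_integralZl.
- exact: measurableT.
- exact/measurable_EFinP.
- by move=> x _; rewrite lee_fin.
- by rewrite lee_fin mulr_ge0// pi_ge0.
Qed.

End approximate_identity.

(** * From means of the approximations to level sets of the limit *)

Section supremum_bound.
Context {R : realType}.
Local Notation M3 :=
  (measurableTypeR R * measurableTypeR R * measurableTypeR R)%type.

(** Splitting at the threshold [t], in the manner of Chebyshev, turns L^6 closeness into linear
    bounds and takes the place of Hölder's inequality. *)
Lemma le_pow6 (t g : R) : 0 < t -> 0 <= g -> g <= t + g ^+ 6 / t ^+ 5.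
Proof.
move=> t0 g0; have [gt|tg] := leP g t.
  by rewrite (le_trans gt)// lerDl divr_ge0 ?exprn_ge0// ltW.
apply: (@le_trans _ _ (g ^+ 6 / t ^+ 5)); last by rewrite lerDr ltW.
rewrite ler_pdivlMr ?exprn_gt0// (exprS g 5) ler_wpM2l//.
by rewrite lerXn2r ?nnegrE// ltW.
Qed.

Lemma pow6D (a b : R) : (a + b) ^+ 6 <= 32 * (a ^+ 6 + b ^+ 6).
Proof.
have H1 : (a + b) ^+ 2 <= 2 * (a ^+ 2 + b ^+ 2).
  rewrite -subr_ge0 (_ : _ - _ = (a - b) ^+ 2); first exact: sqr_ge0.
  by ring.
have H2 (p q : R) : 0 <= p -> 0 <= q -> (p + q) ^+ 3 <= 4 * (p ^+ 3 + q ^+ 3).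
  move=> p0 q0; rewrite -subr_ge0 (_ : _ - _ = 3 * (p + q) * (p - q) ^+ 2).
    by rewrite mulr_ge0 ?sqr_ge0// mulr_ge0// addr_ge0.
  by ring.
rewrite -[6%N]/(2 * 3)%N !exprM.
apply: (@le_trans _ _ ((2 * (a ^+ 2 + b ^+ 2)) ^+ 3)).
  by rewrite lerXn2r ?nnegrE ?sqr_ge0// mulr_ge0// addr_ge0 ?sqr_ge0.
rewrite exprMn (le_trans (ler_wpM2l _ (H2 _ _ (sqr_ge0 a) (sqr_ge0 b))))// ?exprn_ge0//.
by rewrite mulrA; apply: ler_wpM2r; [rewrite addr_ge0// exprn_ge0// sqr_ge0|lra].
Qed.

Lemma compact_supp2 (f g h : R3 R -> R) : (forall x, f x = 0 -> g x = 0 -> h x = 0) ->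
  compact (supp f) -> compact (supp g) -> compact (supp h).
Proof.
move=> H kf kg; apply: (subclosed_compact _ (compactU kf kg)).
  exact: closed_closure.
have cl : closed (supp f `|` supp g) by apply: closedU; exact: closed_closure.
rewrite [X in _ `<=` X](closure_id _).1//; apply: closure_subset => x /= hx.
have [fx|fx] := eqVneq (f x) 0; last by left; exact: supp_sub.
by right; apply: supp_sub; apply: contra_neq hx; exact: H.
Qed.

Variables (Omega : set (R3 R)) (U : R3 R -> R) (V : 'I_3 -> R3 R -> R) (L : R3 R -> R).
Variable phi : nat -> R3 R -> R.
Hypothesis mU : mfun3 U.
Hypothesis mV : forall i, mfun3 (V i).
Hypothesis IV : forall i, itg (fun x => V i x ^+ 2).
Hypothesis mL : mfun3 L.
Hypothesis IL : itg (fun x => L x ^+ 2).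
Hypothesis W : forall eta, test_function Omega eta ->
  \int[mu3 R]_x (\sum_(i < 3) V i x * partial i eta x + L x * eta x) = 0.
Hypothesis tphi : forall n, test_function Omega (phi n).
Hypothesis phi6 : forall ep, 0 < ep -> exists N, forall n, (N <= n)%N ->
  itg (fun x => (phi n x - U x) ^+ 6) /\ \int[mu3 R]_x (phi n x - U x) ^+ 6 <= ep.
Hypothesis phi2 : forall ep, 0 < ep -> exists N, forall n, (N <= n)%N ->
  \int[mu3 R]_x (\sum_(i < 3) (partial i (phi n) x - V i x) ^+ 2) <= ep.

Let A2 := \int[mu3 R]_x (\sum_(i < 3) V i x ^+ 2).
Let B2 := \int[mu3 R]_x (L x ^+ 2).
Let M lam mu := lam / (2 * mu) + (mu ^+ 2 * A2 + B2) / (8 * pi * lam).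

Lemma rho_bound lam mu e eta : 0 < lam -> 0 < mu -> 0 < e -> 0 < eta ->
  exists N, forall n, (N <= n)%N -> forall a,
    \int[mu3 R]_x (rho e a x * `|phi n x|) <= 4 * pi * (M lam mu + eta).
Proof.
move=> l0 m0 e0 eta0.
have p0 : 0 < pi :> R := pi_gt0 R.
have A20 : 0 <= A2.
  by apply: int_ge0 => x; apply: sumr_ge0 => i _; exact: sqr_ge0.
(* The slack [4 * pi * eta] is split into four equal parts: [k], [tau] and [th] use one each. [N]
   uses the fourth and comes last because [K] depends on the other three. *)
pose k := eta / 4.
have k0 : 0 < k by rewrite divr_gt0.
pose tau := pi * eta / (2 * pi * (mu + e^-1) ^+ 2 / mu).
have c0 : 0 < mu + e^-1 by rewrite addr_gt0// invr_gt0.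
have t0 : 0 < tau.
  apply: divr_gt0; first exact: mulr_gt0.
  by apply: divr_gt0 => //; apply: mulr_gt0; [exact: mulr_gt0|exact: exprn_gt0].
(* The [+ 1] keeps the denominator positive when the gradient norm is zero. *)
pose th := pi * eta / (mu ^+ 2 * A2 / (2 * lam) + 1).
have d0 : 0 < mu ^+ 2 * A2 / (2 * lam) + 1.
  by rewrite ltr_wpDl// divr_ge0 ?mulr_ge0 ?sqr_ge0// ltW.
have th0 : 0 < th by rewrite divr_gt0// mulr_gt0.
pose K := mu ^+ 2 * (1 + th^-1) / (2 * lam) + (2 * tau)^-1 + e^-1 * k^-1 / 4.
have K0 : 0 < K.
  have i0 (y : R) : 0 < y -> 0 < y^-1 by rewrite invr_gt0.
  apply: addr_gt0; first apply: addr_gt0.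
  - apply: divr_gt0; last exact: mulr_gt0.
    by apply: mulr_gt0; [exact: exprn_gt0|apply: addr_gt0 => //; exact: i0].
  - by apply: i0; exact: mulr_gt0.
  - by apply: divr_gt0 => //; apply: mulr_gt0; exact: i0.
have [N HN] := phi2 (divr_gt0 (mulr_gt0 p0 eta0) K0).
exists N => n /HN Hn a.
have := core_inequality mV IV mL IL W (tphi n) a l0 m0 th0 t0 k0 e0.
rewrite -/K -/A2 -/B2 => core.
have [Cphi kphi _] := test_functionP (tphi n).
have cphi := Cn_continuous (Cphi 0%N).
have [Ir Jr] := int_rho a e0.
have Ih : itg (fun x => rho e a x * (hyp k (phi n x) - k)).
  apply: itg_rhoM => //.
    apply: (@Cn_continuous _ 0); apply: CnD; [exact: Cn_hyp|exact: Cn_cst].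
  by apply: compact_supp_le kphi => x ->; rewrite /hyp expr0n/= add0r sqrtr_sqr
    gtr0_norm// subrr.
have H1 : \int[mu3 R]_x (rho e a x * `|phi n x|) <=
    \int[mu3 R]_x (rho e a x * (hyp k (phi n x) - k)) + k * (4 * pi).
  rewrite -Jr -(intZ k Ir) -intD//; last exact: itgZ.
  apply: int_le; [|by apply: itgD => //; exact: itgZ|].
    by apply: itg_rhoM => //; [exact: continuous_normr|exact: compact_supp_normr].
  move=> x; rewrite mulrBr [k * _]mulrC subrK ler_wpM2l ?rho_ge0//.
  by rewrite -hyp_norm ler_hyp.
have {Hn} H2 : K * \int[mu3 R]_x (\sum_(i < 3) (partial i (phi n) x - V i x) ^+ 2)
  <= pi * eta.
  by rewrite mulrC -ler_pdivlMr.
have H3 : th * (mu ^+ 2 * A2 / (2 * lam)) <= pi * eta.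
  rewrite /th mulrAC ler_pdivrMr// ler_wpM2l ?mulr_ge0 ?(ltW p0) ?(ltW eta0)//.
  by rewrite lerDl.
have E4 : tau * (mu + e^-1) ^+ 2 / 2 * (4 * pi / mu) = pi * eta.
  have gen (p c : R) : 0 < p -> 0 < c ->
      p * eta / (2 * p * c ^+ 2 / mu) * c ^+ 2 / 2 * (4 * p / mu) = p * eta.
    by move=> *; field; rewrite !gt_eqF.
  exact: gen.
have E5 : k * (4 * pi) = pi * eta by rewrite /k; field.
have E6 : 4 * pi * (M lam mu + eta) = lam / 2 * (4 * pi / mu) + mu ^+ 2 * A2 / (2 * lam)
    + (2 * lam)^-1 * B2 + 4 * (pi * eta).
  have gen (p u v : R) : 0 < p -> 4 * p * (lam / (2 * mu) + (mu ^+ 2 * u +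
    v) / (8 * p * lam) + eta) =
      lam / 2 * (4 * p / mu) + mu ^+ 2 * u / (2 * lam) + (2 * lam)^-1 * v +
        4 * (p * eta).
    by move=> *; field; rewrite !gt_eqF.
  exact: gen.
rewrite E6; apply: (le_trans H1); rewrite E5.
have E7 : (lam + tau * (mu + e^-1) ^+ 2) / 2 * (4 * pi / mu) + mu ^+ 2 * (1 +
  th) / (2 * lam) * A2 =
  lam / 2 * (4 * pi / mu) + tau * (mu + e^-1) ^+ 2 / 2 * (4 * pi / mu) +
    mu ^+ 2 * A2 / (2 * lam) + th * (mu ^+ 2 * A2 / (2 * lam)).
  have gen (p u c : R) : 0 < p ->
      (lam + tau * c ^+ 2) / 2 * (4 * p / mu) + mu ^+ 2 * (1 + th) / (2 * lam) * u =
      lam / 2 * (4 * p / mu) + tau * c ^+ 2 / 2 * (4 * p / mu) +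
        mu ^+ 2 * u / (2 * lam) + th * (mu ^+ 2 * u / (2 * lam)).
    by move=> *; field; rewrite !gt_eqF.
  exact: gen.
rewrite E7 E4 in core.
have gen (x l v b h w z : R) : x <= l + z + v + h + b + w -> w <= z -> h <= z ->
    x + z <= l + v + b + 4 * z.
  by move=> *; lra.
exact: gen core H2 H3.
Qed.

(** Of the margin [5 * eta], one part each goes to recovering [phi N] from its means, to the bound
    on the means of [phi m], to the comparison of the two means, and to the distance from [phi N] to
    [U]. The fifth is left on the level set and is exceeded only where sixth-power errors are large,
    which Chebyshev's argument makes rare. *)
Lemma level_set_null lam mu eta : 0 < lam -> 0 < mu -> 0 < eta ->
  mu3 R [set x | M lam mu + 5 * eta < `|U x|] = 0%E.
Proof.
move=> l0 m0 eta0.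
have p0 : 0 < pi :> R := pi_gt0 R.
set A := [set x | _].
have mA : measurable (A : set M3).
  have mn : measurable_fun (setT : set M3) (fun x => `|U x|) by apply: measurableT_comp.
  have := mn measurableT `]M lam mu + 5 * eta, +oo[%classic (measurable_itv _).
  rewrite setTI (_ : _ @^-1` _ = A)//.
  by apply/seteqP; split => x /=; rewrite in_itv/= andbT.
have e5 : 0 < eta ^+ 5 by rewrite exprn_gt0.
(* The constant is 65 = 64 + 1: [pow6D] gives 32 (ep + ep) for the distance between [phi N] and
   [phi m], and the distance from [phi N] to [U] adds one more [ep]. *)
have main ep : 0 < ep -> (eta%:E * mu3 R A <= (65 * ep / eta ^+ 5)%:E)%E.
  move=> ep0; have [N HN] := phi6 ep0.
  have [I6 J6] := HN N (leqnn N).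
  have [Cn' kn _] := test_functionP (tphi N).
  have [e e0 He] := rho_approx (Cn' 1%N) kn eta0.
  have [N' HN'] := rho_bound l0 m0 e0 eta0.
  pose m := maxn N N'.
  have [I6m J6m] := HN m (leq_maxl _ _).
  have Hm := HN' m (leq_maxr _ _).
  have [Cm km _] := test_functionP (tphi m).
  pose h x := (phi N x - phi m x) ^+ 6.
  have Ch : Cn 0 (fun x => phi N x - phi m x).
    rewrite (_ : (fun x => _) = fun x => phi N x + -1 * phi m x).
      by apply: CnD => //; apply: CnM => //; exact: Cn_cst.
    by apply/funext => x; rewrite mulN1r.
  have ch : continuous h.
    move=> x; apply: (@continuous_comp _ _ _ (fun x => phi N x - phi m x) (fun t =>
      t ^+ 6)).
      exact: (Cn_continuous Ch).
    exact: exprn_continuous.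
  have kh : compact (supp h).
    by apply: (compact_supp2 _ kn km) => x; rewrite /h => -> ->; rewrite subrr expr0n.
  have h0 x : 0 <= h x by rewrite /h exprn_even_ge0.
  have Ih : itg h by exact: continuous_itg.
  have mh : mfun3 h := itg_mfun Ih.
  have [mJ TJ] := tonelli_rho e0 mh h0.
  have key a : A a -> eta <= (4 * pi * eta ^+ 5)^-1 * \int[mu3 R]_x (rho e a x * h x)
      + (eta ^+ 5)^-1 * (phi N a - U a) ^+ 6.
    rewrite /A /= => Ua.
    have [Ir Jr] := int_rho a e0.
    have cN := Cn_continuous (Cn' 0%N); have cm := Cn_continuous (Cm 0%N).
    have IN := itg_rhoM a e0 (continuous_normr cN) (compact_supp_normr kn).
    have Im := itg_rhoM a e0 (continuous_normr cm) (compact_supp_normr km).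
    have Irh := itg_rhoM a e0 ch kh.
    have B1 : \int[mu3 R]_x (rho e a x * `|phi N x|) <=
        \int[mu3 R]_x (rho e a x * `|phi m x|) + eta * (4 * pi)
        + (eta ^+ 5)^-1 * \int[mu3 R]_x (rho e a x * h x).
      rewrite -Jr -(intZ eta Ir) -(intZ _ Irh) -!intD//; try exact: itgZ; last first.
        by apply: itgD => //; exact: itgZ.
      apply: int_le => //; first by apply: itgD; [apply: itgD => //|]; exact: itgZ.
      move=> x; have r0 := rho_ge0 e a x.
      have T : `|phi N x| <= `|phi m x| + (eta + h x / eta ^+ 5).
        have T1 : `|phi N x| <= `|phi m x| + `|phi N x - phi m x|.
          by have := ler_normD (phi m x) (phi N x - phi m x); rewrite addrC subrK.
        have := le_pow6 eta0 (normr_ge0 (phi N x - phi m x)).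
        rewrite -normrX [X in _ <= _ + X / _]ger0_norm ?exprn_even_ge0// -/(h x) => T2.
        by rewrite (le_trans T1)// lerD2l.
      have := ler_wpM2l r0 T; rewrite !mulrDr => /le_trans; apply.
      by rewrite le_eqVlt; apply/orP; left; apply/eqP; ring.
    have B2' := Hm a.
    have B3 := He a.
    have B4 := le_pow6 eta0 (normr_ge0 (phi N a - U a)).
    rewrite -normrX [X in _ <= _ + X / _]ger0_norm ?exprn_even_ge0// in B4.
    have B5 : `|U a| <= `|phi N a| + `|phi N a - U a|.
      by have := ler_normB (phi N a) (phi N a - U a); rewrite subKr.
    have B6 : 4 * pi * `|phi N a| <= 4 * pi * (M lam mu + 3 * eta)
        + (eta ^+ 5)^-1 * \int[mu3 R]_x (rho e a x * h x).
      move: B1 B2' B3; move: (M _ _) (\int[mu3 R]_x (rho e a x * `|phi N x|))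
       (\int[mu3 R]_x (rho e a x * `|phi m x|)) (_ * \int[mu3 R]_x (rho e a x * h
         x)) (4 * pi) => *; nra.
    have B7 : `|phi N a| <= (M lam mu + 3 * eta)
        + (4 * pi * eta ^+ 5)^-1 * \int[mu3 R]_x (rho e a x * h x).
      have gen (p q u v w : R) : 0 < p -> p * u <= p * v + q^-1 * w ->
        u <= v + (p * q)^-1 * w.
        move=> p1 H; rewrite -(@ler_pM2l _ p)// (le_trans H)// mulrDr lerD2l.
        by rewrite mulrA invfM mulrA divff ?mul1r// gt_eqF.
      by apply: gen B6; apply: mulr_gt0.
    move: Ua B4 B5 B7; rewrite [_ / eta ^+ 5]mulrC.
    move: (M _ _) (_ * \int[mu3 R]_x (rho e a x * h x)) (_ * (phi N a - U a) ^+ 6)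
      => *; lra.
  have m6 : mfun3 (fun x => (phi N x - U x) ^+ 6) := itg_mfun I6.
  have p6 x : 0 <= (phi N x - U x) ^+ 6 by rewrite exprn_even_ge0.
  have J0 a : (0 <= \int[mu3 R]_x (rho e a x * h x)%:E)%E.
    by apply: integral_ge0 => x _; rewrite lee_fin mulr_ge0 ?rho_ge0.
  have i50 : 0 <= (4 * pi * eta ^+ 5)^-1 by rewrite invr_ge0 mulr_ge0 ?mulr_ge0
    ?(ltW p0)// ltW.
  have i5 : 0 <= (eta ^+ 5)^-1 by rewrite invr_ge0 ltW.
  pose G a : \bar R := ((4 * pi * eta ^+ 5)^-1%:E * (\int[mu3 R]_x (rho e a x * h x)%:E)
     + (eta ^+ 5)^-1%:E * ((phi N a - U a) ^+ 6)%:E)%E.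
  have mG1 : measurable_fun (setT : set M3) (fun a =>
    (4 * pi * eta ^+ 5)^-1%:E * (\int[mu3 R]_x (rho e a x * h x)%:E))%E.
    exact: measurable_funeM.
  have mG2 : measurable_fun (setT : set M3) (fun a =>
    (eta ^+ 5)^-1%:E * ((phi N a - U a) ^+ 6)%:E)%E.
    by apply: measurable_funeM; exact/measurable_EFinP.
  have mG : measurable_fun (setT : set M3) G by exact: emeasurable_funD.
  have G0 a : (0 <= G a)%E.
    by apply: adde_ge0; apply: mule_ge0; rewrite ?lee_fin.
  have E1 : (eta%:E * mu3 R A = \int[mu3 R]_(x in A) eta%:E)%E.
    by rewrite integral_cst.
  rewrite E1; apply: (@le_trans _ _ (\int[mu3 R]_(x in A) G x)%E).
    apply: ge0_le_integral => //.
    - by move=> x _; rewrite lee_fin ltW.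
    - exact: measurable_funTS.
    - move=> a Aa; have := key a Aa; rewrite -lee_fin EFinD !EFinM => /le_trans; apply.
      rewrite /G int_EFin//; exact: itg_rhoM.
  apply: (@le_trans _ _ (\int[mu3 R]_x G x)%E).
    by apply: ge0_subset_integral.
  rewrite /G ge0_integralD//; last 2 first.
  - by move=> a _; apply: mule_ge0; rewrite ?lee_fin.
  - by move=> a _; rewrite mule_ge0 ?lee_fin.
  have E2 := @ge0_integralZl _ _ _ (mu3 R) _ measurableT _ mJ (4 * pi * eta ^+
    5)^-1%:E (fun x _ => J0 x) i50.
  have E3 := @ge0_integralZl _ _ _ (mu3 R) _ measurableT _ ((measurable_EFinP _
    _).2 m6) (eta ^+ 5)^-1%:E (fun x _ => p6 x) i5.
  rewrite E2 E3 TJ.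
  rewrite !int_EFin// -!EFinM -EFinD lee_fin.
  have Jh : \int[mu3 R]_x h x <= 64 * ep.
    apply: (@le_trans _ _ (\int[mu3 R]_x (32 * ((phi N x - U x) ^+ 6 +
      (phi m x - U x) ^+ 6)))).
      apply: int_le => //; first by apply: itgZ; exact: itgD.
      move=> x; rewrite /h (_ : phi N x - phi m x = (phi N x - U x) +
        (U x - phi m x)); last by ring.
      rewrite (_ : (phi m x - U x) ^+ 6 = (U x - phi m x) ^+ 6); last by ring.
      exact: pow6D.
    rewrite (intZ 32 (itgD I6 I6m)) (intD I6 I6m); move: J6 J6m.
    by move: (\int[mu3 R]_x (phi N x - U x) ^+ 6) (\int[mu3 R]_x (phi m x - U x) ^+
      6) => *; lra.
  rewrite (_ : _ + _ = (\int[mu3 R]_x h x + \int[mu3 R]_x (phi N x - U x) ^+ 6) /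
    eta ^+ 5); last first.
    have gen (p u v w : R) : 0 < p -> 0 < w ->
        (4 * p * w)^-1 * (4 * p * u) + w^-1 * v = (u + v) / w.
      by move=> *; field; rewrite !gt_eqF.
    exact: gen.
  rewrite ler_pM2r ?invr_gt0//.
  have gen (u v w : R) : u <= 64 * w -> v <= w -> u + v <= 65 * w by move=> *; lra.
  exact: gen Jh J6.
have : (eta%:E * mu3 R A <= 0)%E.
  apply/lee_addgt0Pr => d d0; rewrite add0e.
  have := main (d * eta ^+ 5 / 65); rewrite divr_gt0 ?mulr_gt0// => /(_ isT).
  by rewrite (_ : 65 * _ / _ = d)//; field; rewrite gt_eqF.
rewrite pmule_rle0 ?lte_fin// => H; apply/eqP; rewrite eq_le H.
exact: measure_ge0.
Qed.

End supremum_bound.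

(** * Norms as integrals, and optimisation of the parameters *)

Section norms.
Context {R : realType}.
Implicit Types (Omega : set (R3 R)) (f : R3 R -> R).

(** Only the exponents 2 and 6 occur; their parity lets plain powers replace real powers of absolute
    values. *)
Lemma Lnorm_exprn k f : (0 < k)%N -> ~~ odd k ->
  ('N[mu3 R]_(k%:R%:E)[EFin \o f] `^ k%:R = \int[mu3 R]_x (f x ^+ k)%:E)%E.
Proof.
move=> k0 ek; rewrite poweR_Lnorm ?pnatr_eq0 -?lt0n//.
apply: eq_integral => x _ /=.
by rewrite powR_mulrn// -normrX ger0_norm// exprn_even_ge0.
Qed.

Lemma Lnorm_sqrt f : itg (fun x => f x ^+ 2) ->
  ('N[mu3 R]_(2%:E)[EFin \o f] = (Num.sqrt (\int[mu3 R]_x (f x ^+ 2)))%:E)%E.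
Proof.
move=> If.
have := @Lnorm_exprn 2 f isT isT; rewrite int_EFin// => H.
have N0 := @Lnorm_ge0 _ _ _ (mu3 R) 2%:E (EFin \o f).
set N := 'N[mu3 R]_(2%:E)[EFin \o f]%E in H N0 *.
have -> : N = ((N `^ 2) `^ (2^-1))%E by rewrite -poweRrM divff// poweRe1.
by rewrite H poweR_EFin powR12_sqrt//; apply: int_ge0 => x; exact: sqr_ge0.
Qed.

Lemma in_LP k Omega f : (0 < k)%N -> ~~ odd k ->
  in_L Omega (k%:R%:E) f <->
  mfun3 (f \_ Omega) /\ itg (fun x => (f \_ Omega) x ^+ k).
Proof.
move=> k0 ek; have kR : 0 < k%:R :> R by rewrite ltr0n.
have E := @Lnorm_exprn k (f \_ Omega) k0 ek.
rewrite /in_L inE; split.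
  move=> /andP[]; rewrite !inE/= => mf; rewrite /finite_norm => fin; split=> //.
  apply: (@itg_ge0 _ _ (fine (\int[mu3 R]_x ((f \_ Omega) x ^+ k)%:E)%E)).
  - exact: mfun3X.
  - by move=> x; rewrite exprn_even_ge0.
  - rewrite fineK// ge0_fin_numE; last by apply: integral_ge0 => x _;
    rewrite lee_fin exprn_even_ge0.
    by rewrite -E poweR_lty.
move=> [mf If]; apply/andP; rewrite !inE/=; split => //.
rewrite /finite_norm; apply: (@lty_poweRy _ _ k%:R); first by rewrite gt_eqF.
by rewrite E int_EFin// ltry.
Qed.

Lemma normL_cvg0 k Omega (f : nat -> R3 R -> R) : (0 < k)%N -> ~~ odd k ->
  (forall n, mfun3 (f n \_ Omega)) ->
  normL Omega (k%:R%:E) (f n) @[n --> \oo] --> 0%E ->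
  forall ep, 0 < ep -> exists N, forall n, (N <= n)%N ->
    itg (fun x => (f n \_ Omega) x ^+ k) /\
    \int[mu3 R]_x (f n \_ Omega) x ^+ k <= ep.
Proof.
move=> k0 ek mf f0 ep ep0; have kR : 0 < k%:R :> R by rewrite ltr0n.
pose d := ep `^ (k%:R^-1).
have d0 : 0 < d by rewrite powR_gt0.
have : \forall n \near \oo, (normL Omega (k%:R%:E) (f n) < d%:E)%E.
  apply: (f0 [set y : \bar R | (y < d%:E)%E]); apply: open_nbhs_nbhs; split;
    first exact: open_ereal_lt_ereal.
  by rewrite /= lte_fin.
move=> [N _ HN]; exists N => n /HN /= Hn.
have g0 x : 0 <= (f n \_ Omega) x ^+ k by rewrite exprn_even_ge0.
have le : (\int[mu3 R]_x ((f n \_ Omega) x ^+ k)%:E <= ep%:E)%E.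
  rewrite -Lnorm_exprn//.
  have -> : ep%:E = (d%:E `^ k%:R)%E.
    by rewrite poweR_EFin -powRrM mulVf ?gt_eqF// powRr1// ltW.
  apply: gt0_ler_poweR; rewrite ?ler0n// ?in_itv/= ?leey ?andbT ?Lnorm_ge0//
    ?lee_fin ?(ltW d0)//.
  exact: ltW.
have I : itg (fun x => (f n \_ Omega) x ^+ k).
  by apply: itg_ge0 le => //; exact: mfun3X.
by split => //; rewrite -lee_fin -int_EFin.
Qed.

Lemma itg_pow6M u f : mfun3 u -> itg (fun x => u x ^+ 6) ->
  continuous f -> compact (supp f) -> itg (fun x => u x * f x).
Proof.
move=> mu Iu cf kf.
have [C C0 HC] := compact_supp_bounded cf kf.
have In : itg (fun x => `|f x|).
  by apply: continuous_itg; [exact: continuous_normr|exact: compact_supp_normr].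
apply: (@itg_le _ _ (fun x => `|f x| + C * u x ^+ 6)).
- by apply: mfun3M => //; exact: continuous_mfun3.
- move=> x; rewrite normrM.
  have H : `|u x| <= 1 + u x ^+ 6.
    have := le_pow6 ltr01 (normr_ge0 (u x)).
    by rewrite expr1n divr1 -normrX [X in _ + X]ger0_norm// exprn_even_ge0.
  apply: (le_trans (ler_wpM2r (normr_ge0 _) H)).
  by rewrite mulrDl mul1r lerD2l mulrC ler_wpM2r ?exprn_even_ge0.
- by apply: itgD => //; exact: itgZ.
Qed.

Lemma Rintegral_patch Omega u f : open Omega ->
  \int[mu3 R]_(x in Omega) (u x * f x) = \int[mu3 R]_x ((u \_ Omega) x * f x).
Proof.
move=> oO; rewrite Rintegral_mkcond; apply: eq_Rintegral => x _.
by rewrite !patchE; case: ifPn => //; rewrite mul0r.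
Qed.

(** The optimal parameters are quotients of [A] and [B], either of which may be zero; they are
    therefore computed for [A + d] and [B + d], and [d] then tends to 0. *)
Lemma infimum_bound (X : \bar R) (A B : R) : 0 <= A -> 0 <= B ->
  (forall lam mu, 0 < lam -> 0 < mu ->
    (X <= (lam / (2 * mu) + (mu ^+ 2 * A ^+ 2 + B ^+ 2) / (8 * pi * lam))%:E)%E) ->
  (X <= (Num.sqrt (A * B / (2 * pi)))%:E)%E.
Proof.
move=> A0 B0 H; have p0 := pi_gt0 R.
have K d : 0 < d -> (X <= (Num.sqrt ((A + d) * (B + d) / (2 * pi)))%:E)%E.
  move=> d0; pose a := A + d; pose b := B + d.
  have a0 : 0 < a by rewrite ltr_wpDl.
  have b0 : 0 < b by rewrite ltr_wpDl.
  pose s := Num.sqrt (a * b / (2 * pi)).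
  have s0 : 0 < s by rewrite sqrtr_gt0 divr_gt0// mulr_gt0.
  (* The value mu = b / a equates mu^2 a^2 with b^2, and lam = s b / a then balances the two
     summands at s / 2 each. *)
  have l0 : 0 < s * b / a by rewrite divr_gt0// mulr_gt0.
  have m0 : 0 < b / a by rewrite divr_gt0.
  apply: (le_trans (H _ _ l0 m0)); rewrite lee_fin -/a -/b -/s.
  have ss : s ^+ 2 = a * b / (2 * pi) by rewrite sqr_sqrtr// ltW// divr_gt0// mulr_gt0.
  have Aa : A ^+ 2 <= a ^+ 2 by rewrite lerXn2r ?nnegrE ?(ltW a0)// lerDl ltW.
  have Bb : B ^+ 2 <= b ^+ 2 by rewrite lerXn2r ?nnegrE ?(ltW b0)// lerDl ltW.
  have D : 0 < 8 * pi * (s * b / a) by apply: mulr_gt0 => //; apply: mulr_gt0.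
  apply: (@le_trans _ _ (s / 2 + (2 * b ^+ 2) / (8 * pi * (s * b / a)))).
    have -> : s * b / a / (2 * (b / a)) = s / 2 by field; rewrite !gt_eqF.
    rewrite lerD2l ler_pM2r ?invr_gt0//.
    have Ba : (b / a) ^+ 2 * A ^+ 2 <= b ^+ 2.
      apply: (le_trans (ler_wpM2l (sqr_ge0 _) Aa)).
      by rewrite -exprMn divfK// gt_eqF.
    by have := lerD Ba Bb; rewrite -mulr2n mulr_natl.
  rewrite -(@ler_pM2r _ s)// mulrDl -expr2.
  have -> : 2 * b ^+ 2 / (8 * pi * (s * b / a)) * s = a * b / (2 * pi) / 2.
    by move: pi p0 => p p0; field; rewrite !gt_eqF.
  have -> : s / 2 * s = s ^+ 2 / 2 by ring.
  by rewrite ss; lra.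
apply/lee_addgt0Pr => t t0.
(* The bound [d <= 1] makes d (A + B + d) at most d (A + B + 1), and the second entry brings this
   below t^2. *)
pose d := Num.min 1 (t ^+ 2 / (A + B + 1)).
have c0 : 0 < A + B + 1 by rewrite ltr_wpDl// addr_ge0.
have d0 : 0 < d by rewrite lt_min ltr01 divr_gt0// exprn_gt0.
apply: (le_trans (K d d0)); rewrite -EFinD lee_fin.
have d1 : d <= 1 by rewrite ge_min lexx.
have dt : d * (A + B + 1) <= t ^+ 2 by rewrite -ler_pdivlMr// ge_min lexx orbT.
have AB : 0 <= A * B / (2 * pi) by rewrite divr_ge0 ?mulr_ge0// ltW.
have h0 : 0 <= Num.sqrt (A * B / (2 * pi)) + t by rewrite addr_ge0 ?sqrtr_ge0// ltW.
rewrite -(@ler_sqr _ _ (_ + t)) ?nnegrE ?sqrtr_ge0// sqr_sqrtr; last first.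
  apply: divr_ge0; first by apply: mulr_ge0; apply: addr_ge0 => //; exact: ltW.
  by rewrite mulr_ge0// ltW.
rewrite sqrrD sqr_sqrtr//.
have q0 : 0 <= Num.sqrt (A * B / (2 * pi)) * t by rewrite mulr_ge0 ?sqrtr_ge0// ltW.
apply: (@le_trans _ _ (A * B / (2 * pi) + t ^+ 2));
  last by rewrite -addrA lerD2l lerDr mulrn_wge0.
have -> : (A + d) * (B + d) / (2 * pi) = A * B / (2 * pi) + d * (A + B + d) / (2 * pi).
  by move: pi p0 => p p0; field; rewrite gt_eqF.
rewrite lerD2l (le_trans _ dt)// ler_pdivrMr ?mulr_gt0//.
apply: (@le_trans _ _ (d * (A + B + 1))); first by rewrite ler_pM2l// lerD2l.
rewrite ler_peMr ?mulr_ge0 ?(ltW d0) ?(ltW c0)//.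
have := pi_ge2 R; lra.
Qed.

Lemma sqrt_constant (A B : R) : 0 <= A -> 0 <= B ->
  ((Num.sqrt (A * B / (2 * pi)))%:E =
   ((Num.sqrt (2 * pi))^-1)%:E * A%:E `^ (2^-1) * B%:E `^ (2^-1))%E.
Proof.
move=> A0 B0; rewrite !poweR_EFin !powR12_sqrt// -!EFinM; congr (_%:E).
by rewrite sqrtrM ?mulr_ge0// sqrtrM// sqrtrV ?mulr_ge0 ?pi_ge0// mulrC mulrA.
Qed.

End norms.

(** * The supremum bound on an arbitrary open set *)

Section inequality.
Context {R : realType}.
Local Notation M3 :=
  (measurableTypeR R * measurableTypeR R * measurableTypeR R)%type.

Lemma test_function_partial Omega (phi : R3 R -> R) i :
  test_function Omega phi -> test_function Omega (partial i phi).
Proof.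
move=> tp; have [C k s] := test_functionP tp.
split; [|exact: compact_supp_partial|exact: subset_trans (@supp_partial _ _ _) s].
by apply/smoothP => n; exact: (@Cn_partial _ n phi i (C n.+1)).
Qed.

Lemma test_function_notin Omega (phi : R3 R -> R) x :
  test_function Omega phi -> x \notin Omega -> phi x = 0.
Proof.
move=> tp xO; have [_ _ s] := test_functionP tp.
apply/eqP; apply: contraNT xO => px; rewrite inE; apply: s; exact: supp_sub.
Qed.

Lemma euclid_patch_sqr Omega (F : 'I_3 -> R3 R -> R) x :
  (euclid F \_ Omega) x ^+ 2 = \sum_(i < 3) (F i \_ Omega) x ^+ 2.
Proof.
rewrite patchE /euclid; case: ifPn => xO.
  rewrite sqr_sqrtr; last by apply: sumr_ge0 => i _; exact: sqr_ge0.
  by apply: eq_bigr => i _; rewrite patchE xO.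
rewrite expr0n big1// => i _; by rewrite patchE (negbTE xO) expr0n.
Qed.

Lemma mfun3_euclid_patch Omega (F : 'I_3 -> R3 R -> R) :
  (forall i, mfun3 (F i \_ Omega)) -> mfun3 (euclid F \_ Omega).
Proof.
move=> mF.
have -> : euclid F \_ Omega = fun x => Num.sqrt (\sum_(i < 3) (F i \_ Omega) x ^+ 2).
  apply/funext => x; rewrite -euclid_patch_sqr sqrtr_sqr ger0_norm// patchE.
  by case: ifP => // _; exact: sqrtr_ge0.
have mS : mfun3 (fun x => \sum_(i < 3) (F i \_ Omega) x ^+ 2).
  under eq_fun do rewrite sum3E.
  by apply: mfun3D; [apply: mfun3D|]; exact: mfun3X.
by apply: measurableT_comp mS; apply: continuous_measurable_fun; exact: sqrt_continuous.
Qed.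

Variables (Omega : set (R3 R)) (u : R3 R -> R) (Du : 'I_3 -> R3 R -> R).
Variable Lu : R3 R -> R.
Hypothesis oO : open Omega.
Hypothesis Hu : hatH01 Omega u Du.
Hypothesis HL : distr_laplacian Omega u Lu.
Hypothesis LL : in_L Omega 2%:E Lu.

Let U := u \_ Omega.
Let V i := Du i \_ Omega.
Let L := Lu \_ Omega.

(** The weak gradient is tested against the partial derivatives of [eta], themselves test functions;
    this turns the pairing of [u] with the Laplacian of [eta] into one of first derivatives. *)
Lemma weak_laplacian eta : test_function Omega eta ->
  \int[mu3 R]_x (\sum_(i < 3) V i x * partial i eta x + L x * eta x) = 0.
Proof.
move=> te; have [u6 Du2 wg _] := Hu.
have [mU IU] := (in_LP Omega u (isT : (0 < 6)%N) isT).1 u6.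
have mIV i := (in_LP Omega (Du i) (isT : (0 < 2)%N) isT).1 (Du2 i).
have [mL IL] := (in_LP Omega Lu (isT : (0 < 2)%N) isT).1 LL.
have tp i := test_function_partial i te.
have tpp i := test_function_partial i (tp i).
have ct f : test_function Omega f -> continuous f /\ compact (supp f).
  by move=> /test_functionP[C k _]; split => //; exact: (Cn_continuous (C 0%N)).
have sqI f : test_function Omega f -> mfun3 f /\ itg (fun x => f x ^+ 2).
  move=> /ct[cf kf]; split; first exact: continuous_mfun3.
  apply: continuous_itg; last by apply: compact_supp_le kf => x ->; rewrite expr0n.
  by move=> x; apply: (cvg_comp _ (fun t : R => t ^+ 2) (cf x));
    exact: exprn_continuous.
have E1 i : \int[mu3 R]_x (V i x * partial i eta x) =
  - \int[mu3 R]_x (U x * partial i (partial i eta) x).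
  have P1 := Rintegral_patch u (partial i (partial i eta)) oO.
  have P2 := Rintegral_patch (Du i) (partial i eta) oO.
  have P3 := canRL (@opprK _) (esym (wg _ i (tp i))).
  exact: (etrans (esym P2) (etrans P3 (congr1 -%R P1))).
have IVi i : itg (fun x => V i x * partial i eta x).
  have [m1 I1] := sqI _ (tp i); have [mV IV] := mIV i.
  exact: itgM2.
have IUi i : itg (fun x => U x * partial i (partial i eta) x).
  by have [c k] := ct _ (tpp i); exact: itg_pow6M.
have E2 : \int[mu3 R]_x (U x * laplacian eta x) = \int[mu3 R]_x (L x * eta x).
  have P1 := Rintegral_patch u (laplacian eta) oO.
  have P2 := Rintegral_patch Lu eta oO.
  exact: (etrans (esym P1) (etrans (HL te) P2)).
have ILe : itg (fun x => L x * eta x) by have [m1 I1] := sqI _ te; exact: itgM2.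
rewrite (intD (itg_sum IVi) ILe) (int_sum IVi).
rewrite -E2 (eq_bigr _ (fun i _ => E1 i)) sumrN -(int_sum IUi).
apply/eqP; rewrite addrC subr_eq0; apply/eqP; apply: eq_Rintegral => x _.
by rewrite /laplacian mulr_sumr.
Qed.

Lemma sup_norm_le :
  (normL Omega +oo u <=
     ((Num.sqrt (2 * pi))^-1)%:E * normL Omega 2%:E (euclid Du) `^ (2^-1)
       * normL Omega 2%:E Lu `^ (2^-1))%E.
Proof.
have [u6 Du2 _ [phi [tphi c6 c2]]] := Hu.
have [mU IU] := (in_LP Omega u (isT : (0 < 6)%N) isT).1 u6.
have mIV i := (in_LP Omega (Du i) (isT : (0 < 2)%N) isT).1 (Du2 i).
have [mL IL] := (in_LP Omega Lu (isT : (0 < 2)%N) isT).1 LL.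
have mV i := (mIV i).1.
have IV i := (mIV i).2.
have cphi n : continuous (phi n).
  by have [C _ _] := test_functionP (tphi n); exact: (Cn_continuous (C 0%N)).
have cpphi i n : continuous (partial i (phi n)).
  have [C _ _] := test_functionP (test_function_partial i (tphi n)).
  exact: (Cn_continuous (C 0%N)).
have D6 n : (fun x => phi n x - u x) \_ Omega = fun x => phi n x - U x.
  apply/funext => x; rewrite /U !patchE; case: ifPn => // xO.
  by rewrite (test_function_notin (tphi n) xO) subrr.
have D2 n i : (fun x => grad (phi n) i x - Du i x) \_ Omega =
    fun x => partial i (phi n) x - V i x.
  apply/funext => x; rewrite /V !patchE; case: ifPn => // xO.
  by rewrite (test_function_notin (test_function_partial i (tphi n)) xO) subrr.
have mB f g : mfun3 f -> mfun3 g -> mfun3 (fun x : R3 R => f x - g x : R).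
  by move=> mf mg; exact: measurable_funB.
have phi6 ep : 0 < ep -> exists N, forall n, (N <= n)%N ->
    itg (fun x => (phi n x - U x) ^+ 6) /\ \int[mu3 R]_x (phi n x - U x) ^+ 6 <= ep.
  move=> ep0.
  have [|N HN] := @normL_cvg0 R 6 Omega _ isT isT _ c6 ep ep0.
    by move=> n; rewrite D6; apply: mB => //; exact: continuous_mfun3.
  by exists N => n /HN; rewrite D6.
have phi2 ep : 0 < ep -> exists N, forall n, (N <= n)%N ->
    \int[mu3 R]_x (\sum_(i < 3) (partial i (phi n) x - V i x) ^+ 2) <= ep.
  move=> ep0.
  have [|N HN] := @normL_cvg0 R 2 Omega _ isT isT _ c2 ep ep0.
    move=> n; apply: mfun3_euclid_patch => i; rewrite D2.
    by apply: mB; [exact: continuous_mfun3|exact: mV].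
  exists N => n /HN[_]; under eq_Rintegral do rewrite euclid_patch_sqr.
  by under eq_Rintegral do under eq_bigr do rewrite D2.
pose A := Num.sqrt (\int[mu3 R]_x (\sum_(i < 3) V i x ^+ 2)).
pose B := Num.sqrt (\int[mu3 R]_x (L x ^+ 2)).
have A2 : \int[mu3 R]_x (\sum_(i < 3) V i x ^+ 2) = A ^+ 2.
  by rewrite sqr_sqrtr//; apply: int_ge0 => x; apply: sumr_ge0 => i _; exact: sqr_ge0.
have B2 : \int[mu3 R]_x (L x ^+ 2) = B ^+ 2.
  by rewrite sqr_sqrtr//; apply: int_ge0 => x; exact: sqr_ge0.
have A0 : 0 <= A by exact: sqrtr_ge0.
have B0 : 0 <= B by exact: sqrtr_ge0.
have NA : normL Omega 2%:E (euclid Du) = A%:E.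
  have E : (fun x => (euclid Du \_ Omega) x ^+ 2) = fun x => \sum_(i < 3) V i x ^+ 2.
    by apply/funext => x; exact: euclid_patch_sqr.
  by rewrite /normL Lnorm_sqrt E//; exact: itg_sum.
have NB : normL Omega 2%:E Lu = B%:E by rewrite /normL Lnorm_sqrt.
rewrite NA NB -(sqrt_constant A0 B0); apply: infimum_bound => // lam mu l0 m0.
set M := _ + _.
have M0 : 0 <= M.
  have p0 := pi_ge0 R.
  apply: addr_ge0; first by rewrite divr_ge0 ?mulr_ge0// ltW.
  apply: divr_ge0; last by apply: mulr_ge0; [exact: mulr_ge0|exact: ltW].
  by apply: addr_ge0; [apply: mulr_ge0|]; exact: sqr_ge0.
(* The norm of exponent +oo takes the default value 0 on a null space, whence the second case. *)
rewrite /normL unlock; case: ifPn => [_|_]; last by rewrite lee_fin.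
apply/lee_addgt0Pr => t t0; rewrite -EFinD; apply/ess_supP.
have t5 : 0 < t / 5 by rewrite divr_gt0.
have := level_set_null mU mV IV mL IL weak_laplacian tphi phi6 phi2 l0 m0 t5.
rewrite A2 B2 -/M => null.
exists [set x | M + 5 * (t / 5) < `|U x|]; split => //.
  have mn : measurable_fun (setT : set M3) (fun x => `|U x|) by apply: measurableT_comp.
  have := mn measurableT `]M + 5 * (t / 5), +oo[%classic (measurable_itv _).
  rewrite setTI (_ : _ @^-1` _ = [set x | M + 5 * (t / 5) < `|U x|])//.
  by apply/seteqP; split => x /=; rewrite in_itv/= andbT.
move=> x /= /negP; rewrite lee_fin -ltNge => H.
by rewrite mulrC divfK.
Qed.

End inequality.

(** * A smooth one-sided truncation *)

Section flat.
Context {R : realType}.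

(** A family closed under derivation that contains every derivative of [ramp]; it yields smoothness
    of all orders by a single induction. *)
Definition flat (P : {poly R}) (t : R) : R :=
  if 0 < t then P.[t^-1] * expR (- t^-1) else 0.

(** A smooth substitute for the positive part, with explicit derivatives (1 + 1/t) exp(-1/t) and
    t^-3 exp(-1/t): the slope stays in [0, 1], so truncation does not increase the gradient. *)
Definition ramp (t : R) : R := if 0 < t then t * expR (- t^-1) else 0.

Lemma exprn_le_expR (n : nat) (y : R) : 0 <= y -> y ^+ n <= n%:R ^+ n * expR y.
Proof.
move=> y0; case: n => [|n]; first by rewrite !expr0 mul1r -expR0 ler_expR.
have n0 : 0 < n.+1%:R :> R by rewrite ltr0n.
have -> : expR y = expR (y / n.+1%:R) ^+ n.+1.
  by rewrite -expRM_natl mulrC divfK// gt_eqF.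
rewrite -exprMn.
rewrite lerXn2r ?nnegrE// ?mulr_ge0 ?expR_ge0 ?(ltW n0)//.
have : y / n.+1%:R <= expR (y / n.+1%:R).
  by rewrite (le_trans _ (expR_ge1Dx _))// lerDr.
by rewrite ler_pdivrMr// mulrC.
Qed.

(** A quadratic bound is what makes the derivative at 0 exist and vanish. For the monomial of degree
    i the exponential is estimated at order i + 2, so that t^2 is left. *)
Lemma flat_le (P : {poly R}) : exists2 K, 0 <= K & forall t, `|flat P t| <= K * t ^+ 2.
Proof.
exists (\sum_(i < size P) `|P`_i| * (i.+2%:R ^+ i.+2)).
  by apply: sumr_ge0 => i _; rewrite mulr_ge0// exprn_ge0.
move=> t; rewrite /flat; case: ifPn => t0; last first.
  by rewrite normr0 mulr_ge0 ?sqr_ge0// sumr_ge0// => i _; rewrite mulr_ge0// exprn_ge0.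
rewrite horner_coef normrM (gtr0_norm (expR_gt0 _)) expRN ler_pdivrMr ?expR_gt0//.
rewrite (le_trans (ler_norm_sum _ _ _))// !mulr_suml; apply: ler_sum => i _.
have y0 : 0 <= t^-1 by rewrite invr_ge0 ltW.
rewrite normrM -(mulrA _ (t ^+ 2)) -(mulrA `|P`_i|) ler_wpM2l//.
rewrite ger0_norm ?exprn_ge0//.
have := exprn_le_expR i.+2 y0; rewrite -[in t^-1 ^+ _]addn2 exprD.
move: (t^-1 ^+ i) (_ ^+ i.+2) (expR _) => a N E H.
have t2 : 0 < t ^+ 2 by rewrite exprn_gt0.
rewrite -(ler_pM2r t2) in H; move: H; rewrite -mulrA -exprMn mulVf ?gt_eqF//
  expr1n mulr1.
by move=> /le_trans; apply; rewrite -mulrA [E * _]mulrC.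
Qed.

Lemma is_derive_at0 (G : R -> R) K : 0 <= K -> (forall t, `|G t| <= K * t ^+ 2) ->
  is_derive (0 : R) 1 G 0.
Proof.
move=> K0 HG.
have G0 : G 0 = 0.
  by apply/eqP; rewrite -normr_le0 (le_trans (HG 0))// expr0n mulr0.
have C : h^-1 *: ((G \o shift 0) (h *: (1 : R)) - G 0) @[h --> 0^'] --> (0 : R).
  apply/cvgr0Pnorm_le => ep ep0.
  have k1 : 0 < K + 1 by rewrite ltr_wpDl.
  near=> h.
  rewrite /= G0 subr0 addr0 /GRing.scale/= mulr1 normrM normfV.
  have h0 : h != 0 by near: h; exact: nbhs_dnbhs_neq.
  rewrite ler_pdivrMl ?normr_gt0// (le_trans (HG h))//.
  rewrite -real_normK ?num_real// expr2 mulrCA ler_wpM2l//.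
  have : `|h| <= ep / (K + 1).
    near: h; apply: dnbhs0_le; exact: divr_gt0.
  rewrite ler_pdivlMr// mulrDr mulr1 => H; rewrite (le_trans _ H)// mulrC lerDl//.
by apply: DeriveDef; [apply/cvg_ex; exists 0|apply: cvg_lim].
Unshelve. all: by end_near. Qed.

Lemma is_derive_gt0 (G F : R -> R) (t d : R) : 0 < t ->
  (forall s, 0 < s -> G s = F s) -> is_derive t 1 F d -> is_derive t 1 G d.
Proof.
move=> t0 GF dF; apply: (near_eq_is_derive (f := F)) => //.
near=> s; rewrite GF//; near: s; exact: lt_nbhsr.
Unshelve. all: by end_near. Qed.

Lemma is_derive_lt0 (G : R -> R) (t : R) : t < 0 ->
  (forall s, s < 0 -> G s = 0) -> is_derive t 1 G 0.
Proof.
move=> t0 G0; apply: (near_eq_is_derive (f := cst 0)) => //.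
  near=> s; rewrite G0//; near: s; exact: lt_nbhsl.
Unshelve. all: by end_near. Qed.

Lemma is_derive_expNV (t : R) : 0 < t ->
  is_derive t 1 (fun s : R => expR (- s^-1)) (t ^- 2 * expR (- t^-1)).
Proof.
move=> t0; have t1 : t != 0 by rewrite gt_eqF.
have D1 : is_derive t 1 (fun s : R => - s^-1) (- (- (t^-1 * t^-1))).
  by apply: is_deriveN; exact: is_derive_inv.
have D : is_derive t 1 (expR \o (fun s : R =>
  - s^-1)) (expR (- t^-1) * (- (- (t^-1 * t^-1)))).
  exact: (@is_derive1_comp _ expR _ t _ _ (is_derive_expR _) D1).
apply: (is_derive_eq D); rewrite opprK; by field.
Qed.

Lemma is_derive_flat (P : {poly R}) (t : R) :
  is_derive t 1 (flat P) (flat ('X^2 * (P - P^`())) t).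
Proof.
have [t0|t0|t0] := ltgtP t 0.
- rewrite {2}/flat ltNge (ltW t0)/=; apply: is_derive_lt0 => // s s0.
  by rewrite /flat ltNge (ltW s0).
- rewrite {2}/flat t0.
  apply: (is_derive_gt0 t0 (F := fun s => P.[s^-1] * expR (- s^-1))).
    by move=> s s0; rewrite /flat s0.
  have t1 : t != 0 by rewrite gt_eqF.
  have D1 : is_derive t 1 (horner P \o GRing.inv) (P^`().[t^-1] * (- (t^-1 * t^-1))).
    exact: (@is_derive1_comp _ (horner P) GRing.inv t _ _ (is_derive_poly _ _)
      (is_derive_inv t1)).
  have D := is_deriveM D1 (is_derive_expNV t0).
  have E : ('X^2 * (P - P^`())).[t^-1] = t ^- 2 * (P.[t^-1] - P^`().[t^-1]).
    by rewrite hornerM hornerXn hornerD hornerN exprVn.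
  by apply: (is_derive_eq D); rewrite /GRing.scale/= E; field.
- have [K K0 HK] := flat_le P.
  rewrite t0 {2}/flat ltxx; exact: is_derive_at0 HK.
Qed.

Lemma is_derive_ramp (t : R) : is_derive t 1 ramp (flat (1 + 'X) t).
Proof.
have [t0|t0|t0] := ltgtP t 0.
- rewrite /flat ltNge (ltW t0)/=; apply: is_derive_lt0 => // s s0.
  by rewrite /ramp ltNge (ltW s0).
- rewrite /flat t0.
  apply: (is_derive_gt0 t0 (F := fun s => s * expR (- s^-1))).
    by move=> s s0; rewrite /ramp s0.
  have t1 : t != 0 by rewrite gt_eqF.
  have D := is_deriveM (is_derive_id t 1) (is_derive_expNV t0).
  have E : (1 + 'X).[t^-1] = 1 + t^-1 by rewrite !hornerE.
  by apply: (is_derive_eq D); rewrite /GRing.scale/= E; field.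
- rewrite t0 {1}/flat ltxx; apply: (@is_derive_at0 _ 1) => // s.
  rewrite mul1r /ramp; case: ifPn => [s0|_]; last by rewrite normr0 sqr_ge0.
  rewrite ger0_norm ?mulr_ge0 ?expR_ge0 ?(ltW s0)// expr2 ler_pM2l//.
  by rewrite expRN invf_ple ?posrE ?expR_gt0// (le_trans _ (expR_ge1Dx _))//
    lerDr ler01.
Qed.

Lemma ramp_derive_itv t : 0 <= flat (1 + 'X) t <= 1.
Proof.
rewrite /flat; case: ifPn => t0; last by rewrite lexx ler01.
have y0 : 0 < t^-1 by rewrite invr_gt0.
rewrite !hornerE mulr_ge0 ?expR_ge0 ?addr_ge0 ?(ltW y0)//=.
by rewrite expRN ler_pdivrMr ?expR_gt0// mul1r expR_ge1Dx.
Qed.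

Lemma is_derive_ramp_derive (t : R) : is_derive t 1 (flat (1 + 'X)) (flat ('X^3) t).
Proof.
have := is_derive_flat (1 + 'X) t.
have -> : (1 + 'X : {poly R})^`() = 1 by rewrite derivD derivX -polyC1 derivC add0r.
by rewrite [1 + _]addrC addrK -exprSr.
Qed.

(* With [y = t^-1] and [v = t + 1/3] one has [v y = 1 + y/3 <= exp (y/3)]. *)
Lemma ramp_derive2_le t : 0 <= flat 'X^3 t /\ (0 < t ->
  flat 'X^3 t * (t + 3^-1) ^+ 3 <= 1).
Proof.
rewrite /flat; case: ifPn => t0; last by split.
have y0 : 0 < t^-1 by rewrite invr_gt0.
rewrite hornerXn; split; first by rewrite mulr_ge0 ?expR_ge0// exprn_ge0// ltW.
move=> _; rewrite mulrAC -exprMn mulrDr mulVf ?gt_eqF//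
  expRN ler_pdivrMr ?expR_gt0// mul1r.
have -> : expR t^-1 = expR (t^-1 / 3) ^+ 3 by rewrite -expRM_natl mulrC divfK.
rewrite lerXn2r ?nnegrE ?expR_ge0//.
  by rewrite addr_ge0// mulr_ge0// ltW.
exact: expR_ge1Dx.
Qed.

Lemma ramp_ge t : t - 1 <= ramp t.
Proof.
rewrite /ramp; case: ifPn => t0; last by rewrite subr_le0 (le_trans _ ler01)// leNgt.
apply: (@le_trans _ _ (t * (1 - t^-1))).
  by rewrite mulrBr mulr1 divff// gt_eqF.
by rewrite ler_pM2l// expR_ge1Dx.
Qed.

Lemma Cn_ramp n (f : R3 R -> R) : Cn n f -> Cn n (fun x => ramp (f x)).
Proof.
apply: (Cn_comp (C := fun G => G = ramp \/ exists P, G = flat P)); last by left.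
move=> G [->|[P ->]].
  by exists (flat (1 + 'X)); [right; exists (1 + 'X)|exact: is_derive_ramp].
exists (flat ('X^2 * (P - P^`()))); last exact: is_derive_flat.
by right; exists ('X^2 * (P - P^`())).
Qed.

End flat.

(** * Test functions as elements of the energy space *)

Section test_function_norms.
Context {R : realType}.

Lemma mu3_open_gt0 (A : set (R3 R)) : open A -> A !=set0 -> (0 < mu3 R A)%E.
Proof.
move=> oA [x Ax].
have [r /= r0 Hr] := (nbhs_ballP _ _).1 (open_nbhs_nbhs (conj oA Ax)).
pose I (c : R) : set (measurableTypeR R) := `[c - r / 2, c + r / 2]%classic.
have r2 : 0 < r / 2 by rewrite divr_gt0.
have mi c : measurable (I c) by rewrite /I.
have L c : (0 < @lebesgue_measure R (I c))%E.
  rewrite lebesgue_measure_itv/= lte_fin; case: ifPn => [_|].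
    by rewrite -EFinD lte_fin subr_gt0 ltrBlDr -addrA ltrDl addr_gt0.
  by rewrite ltrBlDr -addrA ltrDl addr_gt0.
have E2 := @product_measure1E _ _ _ _ R (@lebesgue_measure R) (@lebesgue_measure R)
  (I x.1.1) (I x.1.2) (mi _) (mi _).
have E1 := @product_measure1E _ _ _ _ R (@la2 R) (@lebesgue_measure R)
  (I x.1.1 `*` I x.1.2) (I x.2) (measurableX (mi _) (mi _)) (mi _).
have L3 : (0 < mu3 R (I x.1.1 `*` I x.1.2 `*` I x.2))%E.
  have -> : mu3 R (I x.1.1 `*` I x.1.2 `*` I x.2) = _ := E1.
  apply: mule_gt0; last exact: L.
  have L2 : (0 < (@lebesgue_measure R \x @lebesgue_measure R) (I x.1.1 `*` I x.1.2))%E.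
    by rewrite E2; apply: mule_gt0; exact: L.
  exact: L2.
apply: (lt_le_trans L3); apply: le_measure; rewrite ?inE.
- by apply: measurableX => //; exact: measurableX.
- exact: open_measurable3.
move=> y [[y1 y2] y3]; apply: Hr.
have H (c d : R) : I c d -> ball c r d.
  rewrite /I/= in_itv/= => /andP[H1 H2]; rewrite /ball/= ltr_norml.
  have r0' : 0 < r := r0; lra.
by split; [split|]; exact: H.
Qed.

Lemma patch_test_function Omega (f : R3 R -> R) : test_function Omega f ->
  f \_ Omega = f.
Proof.
move=> tf; apply/funext => x; rewrite patchE; case: ifPn => // xO.
by rewrite (test_function_notin tf xO).
Qed.

Lemma test_function_continuous Omega (f : R3 R -> R) : test_function Omega f ->
  continuous f.
Proof. by move=> /test_functionP[C _ _]; exact: (Cn_continuous (C 0%N)). Qed.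

Lemma test_function_itgX Omega (f : R3 R -> R) k : test_function Omega f ->
  (0 < k)%N -> itg (fun x => f x ^+ k).
Proof.
move=> tf k0; have [_ kf _] := test_functionP tf; apply: continuous_itg.
  move=> x; apply: (@continuous_comp _ _ _ f (fun t => t ^+ k)).
    exact: (test_function_continuous tf).
  exact: exprn_continuous.
by apply: compact_supp_le kf => x ->; rewrite expr0n gtn_eqF.
Qed.

Lemma laplacian_Cn n (f : R3 R -> R) : Cn n.+2 f -> Cn n (laplacian f).
Proof.
move=> Cf; have C i : Cn n (partial i (partial i f)).
  by apply: Cn_partial; exact: Cn_partial.
have -> : laplacian f = fun x => partial ord0 (partial ord0 f) x +
    partial (lift ord0 ord0) (partial (lift ord0 ord0) f) x +
    partial (lift ord0 (lift ord0 ord0)) (partial (lift ord0 (lift ord0 ord0)) f) x.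
  by apply/funext => x; rewrite /laplacian sum3E.
by apply: CnD; [apply: CnD|]; exact: C.
Qed.

Lemma test_function_laplacian Omega (f : R3 R -> R) : test_function Omega f ->
  test_function Omega (laplacian f).
Proof.
move=> tf; have [C k s] := test_functionP tf.
have sub : supp (laplacian f) `<=` supp f.
  have -> : supp f = closure (supp f) by apply/closure_id; exact: closed_closure.
  apply: closure_subset => x /=; apply: contra_neqP => nfx.
  rewrite /laplacian big1// => i _; apply/eqP; apply: contra_notT nfx => H.
  by apply: (@supp_partial _ i f); apply: (@supp_partial _ i (partial i f));
    exact: supp_sub.
split; last exact: subset_trans s.
  by apply/smoothP => n; exact: (laplacian_Cn (C n.+2)).
by apply: (subclosed_compact _ k sub); exact: closed_closure.
Qed.

Lemma in_L_test_function Omega (f : R3 R -> R) k : test_function Omega f ->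
  (0 < k)%N -> ~~ odd k -> in_L Omega (k%:R%:E) f.
Proof.
move=> tf k0 ek; apply/in_LP => //; rewrite (patch_test_function tf); split.
  by apply: continuous_mfun3; exact: test_function_continuous tf.
exact: test_function_itgX tf k0.
Qed.

Variable Omega : set (R3 R).
Hypothesis oO : open Omega.
Variable u : R3 R -> R.
Hypothesis tu : test_function Omega u.

Lemma partial_integration i (phi : R3 R -> R) : test_function Omega phi ->
  \int[mu3 R]_x (u x * partial i phi x) = - \int[mu3 R]_x (partial i u x * phi x).
Proof.
move=> tp.
have [Cu ku _] := test_functionP tu; have [Cp kp _] := test_functionP tp.
have cu := test_function_continuous tu; have cp := test_function_continuous tp.
have cui := test_function_continuous (test_function_partial i tu).
have cpi := test_function_continuous (test_function_partial i tp).
have cM (f g : R3 R -> R) : continuous f -> continuous g -> continuous (fun x =>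
  f x * g x).
  by move=> cf cg x; apply: cvgM; [exact: cf|exact: cg].
have I1 : itg (fun x => u x * partial i phi x).
  by apply: continuous_itg; [exact: cM|apply: compact_supp_le ku => x ->;
    rewrite mul0r].
have I2 : itg (fun x => partial i u x * phi x).
  by apply: continuous_itg; [exact: cM|apply: compact_supp_le kp => x ->;
    rewrite mulr0].
have [_ J] := @int_partial R i (fun x => u x * phi x) (CnM (Cu 1%N) (Cp 1%N))
  (compact_supp_le (fun x (e : u x = 0) => etrans (congr1 ( *%R^~ (phi x)) e)
    (mul0r _)) ku).
have dP n (f : R3 R -> R) : Cn n.+1 f -> forall x, derivable f x (e3 R i).
  by move=> Cf x; exact: Cn_derivable Cf.
rewrite (partialM (dP 0%N _ (Cu 1%N)) (dP 0%N _ (Cp 1%N))) (intD I1 I2) in J.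
by apply/eqP; rewrite -addr_eq0 J.
Qed.

Lemma hatH01_test_function : hatH01 Omega u (grad u).
Proof.
split.
- exact: (@in_L_test_function _ _ 6 tu isT isT).
- by move=> i; exact: (@in_L_test_function _ _ 2 (test_function_partial i tu) isT isT).
- move=> phi i tp.
  have P1 := Rintegral_patch u (partial i phi) oO.
  have P2 := Rintegral_patch (partial i u) phi oO.
  rewrite (patch_test_function tu) in P1.
  rewrite (patch_test_function (test_function_partial i tu)) in P2.
  exact: (etrans P1 (etrans (partial_integration i tp) (congr1 -%R (esym P2)))).
- exists (fun=> u); split => //.
  + have -> : (fun x => u x - u x) = cst 0 by apply/funext => x; rewrite subrr.
    have -> : normL Omega 6%:E (cst 0) = 0%E.
      rewrite /normL (_ : cst 0 \_ Omega = cst 0) ?Lnorm0//.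
      by apply/funext => x; rewrite patchE; case: ifP.
    exact: cvg_cst.
  + have -> : euclid (fun i x => grad u i x - grad u i x) = cst 0.
      apply/funext => x; rewrite /euclid big1 ?sqrtr0// => i _.
      by rewrite subrr expr0n.
    have -> : normL Omega 2%:E (cst 0) = 0%E.
      rewrite /normL (_ : cst 0 \_ Omega = cst 0) ?Lnorm0//.
      by apply/funext => x; rewrite patchE; case: ifP.
    exact: cvg_cst.
Qed.

End test_function_norms.

(** * Distributional Laplacian and norms of test functions *)

Section test_function_distributions.
Context {R : realType}.
Variable Omega : set (R3 R).
Hypothesis oO : open Omega.
Variable u : R3 R -> R.
Hypothesis tu : test_function Omega u.

Lemma distr_laplacian_test_function : distr_laplacian Omega u (laplacian u).
Proof.
move=> phi tp.
have P1 := Rintegral_patch u (laplacian phi) oO.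
have P2 := Rintegral_patch (laplacian u) phi oO.
rewrite (patch_test_function tu) in P1.
rewrite (patch_test_function (test_function_laplacian tu)) in P2.
apply: (etrans P1); apply: (etrans _ (esym P2)).
have cM (f g : R3 R -> R) : test_function Omega f -> test_function Omega g ->
  itg (fun x => f x * g x).
  move=> tf tg; have [_ kf _] := test_functionP tf; apply: continuous_itg.
    move=> x; apply: cvgM; [exact: (test_function_continuous tf)|exact:
      (test_function_continuous tg)].
  by apply: compact_supp_le kf => x ->; rewrite mul0r.
have tpp i := test_function_partial i (test_function_partial i tp).
have tuu i := test_function_partial i (test_function_partial i tu).
have E1 : \int[mu3 R]_x (u x * laplacian phi x) =
  \sum_(i < 3) \int[mu3 R]_x (u x * partial i (partial i phi) x).
  rewrite -int_sum; last by move=> i; exact: cM.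
  by apply: eq_Rintegral => x _; rewrite /laplacian mulr_sumr.
have E2 : \int[mu3 R]_x (laplacian u x * phi x) =
  \sum_(i < 3) \int[mu3 R]_x (partial i (partial i u) x * phi x).
  rewrite -int_sum; last by move=> i; exact: cM.
  by apply: eq_Rintegral => x _; rewrite /laplacian mulr_suml.
rewrite E1 E2; apply: eq_bigr => i _.
have H1 := partial_integration tu i (test_function_partial i tp).
have H2 := partial_integration (test_function_partial i tu) i tp.
by rewrite H1 H2 opprK.
Qed.

Lemma normL2_grad_test_function : normL Omega 2%:E (euclid (grad u)) =
  (Num.sqrt (\int[mu3 R]_x (\sum_(i < 3) partial i u x ^+ 2)))%:E.
Proof.
have E : (fun x => (euclid (grad u) \_ Omega) x ^+ 2) = fun x =>
  \sum_(i < 3) partial i u x ^+ 2.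
  apply/funext => x; rewrite euclid_patch_sqr; apply: eq_bigr => i _.
  by rewrite (patch_test_function (test_function_partial i tu)).
rewrite /normL Lnorm_sqrt E//; apply: itg_sum => i.
exact: (@test_function_itgX _ _ _ 2 (test_function_partial i tu)).
Qed.

Lemma normL2_test_function : normL Omega 2%:E u =
  (Num.sqrt (\int[mu3 R]_x (u x ^+ 2)))%:E.
Proof.
rewrite /normL (patch_test_function tu) Lnorm_sqrt//.
exact: (@test_function_itgX _ _ _ 2 tu).
Qed.

(** If the essential supremum were smaller, continuity would make a nonempty open set null. *)
Lemma normLoo_test_function_ge x : Omega x -> ((u x)%:E <= normL Omega +oo u)%E.
Proof.
move=> Ox; rewrite /normL unlock (patch_test_function tu).
rewrite ifT; last by apply: mu3_open_gt0; [exact: openT|exists x].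
apply/lee_addgt0Pr => t t0; rewrite -leeBlDr//.
rewrite leNgt; apply/negP => H.
have /ess_supP : (ess_sup (mu3 R) (abse \o (EFin \o u)) <= (u x - t)%:E)%E.
  by rewrite EFinB ltW.
move=> [N [mN N0 sN]].
pose A := [set y | u x - t < u y].
have oA : open A.
  have := @open_comp _ _ u [set s | u x - t < s]; apply.
    by move=> y _; exact: (test_function_continuous tu).
  exact: open_gt.
have A0 : (0 < mu3 R A)%E.
  by apply: mu3_open_gt0 => //; exists x; rewrite /A/= ltrBlDr ltrDl.
have : (mu3 R A <= mu3 R N)%E.
  apply: le_measure; rewrite ?inE//; first exact: open_measurable3.
  move=> y Ay; apply: sN => /=; rewrite lee_fin => H'.
  by move: Ay; rewrite /A/= ltNge (le_trans (ler_norm _) H').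
by rewrite N0 leNgt A0.
Qed.

End test_function_distributions.

(** * The truncated kernel and its energy density *)

Section extremal.
Context {R : realType}.

(** For p = mu s the gradient of [h] is -D (x - a) / s^3. The last bound is the product of D <= p (1
    - E) and D <= (1 - E)^2, where E = exp(-p). *)
Lemma exp_defect (p : R) : 0 <= p -> let D := 1 - (p + 1) * expR (- p) in
  [/\ 0 <= D, D <= p ^+ 2 & D ^+ 2 <= p * (1 - expR (- p)) ^+ 3].
Proof.
move=> p0 D; set E := expR (- p) in D *.
have E0 : 0 <= E by exact: expR_ge0.
have E1 : 1 - p <= E by exact: expR_ge1Dx.
have E2 : E <= 1 by rewrite expR_le1 oppr_le0.
have E3 : (p + 1) * E <= 1.
  by rewrite /E expRN ler_pdivrMr ?expR_gt0// mul1r addrC expR_ge1Dx.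
have D0 : 0 <= D by rewrite subr_ge0.
have a0 : 0 <= 1 - E by rewrite subr_ge0.
have Da : D <= p * (1 - E) by rewrite /D; lra.
have Dq : D <= (1 - E) ^+ 2.
  rewrite -subr_ge0 (_ : _ - _ = E * (E - (1 - p))); last by rewrite /D; ring.
  by rewrite mulr_ge0// subr_ge0.
split => //.
  by rewrite (le_trans Da)// expr2 ler_wpM2l//; lra.
by rewrite expr2 (exprS _ 2) mulrA ler_pM.
Qed.

Variables (mu e k : R) (a : R3 R).
Hypotheses (m0 : 0 < mu) (e0 : 0 < e) (k0 : 0 < k).

Let h := regular mu e a.
Let gradh2 x := \sum_(i < 3) partial i h x ^+ 2.

Lemma Cn_regular n : Cn n h.
Proof.
rewrite /h /regular (_ : (fun x => _) = fun x => newton e a x + -1 * yukawa mu e a x).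
  by apply: CnD; [exact: Cn_newton|apply: CnM; [exact: Cn_cst|exact: Cn_yukawa]].
by apply/funext => x; rewrite /regular mulN1r.
Qed.

Lemma partial_regular i x :
  partial i h x = partial i (newton e a) x - partial i (yukawa mu e a) x.
Proof.
have dn : derivable (newton e a) x (e3 R i)
  by exact: (@Cn_derivable _ 0 _ i x (Cn_newton 1 a e0)).
have dy : derivable (yukawa mu e a) x (e3 R i)
  by exact: (@Cn_derivable _ 0 _ i x (Cn_yukawa 1 mu a e0)).
exact: deriveB.
Qed.

Lemma regularE x : h x = (1 - expR (- (mu * kdist e a x))) / kdist e a x.
Proof. by rewrite /h /regular yukawaE /newton mulrBl mul1r. Qed.

(* Keeps the second-derivative term of [laplacian_extremal] bounded by a multiple
   of [mu], uniformly up to the pole. *)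
Lemma regular_gradient_le x : gradh2 x <= mu * h x ^+ 3.
Proof.
have s0 := kdist_gt0 a x e0; set s := kdist e a x in s0.
have p0 : 0 <= mu * s by rewrite mulr_ge0// ltW.
have [D0 _ D2] := exp_defect p0.
set D := 1 - _ in D0 D2.
have -> : gradh2 x = sqnorm3 (x - a) / s ^+ 2 * (D ^+ 2 / s ^+ 4).
  rewrite /gradh2 sqnorm3E !mulr_suml; apply: eq_bigr => i _.
  rewrite partial_regular partial_newton// partial_yukawa// -/s /D.
  have -> : ek mu e (norm3 (x - a)) = expR (- (mu * s)) by [].
  by field; rewrite gt_eqF.
apply: (@le_trans _ _ (D ^+ 2 / s ^+ 4)).
  rewrite ler_piMl ?divr_ge0 ?sqr_ge0 ?exprn_ge0 ?(ltW s0)//.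
  by rewrite ler_pdivrMr ?exprn_gt0// mul1r kdist_sqr lerDl sqr_ge0.
rewrite regularE -/s.
have -> : mu * ((1 - expR (- (mu * s))) / s) ^+ 3 =
  (mu * s * (1 - expR (- (mu * s))) ^+ 3) / s ^+ 4.
  by field; rewrite gt_eqF.
by rewrite ler_pM2r// invr_gt0 exprn_gt0.
Qed.

Let err x := mu ^+ 2 * yukawa mu e a x + laplacian h x.

(** The error is purely an effect of [e]. The factor [b] below is O((mu s)^2), the lower orders in
    mu s cancelling between the two kernels, so the square is O(mu^4 e^4 / s^6). One factor e / s <=
    1 is given up to express it through [rho], whose mass is known, and the factor [e] that remains
    makes the integral small. *)
Lemma laplacian_regular_error x : err x ^+ 2 <= 48 * mu ^+ 4 * e * rho e a x.
Proof.
have gen (u v z : R) : 0 <= u -> u <= v -> 0 <= z -> z <= v ->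
    - (4 * v) <= 3 * u - z <= 4 * v.
  by move=> *; apply/andP; split; lra.
have sq4 (t : R) : (4 * t ^+ 2) ^+ 2 = 16 * t ^+ 4 by ring.
have le9 (u v : R) : 0 < v -> u <= v -> u <= 9 * v by move=> *; lra.
have s0 := kdist_gt0 a x e0; set s := kdist e a x in s0.
have es : e <= s by exact: kdist_ge.
have p0 : 0 <= mu * s by rewrite mulr_ge0// ltW.
have [D0 D1 _] := exp_defect p0.
set E := expR (- (mu * s)) in D0 D1.
have E0 : 0 <= E by exact: expR_ge0.
have E2 : E <= 1 by rewrite expR_le1 oppr_le0.
have Lh : laplacian h x = laplacian (newton e a) x - laplacian (yukawa mu e a) x.
  rewrite /laplacian -sumrB; apply: eq_bigr => i _.
  have -> : partial i h = fun x => partial i (newton e a) x - partial i (yukawa mu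
    e a) x.
    by apply/funext => y; exact: partial_regular.
  have dn := @Cn_derivable _ 0 _ i x (@Cn_partial _ 1 _ i (Cn_newton 2 a e0)).
  have dy := @Cn_derivable _ 0 _ i x (@Cn_partial _ 1 _ i (Cn_yukawa 2 mu a e0)).
  exact: deriveB.
pose b := 3 * (1 - (mu * s + 1) * E) - (mu * s) ^+ 2 * E.
have -> : err x = - (e ^+ 2 * b / s ^+ 5).
  rewrite /err Lh laplacian_newton// laplacian_yukawa// /yukawa -/(kdist e a x) -/s.
  have -> : ek mu e (norm3 (x - a)) = E by [].
  by rewrite /b; field; rewrite gt_eqF.
have q0 : 0 <= (mu * s) ^+ 2 by exact: sqr_ge0.
have b1 : `|b| <= 4 * (mu * s) ^+ 2.
  rewrite ler_norml /b; apply: gen => //; first exact: mulr_ge0.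
  by rewrite ler_piMr.
have b2 : b ^+ 2 <= 16 * (mu * s) ^+ 4.
  rewrite -real_normK ?num_real//.
  have := lerXn2r 2 (normr_ge0 b) (le_trans (normr_ge0 b) b1) b1.
  by rewrite sq4.
rewrite sqrrN !exprMn exprVn /rho -/s.
apply: (@le_trans _ _ ((e ^+ 2) ^+ 2 * (16 * (mu * s) ^+ 4) / (s ^+ 5) ^+ 2)).
  by rewrite ler_pM2r ?invr_gt0 ?exprn_gt0// ler_wpM2l// sqr_ge0.
have -> : (e ^+ 2) ^+ 2 * (16 * (mu * s) ^+ 4) / (s ^+ 5) ^+ 2 =
    16 * mu ^+ 4 * e ^+ 3 / s ^+ 5 * (e / s) by field; rewrite gt_eqF.
have -> : 48 * mu ^+ 4 * e * (3 * e ^+ 2 / s ^+ 5) = 16 * mu ^+ 4 * e ^+ 3 / s ^+ 5 * 9.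
  by field; rewrite gt_eqF.
rewrite ler_wpM2l//.
  by rewrite divr_ge0 ?mulr_ge0 ?exprn_ge0 ?(ltW m0) ?(ltW e0) ?(ltW s0).
by rewrite ler_pdivrMr//; exact: le9.
Qed.

(** The level 1/3 matches [ramp_derive2_le]: the shifted argument is then [k * h], whose cube
    cancels against the bound on the gradient of [h]. It also confines the support to
    [kdist e a x <= 3 * k]. *)
Definition extremal (x : R3 R) := ramp (k * h x - 3^-1).

Let w x := k * h x - 3^-1.

Lemma Cn_argument n : Cn n w.
Proof.
rewrite (_ : w = fun x => k * h x + (- 3^-1)).
  by apply: CnD; [apply: CnM; [exact: Cn_cst|exact: Cn_regular]|exact: Cn_cst].
by [].
Qed.

Lemma Cn_extremal n : Cn n extremal.
Proof. by apply: Cn_ramp; exact: Cn_argument. Qed.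

Lemma partial_argument i : partial i w = fun x => k * partial i h x.
Proof.
have d x : derivable h x (e3 R i) by exact: Cn_derivable (Cn_regular 1).
apply/funext => x.
have D : is_derive x (e3 R i) w (k *: partial i h x - 0).
  apply: is_deriveB; apply: is_deriveZ; exact/derivableP.
by have [_ E] := D; rewrite /partial E subr0.
Qed.

Lemma partial_extremal i :
  partial i extremal = fun x => flat (1 + 'X) (w x) * (k * partial i h x).
Proof.
have d x : derivable w x (e3 R i) by exact: Cn_derivable (Cn_argument 1).
have [_ ->] := @partial_comp R i ramp (flat (1 + 'X)) w d (fun x => is_derive_ramp _).
by rewrite partial_argument.
Qed.

Lemma laplacian_extremal x : laplacian extremal x =
  flat (1 + 'X) (w x) * (k * laplacian h x) + flat 'X^3 (w x) * (k ^+ 2 * gradh2 x).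
Proof.
rewrite /laplacian /gradh2 !mulr_sumr -big_split/=; apply: eq_bigr => i _.
rewrite partial_extremal.
have d y : derivable w y (e3 R i) by exact: Cn_derivable (Cn_argument 1).
have [d1 E1] := @partial_comp R i (flat (1 + 'X)) (flat 'X^3) w d (fun x =>
  is_derive_ramp_derive _).
have d2 y : derivable (partial i h) y (e3 R i).
  exact: (@Cn_derivable _ 0 _ i y (@Cn_partial _ 1 _ i (Cn_regular 2))).
have D2 y : is_derive y (e3 R i) (fun x => k * partial i h x) (k * partial i
  (partial i h) y).
  by apply: is_deriveZ; exact/derivableP.
have d3 y : derivable (fun x => k * partial i h x) y (e3 R i) by have [] := D2 y.
have E3 : partial i (fun x => k * partial i h x) x = k * partial i (partial i h) x.
  by have [] := D2 x.
rewrite (partialM d1 d3) E1 E3 partial_argument; congr (_ + _).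
by rewrite -mulrA; congr (_ * _); ring.
Qed.

Lemma argument_gt0 x : 0 < w x -> kdist e a x < 3 * k.
Proof.
have s0 := kdist_gt0 a x e0.
rewrite /w subr_gt0 regularE => H.
have : 3^-1 < k / kdist e a x.
  apply: (lt_le_trans H); rewrite mulrA ler_pM2r ?invr_gt0// ler_piMr ?(ltW k0)//.
by rewrite ltr_pdivlMr// mulrC ltr_pdivrMr// mulrC.
Qed.

(** Young's inequality with weight [th] separates the main part from two errors: the effect of [e],
    carried by [rho e], and the curvature of the truncation, carried by [rho 1]. *)
Lemma energy_density_le th x : 0 < th ->
  mu ^+ 2 * (\sum_(i < 3) partial i extremal x ^+ 2) + laplacian extremal x ^+ 2 <=
  (1 + th) * k ^+ 2 * mu ^+ 4 * radial_energy mu e (norm3 (x - a)) +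
  2 * (1 + th^-1) * (48 * k ^+ 2 * mu ^+ 4 * e) * rho e a x +
  2 * (1 + th^-1) * (mu ^+ 2 * (1 + 3 * k) ^+ 5 / k ^+ 2) * rho 1 a x.
Proof.
move=> th0.
set c := flat (1 + 'X) (w x).
have /andP[c0 c1] : 0 <= c <= 1 by exact: ramp_derive_itv.
have c2 : c ^+ 2 <= 1 by rewrite expr_le1.
have G0 : 0 <= gradh2 x by apply: sumr_ge0 => i _; exact: sqr_ge0.
have A1 : \sum_(i < 3) partial i extremal x ^+ 2 <= k ^+ 2 * gradh2 x.
  under eq_bigr => i _ do rewrite partial_extremal -/c !exprMn.
  rewrite -!mulr_sumr ler_piMl// mulr_ge0 ?sqr_ge0//.
set r := flat 'X^3 (w x) * (k ^+ 2 * gradh2 x).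
have r2 : r ^+ 2 <= mu ^+ 2 * (1 + 3 * k) ^+ 5 / k ^+ 2 * rho 1 a x.
  have Q0 : 0 <= mu ^+ 2 * (1 + 3 * k) ^+ 5 / k ^+ 2 * rho 1 a x.
    rewrite mulr_ge0 ?rho_ge0// divr_ge0 ?sqr_ge0// mulr_ge0 ?sqr_ge0// exprn_ge0//
      addr_ge0// mulr_ge0// ltW//.
  have [w0|w0] := ltP 0 (w x); last by rewrite /r /flat ltNge w0/= mul0r expr0n.
  have [F0 F1] := ramp_derive2_le (w x); have {}F1 := F1 w0.
  (* The cube of k h from the gradient bound cancels against the decay of the second derivative of
     [ramp], so no singularity is left at the pole. *)
  have rm : r <= mu / k.
    apply: (@le_trans _ _ (flat 'X^3 (w x) * (k ^+ 2 * (mu * h x ^+ 3)))).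
      by rewrite ler_wpM2l// ler_wpM2l ?sqr_ge0// regular_gradient_le.
    have -> : flat 'X^3 (w x) * (k ^+ 2 * (mu * h x ^+ 3)) =
        mu / k * (flat 'X^3 (w x) * (w x + 3^-1) ^+ 3).
      by rewrite /w subrK; field; rewrite gt_eqF.
    by rewrite ler_piMr// divr_ge0// ltW.
  have r0 : 0 <= r by rewrite mulr_ge0// mulr_ge0// sqr_ge0.
  have rr : r ^+ 2 <= (mu / k) ^+ 2 by rewrite lerXn2r ?nnegrE// divr_ge0// ltW.
  apply: (le_trans rr).
  (* On the support [rho 1] is bounded below by 3 / (1 + 3 k)^5, so the constant bound on [r] can be
     integrated through the known mass of [rho 1]. *)
  have sk : kdist 1 a x <= 1 + 3 * k.
    have N0 : 0 <= norm3 (x - a) by exact: sqrtr_ge0.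
    have K0 : 0 <= 1 + 3 * k by rewrite addr_ge0// mulr_ge0// ltW.
    have Nk : norm3 (x - a) <= 3 * k.
      apply: le_trans (ltW (argument_gt0 w0));
        rewrite /kdist -[leLHS](ger0_norm N0) -sqrtr_sqr.
      by rewrite ler_wsqrtr// lerDl sqr_ge0.
    rewrite kdistE -sqr_norm3 -[leRHS](ger0_norm K0) -sqrtr_sqr ler_wsqrtr//.
    have : norm3 (x - a) ^+ 2 <= (3 * k) ^+ 2 by rewrite lerXn2r ?nnegrE//
      mulr_ge0// ltW.
    by move: k0; rewrite expr1n; nra.
  have s0 : 0 < kdist 1 a x by exact: kdist_gt0.
  have S : kdist 1 a x ^+ 5 <= (1 + 3 * k) ^+ 5.
    by rewrite lerXn2r ?nnegrE ?(ltW s0)// (le_trans (ltW s0) sk).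
  rewrite /rho expr1n mulr1.
  have -> : mu ^+ 2 * (1 + 3 * k) ^+ 5 / k ^+ 2 * (3 / kdist 1 a x ^+ 5) =
     (mu / k) ^+ 2 * (3 * ((1 + 3 * k) ^+ 5 / kdist 1 a x ^+ 5)).
    by field; rewrite !gt_eqF.
  rewrite ler_peMr ?sqr_ge0//.
  have : 1 <= (1 + 3 * k) ^+ 5 / kdist 1 a x ^+ 5
    by rewrite ler_pdivlMr ?exprn_gt0// mul1r.
  by move: (_ / _) => ? ?; lra.
have L : laplacian extremal x = - (c * k * mu ^+ 2 * yukawa mu e a x) +
  (c * k * err x + r).
  by rewrite laplacian_extremal -/c -/r /err; ring.
have E2 := laplacian_regular_error x.
have young (X Y : R) : (X + Y) ^+ 2 <= (1 + th) * X ^+ 2 + (1 + th^-1) * Y ^+ 2.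
  rewrite -subr_ge0 (_ : _ - _ = (th * X - Y) ^+ 2 / th); last by field; rewrite gt_eqF.
  by rewrite divr_ge0 ?sqr_ge0// ltW.
have twice (X Y : R) : (X + Y) ^+ 2 <= 2 * (X ^+ 2 + Y ^+ 2).
  rewrite -subr_ge0 (_ : _ - _ = (X - Y) ^+ 2); last by ring.
  exact: sqr_ge0.
have i0 : 0 <= 1 + th^-1 by rewrite addr_ge0// invr_ge0 ltW.
have Y1 : (- (c * k * mu ^+ 2 * yukawa mu e a x)) ^+ 2 <=
  k ^+ 2 * mu ^+ 4 * yukawa mu e a x ^+ 2.
  rewrite [leLHS](_ : _ = c ^+ 2 * (k ^+ 2 * mu ^+ 4 * yukawa mu e a x ^+ 2));
    last by ring.
  by rewrite ler_piMl// mulr_ge0 ?sqr_ge0// mulr_ge0 ?sqr_ge0// exprn_even_ge0.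
have Y2 : (c * k * err x) ^+ 2 <= 48 * k ^+ 2 * mu ^+ 4 * e * rho e a x.
  rewrite [leLHS](_ : _ = c ^+ 2 * (k ^+ 2 * err x ^+ 2)); last by ring.
  apply: (@le_trans _ _ (k ^+ 2 * err x ^+ 2));
    first by rewrite ler_piMl// mulr_ge0 ?sqr_ge0.
  have := ler_wpM2l (sqr_ge0 k) E2; move/le_trans; apply.
  by rewrite le_eqVlt; apply/orP; left; apply/eqP; ring.
have RE : radial_energy mu e (norm3 (x - a)) = gradh2 x / mu ^+ 2 +
  yukawa mu e a x ^+ 2.
  rewrite radial_energyE// /gradh2 mulr_suml; congr (_ + _); apply: eq_bigr => i _.
  by rewrite partial_regular exprMn exprVn.
rewrite L RE.
apply: (@le_trans _ _ (mu ^+ 2 * (k ^+ 2 * gradh2 x) + ((1 +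
  th) * (k ^+ 2 * mu ^+ 4 * yukawa mu e a x ^+ 2)
   + (1 + th^-1) * (2 * (48 * k ^+ 2 * mu ^+ 4 * e * rho e a x + mu ^+ 2 * (1 +
     3 * k) ^+ 5 / k ^+ 2 * rho 1 a x))))).
  apply: lerD; first by rewrite ler_wpM2l ?sqr_ge0.
  apply: (le_trans (young _ _)); apply: lerD.
    by rewrite ler_wpM2l// addr_ge0// ltW.
  rewrite ler_wpM2l//; apply: (le_trans (twice _ _)); rewrite ler_wpM2l//.
  by apply: lerD.
have -> : (1 + th) * k ^+ 2 * mu ^+ 4 * (gradh2 x / mu ^+ 2 + yukawa mu e a x ^+ 2) =
    mu ^+ 2 * (k ^+ 2 * gradh2 x) + th * (mu ^+ 2 * (k ^+ 2 * gradh2 x)) +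
    (1 + th) * (k ^+ 2 * mu ^+ 4 * yukawa mu e a x ^+ 2).
  by field; rewrite gt_eqF.
have : 0 <= th * (mu ^+ 2 * (k ^+ 2 * gradh2 x)).
  by rewrite mulr_ge0 ?(ltW th0)// mulr_ge0 ?sqr_ge0// mulr_ge0 ?sqr_ge0.
set T := th * _ => T0.
rewrite -subr_ge0 (_ : _ - _ = T)//; ring.
Qed.

End extremal.

(** * Sharpness of the constant in every open set *)

Section optimality.
Context {R : realType}.

Lemma compact_supp_closed (D : set (R3 R)) (f : R3 R -> R) (M : R) : closed D ->
  D `<=` cube M -> (forall x, f x != 0 -> D x) -> compact (supp f) /\ supp f `<=` D.
Proof.
move=> cD DM fD.
have sD : supp f `<=` D.
  by rewrite [X in _ `<=` X](closure_id _).1//; apply: closure_subset => x; exact: fD.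
split => //; apply: (@subclosed_compact _ _ (cube M)).
- exact: closed_closure.
- by apply: compact_setX; [apply: compact_setX|]; exact: segment_compact.
- exact: subset_trans DM.
Qed.

Lemma test_function_extremal (Omega : set (R3 R)) (a : R3 R) (r k mu e : R) :
  0 < k -> 3 * k < r -> 0 < mu -> 0 < e -> ball a r `<=` Omega ->
  test_function Omega (extremal mu e k a).
Proof.
move=> k0 kr m0 e0 HO.
pose D := [set x : R3 R | `|x - a| <= 3 * k].
have cD : closed D.
  have := @closed_comp _ _ (fun x : R3 R => `|x - a|) [set s | s <= 3 * k]; apply.
    move=> x _; apply: (@continuous_comp _ _ _ (fun x : R3 R =>
      x - a) (fun y : R3 R => `|y|)).
      by apply: cvgB; [exact: cvg_id|exact: cvg_cst].
    exact: norm_continuous.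
  exact: closed_le.
have DM : D `<=` cube (`|a| + 3 * k).
  move=> x Dx; apply/cubeP; rewrite -(subrK a x) addrC.
  by rewrite (le_trans (ler_normD _ _))// lerD2l.
have fD x : extremal mu e k a x != 0 -> D x.
  move=> ux.
  have w0 : 0 < k * regular mu e a x - 3^-1.
    by move: ux; rewrite /extremal /ramp; case: ifPn => //; rewrite eqxx.
  have Hs := ltW (argument_gt0 e0 k0 w0).
  have Hi i : `|coord3 i (x - a)| <= 3 * k
    by exact: le_trans (coord3_sqr_le a x i e0) Hs.
  rewrite /D/= !prod_normE !ge_max -!andbA.
  by have := Hi ord0; have := Hi (lift ord0 ord0); have :=
    Hi (lift ord0 (lift ord0 ord0));
    rewrite /coord3/= => -> -> ->.
have [kc sc] := compact_supp_closed cD DM fD.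
split => //; first by apply/smoothP => n; exact: Cn_extremal.
apply: subset_trans sc _ => x Dx; apply: HO.
by rewrite -ball_normE/= distrC (le_lt_trans Dx).
Qed.

(** The choice e = mu^-2 turns the error of size mu^4 e into mu^2, below the main order mu^3, while
    mu e = 1 / mu still tends to 0, as the height of the peak requires. *)
Lemma extremal_energy_le (Omega : set (R3 R)) (a : R3 R) (k mu th : R) :
  0 < k -> 0 < mu -> 0 < th -> test_function Omega (extremal mu (mu ^- 2) k a) ->
  let u := extremal mu (mu ^- 2) k a in
  mu ^+ 2 * \int[mu3 R]_x (\sum_(i < 3) partial i u x ^+ 2) +
    \int[mu3 R]_x (laplacian u x ^+ 2) <=
  4 * pi * ((1 + th) * k ^+ 2 * mu ^+ 3 +
    2 * (1 + th^-1) * (48 * k ^+ 2 + (1 + 3 * k) ^+ 5 / k ^+ 2) * mu ^+ 2).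
Proof.
move=> k0 m0 th0 tu; cbv zeta; set u := extremal _ _ _ _.
have e0 : 0 < mu ^- 2 by rewrite invr_gt0 exprn_gt0.
have Ig : itg (fun x => \sum_(i < 3) partial i u x ^+ 2).
  by apply: itg_sum => i; exact: (@test_function_itgX _ _ _ 2
    (test_function_partial i tu)).
have Il : itg (fun x => laplacian u x ^+ 2).
  exact: (@test_function_itgX _ _ _ 2 (test_function_laplacian tu)).
have [I1 J1] := itg_radial_energy a m0 e0.
have [I2 J2] := int_rho a e0.
have [I3 J3] := int_rho a (ltr01 : 0 < (1 : R)).
set c1 := (1 + th) * k ^+ 2 * mu ^+ 4.
set c2 := 2 * (1 + th^-1) * (48 * k ^+ 2 * mu ^+ 4 * mu ^- 2).
set c3 := 2 * (1 + th^-1) * (mu ^+ 2 * (1 + 3 * k) ^+ 5 / k ^+ 2).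
have H : \int[mu3 R]_x (mu ^+ 2 * (\sum_(i < 3) partial i u x ^+ 2) +
  laplacian u x ^+ 2) <=
  \int[mu3 R]_x (c1 * radial_energy mu (mu ^- 2) (norm3 (x - a)) +
    c2 * rho (mu ^- 2) a x + c3 * rho 1 a x).
  apply: int_le.
  - by apply: itgD => //; exact: itgZ.
  - by apply: itgD; [apply: itgD|]; exact: itgZ.
  - by move=> x; exact: energy_density_le.
rewrite (intD (itgZ (mu ^+ 2) Ig) Il) (intZ (mu ^+ 2) Ig) in H.
rewrite (intD (itgD (itgZ c1 I1) (itgZ c2 I2)) (itgZ c3 I3)) (intD (itgZ c1 I1)
  (itgZ c2 I2)) in H.
rewrite (intZ c1 I1) (intZ c2 I2) (intZ c3 I3) J2 J3 in H.
apply: (le_trans H).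
have c10 : 0 <= c1.
  by rewrite /c1 mulr_ge0 ?exprn_even_ge0// mulr_ge0 ?sqr_ge0// addr_ge0// ltW.
have := ler_wpM2l c10 J1.
move: (\int[mu3 R]_x _) => z Hz.
have gen (p : R) : c1 * (4 * p / mu) + c2 * (4 * p) + c3 * (4 * p) =
   4 * p * ((1 + th) * k ^+ 2 * mu ^+ 3 +
    2 * (1 + th^-1) * (48 * k ^+ 2 + (1 + 3 * k) ^+ 5 / k ^+ 2) * mu ^+ 2).
  by rewrite /c1 /c2 /c3; field; rewrite !gt_eqF.
by rewrite -gen !lerD2r.
Qed.

(** The peak of [regular] loses at most 1 against [mu], which costs [k]; the truncation level costs
    1/3 and [ramp_ge] costs 1. *)
Lemma extremal_center_ge (a : R3 R) (k mu : R) : 0 < k -> 0 < mu ->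
  k * mu - (k + 4 / 3) <= extremal mu (mu ^- 2) k a a.
Proof.
move=> k0 m0.
have e0 : 0 < mu ^- 2 by rewrite invr_gt0 exprn_gt0.
apply: le_trans (ramp_ge _).
rewrite regularE //.
have -> : kdist (mu ^- 2) a a = mu ^- 2.
  rewrite kdistE subrr (_ : sqnorm3 0 = 0) ?add0r ?sqrtr_sqr ?gtr0_norm//.
  by rewrite /sqnorm3/= expr0n !addr0.
have -> : mu * mu ^- 2 = mu^-1 by field; rewrite gt_eqF.
have H : mu - 1 <= (1 - expR (- mu^-1)) / mu ^- 2.
  rewrite invrK.
  have p0 : 0 < 1 + mu^-1 by rewrite addr_gt0// invr_gt0.
  have E : expR (- mu^-1) <= (1 + mu^-1)^-1.
    by rewrite expRN lef_pV2 ?posrE ?expR_gt0// expR_ge1Dx.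
  apply: (@le_trans _ _ ((1 - (1 + mu^-1)^-1) * mu ^+ 2)).
    have -> : (1 - (1 + mu^-1)^-1) * mu ^+ 2 = mu ^+ 2 / (mu + 1).
      by field; rewrite !gt_eqF// addr_gt0.
    rewrite ler_pdivlMr ?addr_gt0//.
    by rewrite -subr_ge0 (_ : _ - _ = 1) ?ler01//; ring.
  by rewrite ler_wpM2r ?sqr_ge0// lerD2l lerN2.
have := ler_wpM2l (ltW k0) H; move: (k * (_ / _)) => z; lra.
Qed.

Lemma sup_constant_optimal (Omega : set (R3 R)) (C : R) : open Omega -> Omega !=set0 ->
  C < (Num.sqrt (2 * pi))^-1 ->
  exists (u : R3 R -> R) (Du : 'I_3 -> R3 R -> R) (Lu : R3 R -> R),
    [/\ hatH01 Omega u Du, distr_laplacian Omega u Lu, in_L Omega 2%:E Lu &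
      (C%:E * normL Omega 2%:E (euclid Du) `^ (2^-1)
         * normL Omega 2%:E Lu `^ (2^-1) < normL Omega +oo u)%E].
Proof.
move=> oO [a Oa] C1.
have p0 := pi_gt0 R.
have S0 : 0 < (Num.sqrt (2 * pi))^-1 :> R by rewrite invr_gt0 sqrtr_gt0 mulr_gt0.
(* [C] may be zero or negative; raising it keeps it below the constant and makes it positive. *)
pose c := Num.max C ((Num.sqrt (2 * pi))^-1 / 2).
have c0 : 0 < c by rewrite lt_max divr_gt0 ?orbT.
have cS : c < (Num.sqrt (2 * pi))^-1.
  by rewrite gt_max C1/= ltr_pdivrMr// ltr_pMr// ltr1n.
have Cc : C <= c by rewrite le_max lexx.
pose kap := 2 * pi * c ^+ 2.
have kap0 : 0 < kap by rewrite /kap mulr_gt0 ?exprn_gt0// mulr_gt0.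
have kap1 : kap < 1.
  rewrite /kap mulrC -ltr_pdivlMr ?mulr_gt0// div1r.
  have -> : (2 * pi : R)^-1 = (Num.sqrt (2 * pi))^-1 ^+ 2.
    by rewrite exprVn sqr_sqrtr// mulr_ge0// ltW.
  by rewrite ltrXn2r ?nnegrE ?(ltW c0) ?(ltW S0).
have [r /= r0 Hr] := (nbhs_ballP _ _).1 (open_nbhs_nbhs (conj oO Oa)).
pose k := r / 4.
have k0 : 0 < k by rewrite divr_gt0.
have kr : 3 * k < r.
  have r0' : 0 < r := r0; rewrite /k; lra.
(* With this value kap (1 + th) = (1 + kap) / 2, so half of the gap 1 - kap remains for the
   lower-order terms. *)
pose th := (1 - kap) / (2 * kap).
have th0 : 0 < th by rewrite divr_gt0 ?subr_gt0// mulr_gt0.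
pose Q := 2 * (1 + th^-1) * (48 * k ^+ 2 + (1 + 3 * k) ^+ 5 / k ^+ 2).
have Q0 : 0 < Q.
  have q1 : 0 < 1 + th^-1 by rewrite addr_gt0// invr_gt0.
  have q2 : 0 < 1 + 3 * k by rewrite addr_gt0// mulr_gt0.
  apply: mulr_gt0; first exact: mulr_gt0.
  apply: addr_gt0; first by rewrite mulr_gt0// exprn_gt0.
  by rewrite divr_gt0// exprn_gt0.
pose b := k + 4 / 3.
have b0 : 0 < b by rewrite addr_gt0// divr_gt0.
pose d := (1 - kap) / 2 * k ^+ 2.
have d0 : 0 < d by rewrite mulr_gt0 ?exprn_gt0// divr_gt0// subr_gt0.
(* The first summand makes the reserve d mu^2 exceed all terms linear in mu; the second makes the
   lower bound k mu - b of the peak positive. *)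
pose mu := (Q + 2 * k * b) / d + b / k.
have m0 : 0 < mu.
  rewrite addr_gt0 ?divr_gt0// addr_gt0// mulr_gt0// mulr_gt0//.
have mub : b < k * mu.
  have -> : k * mu = k * ((Q + 2 * k * b) / d) + b
    by rewrite /mu mulrDr [k * (b / k)]mulrC divfK// gt_eqF.
  by rewrite ltrDr mulr_gt0// divr_gt0// addr_gt0// mulr_gt0// mulr_gt0.
have mud : Q + 2 * k * b < d * mu.
  have -> : d * mu = (Q + 2 * k * b) + d * (b / k)
    by rewrite /mu mulrDr [d * (_ / d)]mulrC divfK// gt_eqF.
  by rewrite ltrDl mulr_gt0// divr_gt0.
have e0 : 0 < mu ^- 2 by rewrite invr_gt0 exprn_gt0.
pose u := extremal mu (mu ^- 2) k a.
have tu : test_function Omega u by exact: test_function_extremal Hr.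
exists u, (grad u), (laplacian u); split.
- exact: hatH01_test_function.
- exact: distr_laplacian_test_function.
- exact: (@in_L_test_function _ _ _ 2 (test_function_laplacian tu)).
rewrite (normL2_grad_test_function tu) (normL2_test_function
  (test_function_laplacian tu)).
apply: lt_le_trans (normLoo_test_function_ge tu Oa).
have := extremal_energy_le k0 m0 th0 tu; rewrite /= -/u -/Q.
have G0 : 0 <= \int[mu3 R]_x (\sum_(i < 3) partial i u x ^+ 2).
  by apply: int_ge0 => x; apply: sumr_ge0 => i _; exact: sqr_ge0.
have L0 : 0 <= \int[mu3 R]_x (laplacian u x ^+ 2).
  by apply: int_ge0 => x; exact: sqr_ge0.
move: G0 L0.
move: (\int[mu3 R]_x (\sum_(i < 3) partial i u x ^+ 2)) => G.
move: (\int[mu3 R]_x (laplacian u x ^+ 2)) => L G0 L0 D.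
have U1 := extremal_center_ge a k0 m0; rewrite -/u -/b in U1.
rewrite /= !powR12_sqrt ?sqrtr_ge0// -!EFinM lte_fin.
set A := Num.sqrt G; set B := Num.sqrt L.
have A0 : 0 <= A by exact: sqrtr_ge0.
have B0 : 0 <= B by exact: sqrtr_ge0.
have A2 : A ^+ 2 = G by rewrite sqr_sqrtr.
have B2 : B ^+ 2 = L by rewrite sqr_sqrtr.
apply: (@le_lt_trans _ _ (c * Num.sqrt A * Num.sqrt B)).
  by rewrite ler_wpM2r ?sqrtr_ge0// ler_wpM2r ?sqrtr_ge0.
have U0 : 0 < k * mu - b by rewrite subr_gt0.
apply: lt_le_trans U1.
rewrite -(@ltr_pXn2r _ 2) ?nnegrE ?(ltW U0)//; last first.
  by rewrite mulr_ge0 ?sqrtr_ge0// mulr_ge0 ?sqrtr_ge0// ltW.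
rewrite !exprMn !sqr_sqrtr//.
(* The passage from the weighted sum to the product of the norms, asymptotically sharp because [mu]
   is the optimal weight for [h]. *)
have AB : 2 * mu * (A * B) <= mu ^+ 2 * G + L.
  rewrite -A2 -B2 -subr_ge0 (_ : _ - _ = (mu * A - B) ^+ 2); last by ring.
  exact: sqr_ge0.
have E1 : c ^+ 2 * A * B <= kap * ((1 + th) * k ^+ 2 * mu ^+ 2 + Q * mu).
  have X := le_trans AB D.
  rewrite -(@ler_pM2l _ (2 * mu)) ?mulr_gt0//.
  have -> : 2 * mu * (c ^+ 2 * A * B) = c ^+ 2 * (2 * mu * (A * B)) by ring.
  apply: (le_trans (ler_wpM2l (sqr_ge0 c) X)).
  by rewrite le_eqVlt; apply/orP; left; apply/eqP; rewrite /kap; ring.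
apply: (le_lt_trans E1).
have -> : kap * ((1 + th) * k ^+ 2 * mu ^+ 2 + Q * mu) =
  k ^+ 2 * mu ^+ 2 - d * mu * mu + kap * Q * mu.
  by rewrite /th /d; field; rewrite gt_eqF.
have KQ : kap * Q * mu <= Q * mu by rewrite ler_pM2r// ler_piMl// ltW.
have X2 : (Q + 2 * k * b) * mu < d * mu * mu by rewrite ltr_pM2r.
have -> : (k * mu - b) ^+ 2 = k ^+ 2 * mu ^+ 2 - 2 * k * b * mu + b ^+ 2 by ring.
have bb : 0 < b ^+ 2 by rewrite exprn_gt0.
rewrite mulrDl in X2.
have gen (x y z q s t : R) : y <= z -> z + s < q -> 0 < t -> x - q + y < x - s + t.
  by move=> *; lra.
exact: gen KQ X2 bb.
Qed.

End optimality.

Theorem theorem1 (R : realType) (Omega : set (R3 R))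
    (Omega_open : open Omega) (Omega_neq0 : Omega !=set0) :
  (forall (u : R3 R -> R) (Du : 'I_3 -> R3 R -> R) (Lu : R3 R -> R),
     hatH01 Omega u Du -> distr_laplacian Omega u Lu -> in_L Omega 2%:E Lu ->
     (normL Omega +oo u <=
        ((Num.sqrt (2 * pi))^-1)%:E * normL Omega 2%:E (euclid Du) `^ (2^-1)
          * normL Omega 2%:E Lu `^ (2^-1))%E) /\
  (forall C : R, C < (Num.sqrt (2 * pi))^-1 ->
     exists (u : R3 R -> R) (Du : 'I_3 -> R3 R -> R) (Lu : R3 R -> R),
       [/\ hatH01 Omega u Du, distr_laplacian Omega u Lu, in_L Omega 2%:E Lu &
         (C%:E * normL Omega 2%:E (euclid Du) `^ (2^-1)
            * normL Omega 2%:E Lu `^ (2^-1) < normL Omega +oo u)%E]).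
Proof.
split; first by move=> u Du Lu Hu HL LL; exact: sup_norm_le.
by move=> C HC; exact: sup_constant_optimal.
Qed.
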